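(* Fix any sequence $(H_n, n\ge 1)$ of connected graphs with $H_n$ being a spanning subgraph of $K_n$. Let $\mathbb{K}_n=(K_n,\mathbb{X})$ be the complete graph on $[n]$ with independent Uniform$[0,1]$ edge weights. Then for any $\varepsilon>0$, as $n\to\infty$: (a) with high probability there exists an MST sequence $\mathbb{S}$ for $(\mathbb{K}_n,H_n)$ with $\operatorname{wt}(\mathbb{K}_n,H_n,\mathbb{S})\le 1+\varepsilon$; and (b) there exists $\delta>0$ such that with high probability, given any optimizing sequence $\mathbb{S}=(S_1,\ldots,S_m)$ for $(\mathbb{K}_n,H_n)$ with $\operatorname{wt}(\mathbb{K}_n,H_n,\mathbb{S})\le 1-\varepsilon$, the final spanning subgraph $H_{n,m}$ has weight $w(H_{n,m})\ge \delta\, n\, w(\mathrm{MST}(\mathbb{K}_n))$. In particular, $\operatorname{cost}(\mathbb{K}_n,H_n)\to 1$ in probability as $n\to\infty$.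
   Context: $K_n$ is the complete graph with vertex set $[n]=\{1,\ldots,n\}$, and $\mathbb{K}_n=(K_n,\mathbb{X})$ where $\mathbb{X}=(X_e, e\in E(K_n))$ are independent Uniform$[0,1]$ random variables, used as edge weights $w(e)=X_e$ (almost surely pairwise distinct, so minimum spanning trees are unique). The sequence $(H_n)$ is deterministic. For a subgraph $F$, $w(F)=\sum_{e\in E(F)}w(e)$. A sequence of events $(E_n)$ occurs with high probability if $\mathbb{P}(E_n)\to1$. Let $\mathbb{G}=(V,E,w)$ be a finite connected weighted graph with underlying graph $G=(V,E)$, positive edge weights, and a unique minimum spanning tree $\mathrm{MST}(\mathbb{G})$. For $S\subset V$, $G[S]$ is the induced subgraph on $S$ and $\mathbb{G}[S]$ is the induced weighted subgraph. For a spanning subgraph $H$ of $G$ and $S\subset V$, define $\Phi_{\mathbb{G}}(H,S)$: if the induced subgraph $H[S]$ is connected, it is the spanning subgraph with edge set $(E(H)\setminus E(H[S]))\cup E(\mathrm{MST}(\mathbb{G}[S]))$; otherwise it is $H$. Any finite sequence $\mathbb{S}=(S_1,\ldots,S_m)$ of subsets of $V$ is called an optimizing sequence for $(\mathbb{G},H)$; its subgraph sequence $(H_0,\ldots,H_m)$ is defined by $H_0=H$ and $H_i=\Phi_{\mathbb{G}}(H_{i-1},S_i)$. It is an MST sequence for $(\mathbb{G},H)$ if $H_m=\mathrm{MST}(\mathbb{G})$. Its weight is $\operatorname{wt}(\mathbb{G},H,\mathbb{S})=\max_{1\le i\le m} w(H_{i-1}[S_i])$, and $\operatorname{cost}(\mathbb{G},H)=\min\{\operatorname{wt}(\mathbb{G},H,\mathbb{S}):\mathbb{S}\text{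 is an MST sequence for }(\mathbb{G},H)\}$. For $(\mathbb{K}_n,H_n)$ the subgraph sequence is written $H_{n,0}=H_n$, $H_{n,i}=\Phi_{\mathbb{K}_n}(H_{n,i-1},S_i)$. *)

(* Defs.v *)
From HB Require Import structures.
From mathcomp Require Import all_boot all_order all_algebra.
From mathcomp Require Import all_classical all_reals all_analysis.

Set Implicit Arguments.
Unset Strict Implicit.
Unset Printing Implicit Defensive.

Import Order.TTheory GRing.Theory Num.Theory.
Import numFieldNormedType.Exports.

Local Open Scope classical_set_scope.
Local Open Scope ring_scope.

(* A simple graph on the finite vertex type [V] is given by its edge set, a set
   of 2-element subsets of [V]; spanning subgraphs of G are subsets of E(G).
   An edge-weighted graph is a pair (E, w); [w] is a total function on {set V},
   of which only the values on the edges matter. *)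

Definition complete_graph (n : nat) : {set {set 'I_n}} :=
  [set e : {set 'I_n} | #|e| == 2%N]%SET.

Definition induced (V : finType) (E : {set {set V}}) (S : {set V})
    : {set {set V}} :=
  [set e in E | e \subset S]%SET.

Definition adj (V : finType) (E : {set {set V}}) : rel V :=
  fun x y => [set x; y]%SET \in E.

(* Connectedness of the graph with vertex set [S] and edge set [E], for [E]
   consisting of edges inside [S].  The empty graph counts as connected; this
   has no effect on [phi] below, since phi H set0 = H either way. *)
Definition connected_on (V : finType) (S : {set V}) (E : {set {set V}}) : bool :=
  [forall x in S, forall y in S, connect (adj E) x y].

(* [ucycle] allows cycles x, y of length 2, which traverse an edge back and
   forth. *)
Definition acyclic (V : finType) (E : {set {set V}}) : Prop :=
  forall c : seq V, ucycle (adj E) c -> (size c <= 2)%N.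

Definition weight (R : realType) (V : finType) (w : {set V} -> R)
    (F : {set {set V}}) : R :=
  \sum_(e in F) w e.

Definition spanning_tree (V : finType) (E : {set {set V}}) (S : {set V})
    (T : {set {set V}}) : Prop :=
  [/\ T \subset induced E S, connected_on S T & acyclic T].

Definition is_mst (R : realType) (V : finType) (E : {set {set V}})
    (w : {set V} -> R) (S : {set V}) (T : {set {set V}}) : Prop :=
  spanning_tree E S T /\
  forall T', spanning_tree E S T' -> weight w T <= weight w T'.

(* The edge set of MST(G[S]).  It is the minimum spanning tree when that is
   unique; when weights are tied it is an arbitrary minimizer, and it is the
   empty set when G[S] is disconnected. *)
Definition mst (R : realType) (V : finType) (E : {set {set V}})
    (w : {set V} -> R) (S : {set V}) : {set {set V}} :=
  xget finset.set0 (is_mst E w S).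

Definition phi (R : realType) (V : finType) (E : {set {set V}})
    (w : {set V} -> R) (H : {set {set V}}) (S : {set V}) : {set {set V}} :=
  if connected_on S (induced H S)
  then ((H :\: induced H S) :|: mst E w S)%SET
  else H.

(* Since sequences are indexed from 0, the term H_i is followed by the set
   S_(i+1) = [nth set0 Ss i]. *)
Definition subgraph_seq (R : realType) (V : finType) (E : {set {set V}})
    (w : {set V} -> R) (H : {set {set V}}) (Ss : seq {set V}) (i : nat)
    : {set {set V}} :=
  foldl (phi E w) H (take i Ss).

Definition final_subgraph (R : realType) (V : finType) (E : {set {set V}})
    (w : {set V} -> R) (H : {set {set V}}) (Ss : seq {set V})
    : {set {set V}} :=
  subgraph_seq E w H Ss (size Ss).

Definition mst_sequence (R : realType) (V : finType) (E : {set {set V}})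
    (w : {set V} -> R) (H : {set {set V}}) (Ss : seq {set V}) : Prop :=
  final_subgraph E w H Ss = mst E w [set: V]%SET.

(* The weights are nonnegative, so starting the maximum at 0 only fixes the
   value 0 for the empty sequence (also the value for the sequence (set0)). *)
Definition seq_weight (R : realType) (V : finType) (E : {set {set V}})
    (w : {set V} -> R) (H : {set {set V}}) (Ss : seq {set V}) : R :=
  \big[Num.max/0]_(i < size Ss)
    weight w (induced (subgraph_seq E w H Ss i) (nth finset.set0 Ss i)).

Definition is_minimum (R : realType) (A : set R) (c : R) : Prop :=
  A c /\ forall x, A x -> c <= x.

Definition cost (R : realType) (V : finType) (E : {set {set V}})
    (w : {set V} -> R) (H : {set {set V}}) : R :=
  xget 0 (is_minimum
    [set seq_weight E w H Ss | Ss in [set Ss | mst_sequence E w H Ss]]).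

Definition mutually_independent (R : realType) (d : measure_display)
    (T : measurableType d) (P : probability T R) (I : finType) (D : {set I})
    (X : I -> {RV P >-> R}) : Prop :=
  forall (J : {set I}) (B : I -> set R),
    J \subset D -> (forall i, measurable (B i)) ->
    P (\bigcap_(i in [set` J]) (X i @^-1` B i))
    = (\prod_(i in J) P (X i @^-1` B i))%E.

Definition uniform01 (R : realType) (d : measure_display)
    (T : measurableType d) (P : probability T R) (X : {RV P >-> R}) : Prop :=
  forall B : set R, measurable B ->
    distribution P X B = uniform_prob (@ltr01 R) B.

Definition whp (R : realType) (d : nat -> measure_display)
    (T : forall n, measurableType (d n)) (P : forall n, probability (T n) R)
    (A : forall n, set (T n)) : Prop :=
  (forall n, measurable (A n)) /\ P n (A n) @[n --> \oo] --> 1%E.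

Definition cvg_in_probability (R : realType) (d : nat -> measure_display)
    (T : forall n, measurableType (d n)) (P : forall n, probability (T n) R)
    (Y : forall n, T n -> R) (c : R) : Prop :=
  (forall n, measurable_fun [set: T n] (Y n)) /\
  forall eta : R, 0 < eta ->
    P n [set t | eta < `|Y n t - c|] @[n --> \oo] --> 0%E.

(* Main.v *)
From Pilot Require Import Defs.
From HB Require Import structures.
From mathcomp Require Import all_boot all_order all_algebra.
From mathcomp Require Import all_classical all_reals all_analysis.
From mathcomp Require Import lra ring zify.

(** (a) List the vertices in an order in which each one is [H]-adjacent to an
    earlier one, let [S] be an initial segment on which the subgraph is already
    the minimum spanning tree [M] of [S], and let [v] be the next vertex.  If the
    edges of [M] have weight at most a small [q], if any two vertices of [S] are
    joined by a subtree of [M] of weight at most [c1 < 1], and if every vertex of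
    [S] is joined by a subtree of weight less than 1 - [q] to some [y] for which
    [v y] is light, then sets of weight close to 1 suffice to reach the minimum
    spanning tree of [v |: S]: first get rid of the heavy edges at [v], then add
    the missing tree edges one by one, then remove the superfluous ones.
    The hypotheses hold for all initial segments of more than [L] vertices with
    probability close to 1.  Indeed, some cluster [B] of [S] connected by edges of
    weight below [23 / (20 #|S|)] is large; Prim's algorithm started outside [B]
    reaches it before it has gone far; and at most [4 #|S| / 5] edges are lighter
    than [24 / (20 #|S|)], so that the subtrees weigh less than 1.  The first [L]
    stages are unproblematic when the edges joining the first [L + 1] vertices are
    all very light.  This has small probability, but [H] offers many disjoint stars
    or paths to start from, and a second-moment argument finds a good one.
    (b) An edge of [H] heavier than [1 - eps] lies in no set of weight at most
    [1 - eps], hence is never removed.  There are linearly many such edges, whereas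
    the minimum spanning tree weighs at most 60 with high probability: few vertices
    fail to be in a cluster of more than half of the vertices for the edges of
    weight at most [4 i / n].
    Probabilities are computed on the finite space of the weights rounded down to
    multiples of [1 / N], where they are independent and, with high probability,
    distinct, so that rounding preserves the order of the edges. *)

Set Implicit Arguments.
Unset Strict Implicit.
Unset Printing Implicit Defensive.

Import Order.TTheory GRing.Theory Num.Theory.
Import numFieldNormedType.Exports.


(** * Connectivity and forests *)

Section Graph.
Import mathcomp.boot.fintype mathcomp.boot.finset Pilot.Defs.
Local Open Scope set_scope.
Variable V : finType.
Implicit Types (G J F M H : {set {set V}}) (x y z : V) (A S U : {set V}) (e : {set V}).

(** Write [k] for [#|S|]. Two requirements fix the levels. Clusters of edges below [23/(20k)] must
    be supercritical, so the factor has to exceed 1. The tree edges below [24/(20k)] must weigh less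
    than 1 in total, and 4/5 times 24/20 is 24/25. The gap between 23 and 24 is a sprinkling: once a
    cluster is revealed, the edges on its boundary are only known to weigh at least [23/(20k)], and
    each may still fall below [24/(20k)]. Prim's algorithm is run inside [S :\: B], and not in [S],
    so that the vertices it visits are independent of the edges joining them to [B]. A stage fails
    with probability at most a polynomial in [k] times an exponential in [- k^(1/10)]. This is
    summable, but only the tail beyond a large [L] is small, so a bounded number of initial stages
    escapes this estimate; a light start is forced there, and all later estimates are made relative
    to it. The constants are chosen in the order [eps], [Q], [L], [G] (starting edges weigh at most
    [1/G]), then the number [M] of groups, then [n]. *)

Definition conn G x y := connect (adj G) x y.
Definition cgraph : {set {set V}} := [set e : {set V} | #|e| == 2].

Lemma adjC G x y : adj G x y = adj G y x.
Proof. by rewrite /adj setUC. Qed.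

Lemma connC G x y : conn G x y = conn G y x.
Proof. by apply: sym_connect_sym => u v; exact: adjC. Qed.

Lemma conn0 G x : conn G x x. Proof. exact: connect0. Qed.
Lemma conn1 G x y : adj G x y -> conn G x y. Proof. exact: connect1. Qed.
Lemma conn_trans G y x z : conn G x y -> conn G y z -> conn G x z.
Proof. exact: connect_trans. Qed.

Lemma conn_ind G x (Q : V -> Prop) :
  Q x -> (forall y z, conn G x y -> Q y -> adj G y z -> Q z) ->
  forall y, conn G x y -> Q y.
Proof.
move=> Qx QS y /connectP[p]; elim/last_ind: p y => [|p z IH] y; first by move=> _ ->.
rewrite rcons_path last_rcons => /andP[pp az] ->.
by apply: (QS (last x p)) => //; [apply/connectP; exists p | exact: IH].
Qed.

Lemma conn_mono (G1 G2 : {set {set V}}) x y : G1 \subset G2 -> conn G1 x y -> conn G2 x y.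
Proof.
move=> s12; apply: connect_sub => u v h.
by apply: connect1; exact: (subsetP s12 _ h).
Qed.

Lemma conn_sub G1 G2 x y :
  (forall u v, adj G1 u v -> conn G2 u v) -> conn G1 x y -> conn G2 x y.
Proof. by move=> h; apply: connect_sub. Qed.

Lemma cut_edge G A x y : conn G x y -> x \in A -> y \notin A ->
  exists u v, [/\ u \in A, v \notin A & adj G u v].
Proof.
move=> cxy xA yA; apply: contrapT => no; move: yA; apply/negP; rewrite negbK.
move: y cxy; apply: conn_ind => // u v _ uA a; apply: contrapT => /negP vA.
by apply: no; exists u, v.
Qed.

Lemma conn_add G a b x y : conn ([set a; b] |: G) x y ->
  [\/ conn G x y, conn G x a /\ conn G b y | conn G x b /\ conn G a y].
Proof.
move: y; apply: conn_ind => [|u v _ IH]; first by apply: Or31; exact: conn0.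
rewrite /adj !inE => /orP[/eqP E|a1].
  have : (u == a) && (v == b) || (u == b) && (v == a).
    have ua : u \in [set a; b] by rewrite -E !inE eqxx.
    have va : v \in [set a; b] by rewrite -E !inE eqxx orbT.
    have au : a \in [set u; v] by rewrite E !inE eqxx.
    have bu : b \in [set u; v] by rewrite E !inE eqxx orbT.
    move: ua va au bu; rewrite !inE (eq_sym a u) (eq_sym b u) (eq_sym a v) (eq_sym b v).
    by do 4! case: (_ == _).
  case/orP=> /andP[/eqP eu /eqP->]; subst u.
    case: IH => [h|[h1 h2]|[h1 h2]]; first by apply: Or32; rewrite conn0.
      by apply: Or32; rewrite conn0.
    by apply: Or31.
  case: IH => [h|[h1 h2]|[h1 h2]]; first by apply: Or33; rewrite conn0.
    by apply: Or31.
  by apply: Or33; rewrite conn0.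
have uv : conn G u v by apply: conn1.
case: IH => [h|[h1 h2]|[h1 h2]]; [apply: Or31|apply: Or32|apply: Or33].
- exact: conn_trans uv.
- by split=> //; exact: conn_trans uv.
- by split=> //; exact: conn_trans uv.
Qed.

Lemma edgeP e : reflect (exists x y, x != y /\ e = [set x; y]) (e \in cgraph).
Proof.
rewrite inE; apply: (iffP idP) => [/cards2P[x [y [h ->]]]|[x [y [h ->]]]].
  by exists x, y.
by rewrite cards2 h.
Qed.

Lemma edge2 x y : ([set x; y] \in cgraph) = (x != y).
Proof. by rewrite inE cards2; case: (x == y). Qed.

Lemma sub2 x y A : ([set x; y] \subset A) = (x \in A) && (y \in A).
Proof. by rewrite subUset !sub1set. Qed.

Lemma adj_neq G x y : G \subset cgraph -> adj G x y -> x != y.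
Proof. by move=> s /(subsetP s); rewrite edge2. Qed.

(** Every edge is a bridge. This form suits exchange and uniqueness arguments; [forest_acyclic] and
    [acyclic_forest] relate it to the cycle condition of [acyclic]. *)
Definition forest G := G \subset cgraph /\
  forall x y, adj G x y -> ~~ conn (G :\ [set x; y]) x y.

Lemma forest_mem (G J : {set {set V}}) x y : forest G -> J \subset G -> adj G x y -> conn J x y ->
  [set x; y] \in J.
Proof.
move=> [_ f] s a c; apply: contrapT => /negP n.
have := f x y a; apply/negP; rewrite negbK; apply: conn_mono c.
by apply/subsetP=> e eJ; rewrite !inE (subsetP s) // andbT; apply: contra n => /eqP <-.
Qed.

Lemma forest_cap (G G1 G2 : {set {set V}}) x y : forest G -> G1 \subset G -> G2 \subset G ->
  conn G1 x y -> conn G2 x y -> conn (G1 :&: G2) x y.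
Proof.
move=> fG; move: {-1}(#|G1 :\: G2|) (erefl #|G1 :\: G2|) => n.
elim: n G1 => [|n IH] G1 E s1 s2 c1 c2.
  have s12 : G1 \subset G2 by rewrite -setD_eq0 -cards_eq0 E.
  by move/setIidPl: s12 => ->.
have /card_gt0P[e] : 0 < #|G1 :\: G2| by rewrite E.
rewrite inE => /andP[e2 e1].
have eG : e \in G by exact: subsetP e1.
have /edgeP[a [b [nab Eab]]] := subsetP (proj1 fG) _ eG.
have cD : conn (G1 :\ e) x y.
  have := c1; rewrite -{1}(setD1K e1) {1}Eab => /conn_add[//|[xa by_]|[xb ay]].
    exfalso; have aG : adj G a b by rewrite /adj -Eab.
    have := proj2 fG a b aG; apply/negP; rewrite negbK -Eab.
    apply: (@conn_trans _ x); first by rewrite connC; apply: conn_mono xa; exact: setSD.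
    apply: (@conn_trans _ y); last by rewrite connC; apply: conn_mono by_; exact: setSD.
    apply: conn_mono c2; apply/subsetP=> h hG; rewrite !inE (subsetP s2) // andbT.
    by apply: contra e2 => /eqP <-.
  exfalso; have aG : adj G a b by rewrite /adj -Eab.
  have := proj2 fG a b aG; apply/negP; rewrite negbK -Eab.
  apply: (@conn_trans _ y); first by apply: conn_mono ay; exact: setSD.
  apply: (@conn_trans _ x); last by apply: conn_mono xb; exact: setSD.
  rewrite connC; apply: conn_mono c2; apply/subsetP=> h hG; rewrite !inE (subsetP s2) // andbT.
  by apply: contra e2 => /eqP <-.
have := IH (G1 :\ e); rewrite setDDl setUC -setDDl.
have -> : #|(G1 :\: G2) :\ e| = n.
  by have := cardsD1 e (G1 :\: G2); rewrite E inE e2 e1 /= => -[].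
move=> /(_ erefl (subset_trans (subsetDl _ _) s1) s2 cD c2).
by apply: conn_mono; apply: setSI; exact: subsetDl.
Qed.

Lemma inducedE G S e : (e \in induced G S) = (e \in G) && (e \subset S).
Proof. by rewrite inE. Qed.
Lemma induced_sub G S : induced G S \subset G.
Proof. by apply/subsetP=> e; rewrite inE => /andP[]. Qed.

Lemma adj_induced G S x y :
  adj (induced G S) x y = [&& adj G x y, x \in S & y \in S].
Proof. by rewrite /adj inE sub2. Qed.

Lemma conn_induced G S x y : conn (induced G S) x y -> x \in S -> y \in S.
Proof.
move=> c xS; move: y c; apply: conn_ind => // u v _ uS.
by rewrite adj_induced => /and3P[].
Qed.

(* The part of a connected piece explored from [x] up to the first vertex satisfying [pi]. *)
Lemma first_hit G x (pi : pred V) y : conn G x y -> pi y ->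
  exists Q : {set V}, [/\ x \in Q, forall u, u \in Q -> conn (induced G Q) x u &
    exists z, [/\ z \in Q, pi z & forall u, u \in Q -> pi u -> u = z]].
Proof.
move=> cxy piy; case px : (pi x).
  exists [set x]; split; rewrite ?inE //; first by move=> u; rewrite inE => /eqP->; exact: conn0.
  by exists x; split; rewrite ?inE // => u; rewrite inE => /eqP.
pose N := [set u | ~~ pi u].
pose C := [set u | conn (induced G N) x u].
have xN : x \in N by rewrite inE px.
have xC : x \in C by rewrite inE conn0.
have CN u : u \in C -> u \in N by rewrite inE => /conn_induced; apply.
have yC : y \notin C by apply/negP=> /CN; rewrite inE piy.
have [u [z [uC zC a]]] := cut_edge cxy xC yC.
have pz : pi z.
  apply: contrapT => /negP npz; move: zC; rewrite inE; apply/negP; rewrite negbK.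
  apply: (@conn_trans _ u); first by move: uC; rewrite inE.
  by apply: conn1; rewrite adj_induced a CN //= inE npz.
have cC v : v \in C -> conn (induced G C) x v.
  rewrite inE; move: v; apply: conn_ind => [|a1 b1 ca IH ab]; first exact: conn0.
  apply: conn_trans IH _; apply: conn1; move: (ab); rewrite !adj_induced => /and3P[-> _ _] /=.
  by rewrite !inE ca /=; apply: conn_trans ca _; apply: conn1.
exists (z |: C); split; first by rewrite inE xC orbT.
  have sC : induced G C \subset induced G (z |: C).
    apply/subsetP=> e; rewrite !inE => /andP[-> h] /=.
    by apply: (subset_trans h); apply: subsetUr.
  move=> v; rewrite !inE => /orP[/eqP->|vC].
    apply: (@conn_trans _ u); first by apply: conn_mono (cC _ uC).
    by apply: conn1; rewrite adj_induced a in_setU1 uC orbT setU11.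
  by apply: conn_mono (cC v _) => //; rewrite inE.
exists z; split=> //; first by rewrite !inE eqxx.
move=> v; rewrite in_setU1 => /orP[/eqP//|/CN]; by rewrite inE => /negP.
Qed.

End Graph.

(** * Minimum spanning trees *)

Section Kruskal.
Import mathcomp.boot.fintype mathcomp.boot.finset Pilot.Defs.
Local Open Scope set_scope.
Local Open Scope order_scope.
Variables (V : finType) (disp : Order.disp_t) (T : orderType disp).
Implicit Types (w : {set V} -> T) (x y z : V) (A S : {set V}) (e : {set V}).

(** The threshold is a predicate so that strict and weak bounds are treated alike. The ordered type
    [T] is left abstract because both the real weights and their rounded values in [nat] are
    used. *)
Definition below w (P : pred T) S : {set {set V}} :=
  [set e in cgraph V | (e \subset S) && P (w e)].

Definition lighter w e S := below w (fun t => t < w e) S.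

(* Kruskal's description of the minimum spanning tree of the complete graph on [S]. *)
Definition kr w S : {set {set V}} :=
  [set e in cgraph V | (e \subset S) &&
    [forall x in e, forall y in e, (x != y) ==> ~~ conn (lighter w e S) x y]].

Lemma kr_cgraph w S : kr w S \subset cgraph V.
Proof. by apply/subsetP=> e; rewrite inE => /andP[]. Qed.
Lemma kr_in w S e : e \in kr w S -> e \subset S.
Proof. by rewrite inE => /and3P[]. Qed.

Lemma adj_below w P S x y :
  adj (below w P S) x y = [&& x != y, x \in S, y \in S & P (w [set x; y])].
Proof. by rewrite /adj inE edge2 sub2 -andbA. Qed.

Lemma adj_kr w S x y : adj (kr w S) x y =
  [&& x != y, x \in S, y \in S & ~~ conn (lighter w [set x; y] S) x y].
Proof.
rewrite /adj inE edge2 sub2 -!andbA; case: eqP => //= /eqP nxy.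
congr [&& _, _ & _]; apply/idP/idP => [/forall_inP/(_ x)|h].
  rewrite !inE eqxx => /(_ isT)/forall_inP/(_ y); rewrite !inE eqxx orbT => /(_ isT).
  by rewrite nxy.
apply/forall_inP=> u; rewrite !inE => /orP[]/eqP->; apply/forall_inP=> v;
  by rewrite !inE => /orP[]/eqP->; apply/implyP; rewrite ?eqxx // connC.
Qed.

Lemma adj_kr_S w S x y : adj (kr w S) x y -> (x \in S) && (y \in S).
Proof. by rewrite adj_kr => /and4P[_ -> ->]. Qed.

Lemma conn_kr_S w S x y : conn (kr w S) x y -> x \in S -> y \in S.
Proof.
move=> c xS; move: y c; apply: conn_ind => // u v _ _ /adj_kr_S/andP[] //.
Qed.

Lemma below_sub w P S1 S2 : S1 \subset S2 -> below w P S1 \subset below w P S2.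
Proof.
move=> s; apply/subsetP=> e; rewrite !inE => /and3P[-> h ->] /=.
by rewrite (subset_trans h s).
Qed.

Lemma below_imp w (P Q : pred T) S : (forall t, P t -> Q t) -> below w P S \subset below w Q S.
Proof.
by move=> s; apply/subsetP=> e; rewrite !inE => /and3P[-> -> /s ->].
Qed.

Lemma kr_restr w S1 S2 e : S1 \subset S2 -> e \subset S1 -> e \in kr w S2 -> e \in kr w S1.
Proof.
move=> s s1; rewrite !inE s1 => /and3P[-> _ /forall_inP h] /=.
apply/forall_inP=> x xe; apply/forall_inP=> y ye; apply/implyP=> nxy.
have /forall_inP/(_ y ye)/implyP/(_ nxy) := h x xe.
by apply: contra; apply: conn_mono; exact: below_sub.
Qed.

Lemma kr_cut w S A x y : x \in A -> y \notin A -> x \in S -> y \in S ->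
  (forall u v, u \in A -> u \in S -> v \notin A -> v \in S -> w [set x; y] <= w [set u; v]) ->
  [set x; y] \in kr w S.
Proof.
move=> xA yA xS yS h; have : adj (kr w S) x y; last by [].
rewrite adj_kr xS yS /=; apply/andP; split; first by apply: contraNneq yA => <-.
apply/negP=> c; have [u [v [uA vA]]] := cut_edge c xA yA.
by rewrite adj_below => /and4P[_ uS vS]; rewrite ltNge h.
Qed.

(** The tree realizes all bottleneck connections: if tree edges satisfying [P] did not reach [y],
    the lightest edge satisfying [P] that leaves the set they reach would be a tree edge by
    [kr_cut]. *)
Lemma kr_minimax w (P : pred T) S x y : (forall a b, a < b -> P b -> P a) ->
  conn (below w P S) x y -> conn (kr w S :&: below w P S) x y.
Proof.
move=> dP c; pose A := [set u | conn (kr w S :&: below w P S) x u].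
suff : y \in A by rewrite inE.
apply: contrapT => /negP yA.
have xA : x \in A by rewrite inE conn0.
have [u0 [v0 [u0A v0A a0]]] := cut_edge c xA yA.
pose cr := fun p : V * V => [&& p.1 \in A, p.2 \notin A & adj (below w P S) p.1 p.2].
have cr0 : cr (u0, v0) by rewrite /cr /= u0A v0A.
case: (arg_minP (fun p : V * V => w [set p.1; p.2]) cr0) => [[u v]] /and3P[/= uA vA a] mn.
have uv : [set u; v] \in kr w S.
  have := a; rewrite adj_below => /and4P[nuv uS vS puv].
  apply: (kr_cut uA vA) => // u' v' u'A u'S v'A v'S; rewrite leNgt; apply/negP=> lt.
  have := mn (u', v'); rewrite /cr /= u'A v'A adj_below u'S v'S (dP _ _ lt puv) leNgt lt.
  rewrite andbT /=; have -> : u' != v' by apply: contraNneq v'A => <-.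
  by move=> /(_ isT).
move: vA; rewrite inE; apply/negP; rewrite negbK.
apply: (@conn_trans _ _ u); first by move: uA; rewrite inE.
by apply: conn1; rewrite /adj inE uv; exact: a.
Qed.

Lemma conn_complete w S x y : x \in S -> y \in S -> conn (below w predT S) x y.
Proof.
move=> xS yS; case: (eqVneq x y) => [->|n]; first exact: conn0.
by apply: conn1; rewrite adj_below n xS yS.
Qed.

Lemma kr_conn w S x y : x \in S -> y \in S -> conn (kr w S) x y.
Proof.
move=> xS yS; have := @kr_minimax w predT S x y (fun _ _ _ => id) (conn_complete _ xS yS).
by apply: conn_mono; exact: subsetIl.
Qed.

(** An edge violating [P] is heavier than all edges of a class that already connects [S], so its
    ends are joined by lighter edges. *)
Lemma kr_bottleneck w (P : pred T) S : (forall a b, a < b -> P b -> P a) ->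
  (forall x y, x \in S -> y \in S -> conn (below w P S) x y) ->
  forall e, e \in kr w S -> P (w e).
Proof.
move=> dP h e eK; have /edgeP[x [y [nxy Ee]]] := subsetP (kr_cgraph w S) _ eK.
have : adj (kr w S) x y by rewrite /adj -Ee.
rewrite adj_kr -Ee => /and4P[_ xS yS]; apply: contraNT => nP.
apply: conn_mono (h x y xS yS); apply: below_imp => t pt.
by rewrite ltNge; apply/negP; rewrite le_eqVlt => /orP[/eqP E|lt];
  [rewrite E pt in nP|rewrite (dP _ _ lt pt) in nP].
Qed.

Lemma kr_forest w S : {in cgraph V &, injective w} -> forest (kr w S).
Proof.
move=> inj; split=> [|x y axy]; first exact: kr_cgraph.
apply/negP=> c; set e := [set x; y] in c; set G := kr w S :\ e in c.
have eK : e \in kr w S by [].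
pose Gb g := [set h in G | w h <= w g].
pose ok g := (g \in G) && conn (Gb g) x y.
have [g0 okg0] : exists g, ok g.
  have nE : G != set0.
    apply: contraTneq c => ->; apply/negP => c'.
    have [u [v [_ _]]] : exists u v, [/\ u \in [set x], v \notin [set x] & adj (set0 : {set {set V}}) u v].
      apply: (cut_edge c'); rewrite !inE //.
      by rewrite eq_sym; move: axy; rewrite adj_kr => /and4P[].
    by rewrite /adj inE.
  have [g1 g1G] := set0Pn _ nE.
  case: (arg_maxP w g1G) => g gG' mx; have gG : g \in G := gG'; exists g; rewrite /ok gG /=.
  by apply: conn_mono c; apply/subsetP=> h hG; rewrite inE hG; exact: mx.
(* [g] is the heaviest edge of a best route from [x] to [y] avoiding [e]: the edges of [G] up to
   [w g] join them, those below [w g] do not. *)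
case: (arg_minP w okg0) => g /andP[gG cg] mn.
have gK : g \in kr w S by have /setD1P[] := gG.
have gC := subsetP (kr_cgraph w S) _ gK.
have eC := subsetP (kr_cgraph w S) _ eK.
have nwe : w g != w e.
  by apply/eqP=> /(inj _ _ gC eC) E; move: gG; rewrite !inE E eqxx.
have xyS := adj_kr_S axy.
have subl (f : {set V}) (D : {set {set V}}) : D \subset kr w S -> (forall h, h \in D -> w h < w f) ->
    D \subset lighter w f S.
  move=> s l; apply/subsetP=> h hD; rewrite inE (subsetP (kr_cgraph w S) _ (subsetP s _ hD)).
  by rewrite (kr_in (subsetP s _ hD)) l.
have GbK k : Gb k \subset kr w S.
  by apply/subsetP=> h /setIdP[/setD1P[]].
have lt : w e < w g.
  rewrite lt_neqAle eq_sym nwe /= leNgt; apply/negP=> l.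
  move: (axy); rewrite adj_kr => /and4P[_ _ _]; apply/negP; rewrite negbK.
  apply: conn_mono cg; apply: subl => // h; rewrite inE => /andP[_ hg].
  exact: le_lt_trans hg l.
pose D := [set h in G | w h < w g].
have nD : ~~ conn D x y.
  apply/negP=> cD; case: (set_0Vmem D) => [D0|[h0 h0D]].
    have [u [v [_ _]]] : exists u v, [/\ u \in [set x], v \notin [set x] & adj D u v].
      apply: (cut_edge cD); rewrite !inE //.
      by rewrite eq_sym; move: axy; rewrite adj_kr => /and4P[].
    by rewrite /adj D0 inE.
  case: (arg_maxP w h0D) => h hD' mx; have hD : h \in D := hD'.
  have : ok h.
    rewrite /ok; move: hD; rewrite inE => /andP[-> _] /=.
    by apply: conn_mono cD; apply/subsetP=> k kD; move: (kD); rewrite !inE => /andP[-> _] /=; exact: mx.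
  by move=> /mn; rewrite leNgt; move: hD; rewrite inE => /andP[_ ->].
have /edgeP[a [b [nab Eg]]] := gC.
have sD : Gb g \subset [set a; b] |: D.
  apply/subsetP=> h /setIdP[hG]; rewrite in_setU1 -Eg [h \in D]inE hG le_eqVlt.
  have /setD1P[_ hK] := hG; move=> /orP[/eqP E|->]; last by rewrite orbT.
  by rewrite (inj _ _ (subsetP (kr_cgraph w S) _ hK) gC E) eqxx.
have sDl : [set x; y] |: D \subset lighter w g S.
  apply: subl; first by rewrite subUset sub1set eK; apply/subsetP=> h /setIdP[/setD1P[]].
  by move=> h; rewrite in_setU1 => /orP[/eqP->|] //; rewrite inE => /andP[].
have cxy : conn (lighter w g S) x y.
  by apply: conn1; exact: (subsetP sDl _ (setU11 _ _)).
have DL : D \subset lighter w g S by apply: subset_trans sDl; exact: subsetUr.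
have gab : ~~ conn (lighter w g S) a b.
  have : adj (kr w S) a b by rewrite /adj -Eg.
  by rewrite adj_kr -Eg => /and4P[].
(* The route passes through [g], so its two remaining parts, together with [e], join the ends of [g]
   by edges lighter than [g]. *)
have := conn_mono sD cg => /conn_add[cD|[xa by_]|[xb ay]].
- by rewrite cD in nD.
- move/negP: gab; apply; apply: (@conn_trans _ _ x); first by rewrite connC; exact: conn_mono xa.
  by apply: conn_trans cxy _; rewrite connC; exact: conn_mono by_.
- move/negP: gab; apply; apply: (@conn_trans _ _ y); first exact: conn_mono ay.
  by rewrite connC; apply: (@conn_trans _ _ x) cxy; rewrite connC; exact: conn_mono xb.
Qed.

End Kruskal.

(** * Kruskal's edge set is the unique minimum spanning tree *)

Section Mst.
Import mathcomp.boot.fintype mathcomp.boot.finset Pilot.Defs.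
Local Open Scope set_scope.
Local Open Scope ring_scope.
Variables (V : finType).
Implicit Types (G : {set {set V}}) (x y z : V) (A S : {set V}) (e : {set V}).

Lemma conn_path_avoid G e u q : path (adj G) u q -> all [predC e] q ->
  conn (G :\ e) u (last u q).
Proof.
elim: q u => [|v q IH] u /=; first by move=> *; exact: conn0.
move=> /andP[a p] /andP[ve al]; apply: (@conn_trans _ _ v); last exact: IH.
apply: conn1; rewrite /adj in_setD1; apply/andP; split; last exact: a.
by apply: contraNneq ve => <-; rewrite !inE eqxx orbT.
Qed.

Lemma forest_acyclic G : forest G -> acyclic G.
Proof.
move=> [sG f] [|x [|y [|z p]]] // /andP[/= /and3P[axy ayz pz] u]; exfalso.
have := f x y axy; apply/negP; rewrite negbK connC.
move: pz; rewrite rcons_path => /andP[pz al].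
move: u; rewrite !inE !negb_or => /and3P[/and3P[xy xz xp] /andP[yz yp] _].
have yq : path (adj G) y (z :: p) by rewrite /= ayz pz.
have av : all [predC [set x; y]] (z :: p).
  apply/allP=> v /=; rewrite !inE => /orP[/eqP->|vp]; first by rewrite !(eq_sym z) negb_or xz yz.
  by rewrite negb_or; apply/andP; split; [apply: contraNneq xp => <-|apply: contraNneq yp => <-].
have c := conn_path_avoid yq av; apply: conn_trans c _; apply: conn1.
rewrite /adj in_setD1; apply/andP; split; last exact: al.
have : last y (z :: p) \notin [set x; y] by apply: (allP av); rewrite /= mem_last.
by apply: contraNneq => <-; rewrite !inE eqxx.
Qed.

Lemma acyclic_forest G : G \subset cgraph V -> acyclic G -> forest G.
Proof.
move=> sG ac; split=> // x y axy; apply/negP=> /connectP[p0 pp0]; case/shortenP: pp0.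
move=> p pp u _ yl.
have nxy := adj_neq sG axy.
have s12 : subrel (adj (G :\ [set x; y])) (adj G).
  by move=> a b; rewrite /adj in_setD1 => /andP[].
have cyc : ucycle (adj G) (x :: p).
  rewrite /ucycle u andbT /= rcons_path (sub_path s12 pp) -yl adjC; exact: axy.
have := ac _ cyc; case: p pp u yl {cyc} => [|a [|b p]] //=.
  by move=> _ _ E; rewrite E eqxx in nxy.
by move=> /andP[a1 _] _ E; move: a1; rewrite E /adj in_setD1 eqxx.
Qed.

(** [a] and [b] lie on the two sides of the removed bridge, so the new edge restores the lost
    connections and is itself a bridge. *)
Lemma forest_exchange G x y a b : forest G -> adj G x y -> a != b ->
  conn (G :\ [set x; y]) x a -> conn (G :\ [set x; y]) y b ->
  forest ([set a; b] |: (G :\ [set x; y])) /\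
  (forall u v, conn G u v -> conn ([set a; b] |: (G :\ [set x; y])) u v).
Proof.
move=> fG axy nab xa yb; set G1 := G :\ _ in xa yb *; set G' := _ |: _.
have s1 : G1 \subset G' by exact: subsetUr.
have cab : conn G' a b by apply: conn1; exact: setU11.
have sG1 : G1 \subset G by exact: subsetDl.
have nxy : ~~ conn G1 x y := proj2 fG x y axy.
have nab1 : ~~ conn G1 a b.
  apply: contra nxy => c; apply: (conn_trans xa); apply: (conn_trans c).
  by rewrite connC.
split; last first.
  move=> u v; apply: conn_sub => {}u {}v uv; case: (eqVneq [set u; v] [set x; y]) => [E|n].
    have cxy : conn G' x y.
      apply: conn_trans (conn_mono s1 xa) _; apply: conn_trans cab _.
      by rewrite connC; exact: conn_mono yb.
    have : u \in [set x; y] by rewrite -E !inE eqxx.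
    have : v \in [set x; y] by rewrite -E !inE eqxx orbT.
    by rewrite !inE => /orP[]/eqP-> /orP[]/eqP->; rewrite ?conn0 // connC.
  by apply: conn1; rewrite /adj in_setU1 in_setD1 n; apply/orP; right; exact: uv.
have sG' : G' \subset cgraph V.
  by rewrite subUset sub1set edge2 nab /=; apply: subset_trans (proj1 fG).
split=> // u v; rewrite {1}/adj in_setU1 => /orP[/eqP E|uv1].
  have -> : G' :\ [set u; v] = G1 :\ [set a; b] by rewrite E setDUl setDv set0U.
  have -> : conn (G1 :\ [set a; b]) u v = conn (G1 :\ [set a; b]) a b.
    have ua : u \in [set a; b] by rewrite -E !inE eqxx.
    have va : v \in [set a; b] by rewrite -E !inE eqxx orbT.
    have nuv : u != v by rewrite -edge2 E edge2.
    move: ua va nuv; rewrite !inE => /orP[]/eqP-> /orP[]/eqP->; rewrite ?eqxx // connC //.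
  by apply: contra nab1; apply: conn_mono; exact: subsetDl.
have uvG : adj G u v by exact: (subsetP sG1).
apply/negP; set g := [set u; v] => c.
have gu : conn G1 u v by apply: conn1.
have sub : G' :\ g \subset [set a; b] |: (G1 :\ g) by rewrite setDUl; apply: setSU; exact: subsetDl.
have s1G : G1 :\ g \subset G :\ g by apply: setSD.
have s1g : G1 :\ g \subset G1 by exact: subsetDl.
have := conn_mono sub c => /conn_add[c1|[ua bv]|[ub av]].
- by have := proj2 fG u v uvG; rewrite (conn_mono s1G c1).
- move/negP: nab1; apply; apply: (@conn_trans _ _ u); first by rewrite connC; exact: conn_mono ua.
  by apply: conn_trans gu _; rewrite connC; exact: conn_mono bv.
- move/negP: nab1; apply; apply: (@conn_trans _ _ v); first exact: conn_mono av.
  by rewrite connC; apply: (@conn_trans _ _ u) gu; rewrite connC; exact: conn_mono ub.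
Qed.

Variable R : realType.
Implicit Types (w : {set V} -> R).

Lemma connP_on S G : connected_on S G <-> {in S &, forall x y, conn G x y}.
Proof.
split=> [/forall_inP h x y xS yS|h]; first by have /forall_inP := h x xS; apply.
by apply/forall_inP=> x xS; apply/forall_inP=> y yS; exact: h.
Qed.

Lemma kr_spanning w S : {in cgraph V &, injective w} ->
  spanning_tree (cgraph V) S (kr w S).
Proof.
move=> inj; split.
- by apply/subsetP=> e eK; rewrite inE (subsetP (kr_cgraph w S)) // (kr_in eK).
- by apply/connP_on=> x y; exact: kr_conn.
- by apply: forest_acyclic; exact: kr_forest.
Qed.

(** If an edge of a minimal tree were not a Kruskal edge, lighter edges would join its ends; one of
    them crosses the cut left by its removal, and exchanging the two lowers the weight. A connected
    subset of the forest [kr w S] is then all of it. *)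
Lemma is_mst_kr w S G : {in cgraph V &, injective w} ->
  is_mst (cgraph V) w S G -> G = kr w S.
Proof.
move=> inj [[sG /connP_on cG /acyclic_forest acG] mn].
have sGc : G \subset cgraph V by apply: subset_trans sG (induced_sub _ _).
have fG := acG sGc.
have sGk : G \subset kr w S.
  apply/subsetP=> e eG; have /edgeP[x [y [nxy E]]] := subsetP sGc _ eG.
  have /andP[xS yS] : (x \in S) && (y \in S).
    by rewrite -sub2 -E; have := subsetP sG _ eG; rewrite inE => /andP[].
  have axy : adj G x y by rewrite /adj -E.
  rewrite E -/(adj (kr w S) x y) adj_kr nxy xS yS /=; apply/negP=> c.
  pose G1 := G :\ [set x; y]; pose A := [set u | conn G1 x u].
  have xA : x \in A by rewrite inE conn0.
  have yA : y \notin A by rewrite inE; exact: proj2 fG x y axy.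
  have [u [v [uA vA]]] := cut_edge c xA yA; rewrite adj_below => /and4P[nuv uS vS lt].
  have yv : conn G1 y v.
    have := cG x v xS vS; rewrite -(setD1K axy) => /conn_add[c1|[]//|[c1]].
      by rewrite inE c1 in vA.
    by rewrite inE c1 in yA.
  have xu : conn G1 x u by move: uA; rewrite inE.
  have [fG' cG'] := forest_exchange fG axy nuv xu yv.
  have nuvG : [set u; v] \notin G1.
    apply: contra vA => uvG; rewrite inE; apply: conn_trans xu _; exact: conn1.
  have := mn ([set u; v] |: G1); rewrite leNgt => /(_ _)/negP; apply.
    split; first 1 last.
    - by apply/connP_on=> p q pS qS; apply: cG'; exact: cG.
    - exact: forest_acyclic.
    rewrite subUset sub1set inE edge2 nuv sub2 uS vS /=.
    by apply: subset_trans sG; exact: subsetDl.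
  by rewrite /weight big_setU1 //= [ltRHS](big_setD1 [set x; y]) //= ltrD2r.
apply/eqP; rewrite eqEsubset sGk /=; apply/subsetP=> e eK.
have /edgeP[x [y [nxy E]]] := subsetP (kr_cgraph w S) _ eK; rewrite E.
have axy : adj (kr w S) x y by rewrite /adj -E.
have /andP[xS yS] := adj_kr_S axy.
by apply: (forest_mem (kr_forest _ inj) sGk axy); exact: cG.
Qed.

Lemma mst_kr w S : {in cgraph V &, injective w} -> mst (cgraph V) w S = kr w S.
Proof.
move=> inj; apply: is_mst_kr => //; rewrite /mst.
have sp := kr_spanning S inj.
pose ok : pred {set {set V}} := fun G => `[< spanning_tree (cgraph V) S G >].
have ok0 : ok (kr w S) by apply/asboolP.
case: (arg_minP (P := ok) (weight w) ok0) => G /asboolP spG mn.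
apply: (@xgetPex _ set0 (is_mst (cgraph V) w S)); exists G; split=> // G' sp'.
by apply: mn; apply/asboolP.
Qed.

End Mst.

(** * Adding a vertex to a minimum spanning tree *)

Section Reach.
Import mathcomp.boot.fintype mathcomp.boot.finset Pilot.Defs.
Local Open Scope set_scope.
Local Open Scope ring_scope.
Variables (V : finType) (R : realType) (w : {set V} -> R).
Implicit Types (G H J F M : {set {set V}}) (x y z u v : V) (A B S Q P : {set V}) (e : {set V}).
Hypothesis inj : {in cgraph V &, injective w}.
Hypothesis w_ge0 : forall e, e \in cgraph V -> 0 <= w e.

(** The effect of [phi] on a set where the subgraph is connected, with the tree in Kruskal's
    form. *)
Definition step G P := (G :\: induced G P) :|: kr w P.

Inductive reach (c : R) A : {set {set V}} -> {set {set V}} -> Prop :=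
| reach0 G : reach c A G G
| reachS G P G' : P \subset A -> connected_on P (induced G P) ->
    weight w (induced G P) <= c -> reach c A (step G P) G' -> reach c A G G'.

Lemma reach_trans c A G1 G2 G3 : reach c A G1 G2 -> reach c A G2 G3 -> reach c A G1 G3.
Proof. by elim=> // G P G' PA cn wt _ IH /IH; apply: reachS. Qed.

Lemma in_step G P e : (e \in step G P) =
  (e \in G) && ~~ (e \subset P) || (e \in kr w P).
Proof. by rewrite !inE negb_and; case: (e \in G); rewrite /= ?andbF ?andbT. Qed.

Lemma induced_induced G A B : A \subset B -> induced (induced G B) A = induced G A.
Proof.
move=> s; apply/setP=> e; rewrite !inE -andbA; congr (_ && _).
by case eA : (e \subset A); rewrite ?andbF // (subset_trans eA s).
Qed.

(** Steps on subsets of [A] neither see nor change the edges that are not inside [A]. *)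
Lemma reach_lift c A H G' : reach c A (induced H A) G' ->
  reach c [set: V] H ((H :\: induced H A) :|: G').
Proof.
move E : (induced H A) => G r; elim: r H E => {G G'} [G|G P G' PA cn wt _ IH] H E.
  have -> : (H :\: G) :|: G = H.
    by apply/setP=> e; rewrite -E !inE; case: (e \in H); case: (e \subset A).
  exact: reach0.
have Ei : induced G P = induced H P by rewrite -E induced_induced.
apply: (reachS (P := P)); rewrite -?Ei ?subsetT //.
have E2 : induced (step H P) A = step G P.
  apply/setP=> e; rewrite -E inducedE !in_step inducedE.
  case k : (e \in kr w P); first by rewrite !orbT (subset_trans (kr_in k) PA).
  by rewrite !orbF; case: (e \in H); case: (e \subset A); case: (e \subset P).
have -> : H :\: G = step H P :\: step G P.
  apply/setP=> e; rewrite !in_setD !in_step -E inducedE.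
  case k : (e \in kr w P); first by rewrite !orbT (subset_trans (kr_in k) PA); case: (e \in H).
  rewrite !orbF; case: (e \in H); case eA : (e \subset A); rewrite //=; first by case: (e \subset P).
  by apply/esym; apply: contraFN eA => h; apply: subset_trans PA.
exact: IH.
Qed.

Lemma weight_sub F G : F \subset G -> G \subset cgraph V -> weight w F <= weight w G.
Proof.
move=> s sG; rewrite /weight [leRHS](big_setID F) /= (setIidPr s) lerDl.
by apply: sumr_ge0 => e /setDP[eG _]; apply: w_ge0; exact: (subsetP sG).
Qed.

Lemma weightU1 e G : e \in cgraph V -> weight w (e |: G) <= w e + weight w G.
Proof.
move=> ec; case: (boolP (e \in G)) => eG; last by rewrite /weight big_setU1.
by rewrite (setUidPr _) ?sub1set // lerDr w_ge0.
Qed.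

(** By [kr_restr] the part of the larger tree inside [A] lies in the tree of [A]; being connected on
    [A] inside a forest, it is the whole tree. *)
Lemma kr_eq_induced A B : A \subset B -> (forall x y, x \in A -> y \in A ->
   conn (induced (kr w B) A) x y) -> kr w A = induced (kr w B) A.
Proof.
move=> s cn; apply/eqP; rewrite eq_sym eqEsubset; apply/andP.
have sub : induced (kr w B) A \subset kr w A.
  by apply/subsetP=> e; rewrite inE => /andP[eB eA]; exact: kr_restr eB.
split=> //; apply/subsetP=> e eK.
have /edgeP[x [y [nxy E]]] := subsetP (kr_cgraph w A) _ eK; rewrite E.
have axy : adj (kr w A) x y by rewrite /adj -E.
have /andP[xS yS] := adj_kr_S axy.
by apply: (forest_mem (kr_forest _ inj) sub axy); exact: cn.
Qed.

Lemma conn_step G P x y : connected_on P (induced G P) -> conn G x y -> conn (step G P) x y.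
Proof.
move=> /connP_on cn; apply: conn_sub => u v uv.
case: (boolP ([set u; v] \subset P)) => [|n].
  rewrite sub2 => /andP[uP vP]; apply: conn_mono (kr_conn w uP vP); exact: subsetUr.
by apply: conn1; rewrite /adj in_step n andbT; apply/orP; left.
Qed.

End Reach.

(** * From the tree of [S] to the tree of [v |: S] with sets of bounded weight *)

Section Growth.
Import mathcomp.boot.fintype mathcomp.boot.finset Pilot.Defs.
Local Open Scope set_scope.
Local Open Scope ring_scope.
Variables (V : finType) (R : realType) (w : {set V} -> R).
Implicit Types (G H J F : {set {set V}}) (x y z u : V) (A B Q P : {set V}) (e : {set V}).
Hypothesis inj : {in cgraph V &, injective w}.
Hypothesis w_ge0 : forall e, e \in cgraph V -> 0 <= w e.
Hypothesis w_le1 : forall e, e \in cgraph V -> w e <= 1.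
Variables (S : {set V}) (v : V) (c q c1 c3 : R).
Hypothesis vS : v \notin S.
Local Notation M := (kr w S).
Local Notation S' := (v |: S).
Local Notation M' := (kr w S').
Hypothesis D1 : forall x y, x \in S -> y \in S ->
  exists J, [/\ J \subset M, conn J x y & weight w J <= c1].
Hypothesis D2 : forall e, e \in M -> w e <= q.
Hypothesis D3 : forall z, z \in S -> exists y J,
  [/\ y \in S, w [set v; y] <= q, J \subset M, conn J z y & weight w J <= c3].
Hypothesis c1q : c1 + q + q <= c.
Hypothesis c3q : c3 + q + 1 <= c.

Let forM : forest M := kr_forest S inj.

Lemma vedge_nS x : ~~ ([set v; x] \subset S).
Proof. by rewrite sub2 (negbTE vS). Qed.

Lemma vedge_in x : x \in S -> [set v; x] \in cgraph V.
Proof. by move=> xS; rewrite edge2; apply: contraNneq (vS) => ->. Qed.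

Lemma vedge_inj x y : x \in S -> [set v; x] = [set v; y] -> x = y.
Proof.
move=> xS E; have : x \in [set v; y] by rewrite -E !inE eqxx orbT.
by rewrite !inE => /orP[/eqP xv|/eqP//]; move: (vS); rewrite -xv xS.
Qed.

Lemma star_case Q e : e \in cgraph V -> e \subset v |: Q ->
  e \subset Q \/ exists2 z, z \in Q & e = [set v; z].
Proof.
move=> /edgeP[a [b [nab ->]]]; rewrite !sub2 !in_setU1.
case: (eqVneq a v) nab => [-> nab /=|na nab /=].
  by rewrite eq_sym in nab; rewrite (negbTE nab) /= => bQ; right; exists b.
move=> /andP[aQ]; case: (eqVneq b v) => [->|nb] /= bQ; last by left; rewrite aQ.
by right; exists a => //; rewrite setUC.
Qed.

Lemma conn_to_v G u : G \subset cgraph V -> (forall e, e \in G -> e \subset S') ->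
  u \in S -> conn G u v -> exists z, [/\ z \in S, adj G v z & conn (induced G S) u z].
Proof.
move=> sG GS uS cuv; pose C := [set x | conn (induced G S) u x].
have uC : u \in C by rewrite inE conn0.
have CS x : x \in C -> x \in S by rewrite inE => /conn_induced; apply.
have vC : v \notin C by apply: contra (vS) => /CS.
have [x [y [xC yC a]]] := cut_edge cuv uC vC.
have := GS _ a; rewrite sub2 !in_setU1 => /andP[_ /orP[/eqP E|yS]].
  exists x; split; [exact: CS| by rewrite adjC -E| by move: xC; rewrite inE].
case/negP: yC; rewrite inE; move: (xC); rewrite inE => cx.
apply: (conn_trans cx); apply: conn1; rewrite adj_induced yS CS //= andbT; exact: a.
Qed.

(** The state once the heavy edges at [v] are gone. The part inside [S] consists of old tree edges
    but need not be connected: it is enough that everything is connected to [v]. *)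
Record inv G : Prop := Inv {
  inv_c : G \subset cgraph V;
  inv_S : forall e, e \in G -> e \subset S';
  inv_M : induced G S \subset M;
  inv_q : forall z, adj G v z -> w [set v; z] <= q;
  inv_conn : forall u, u \in S -> conn G u v }.

Definition Jconn J Q := forall x y, x \in Q -> y \in Q -> conn (induced J Q) x y.

Lemma Jconn_mono J1 J2 Q : J1 \subset J2 -> Jconn J1 Q -> Jconn J2 Q.
Proof.
move=> s h x y xQ yQ; apply: conn_mono (h x y xQ yQ).
by apply/subsetP=> e; rewrite !inE => /andP[/(subsetP s)-> ->].
Qed.

Lemma Jconn_from J Q x : (forall u, u \in Q -> conn (induced J Q) x u) -> Jconn J Q.
Proof. by move=> h u y uQ yQ; apply: (@conn_trans _ _ x); [rewrite connC|]; exact: h. Qed.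

Lemma Q_in_S F Q x : F \subset M -> x \in S -> (forall u, u \in Q -> conn (induced F Q) x u) ->
  Q \subset S.
Proof.
move=> s xS h; apply/subsetP=> u /h cu.
exact: conn_kr_S (conn_mono (subset_trans (induced_sub _ _) s) cu) xS.
Qed.

(** The edges of [M] in [Q] and the edge [[set v; z]] already connect [v |: Q] at level [q]. *)
Lemma kr_P_le Q z : Q \subset S -> Jconn M Q -> z \in Q -> w [set v; z] <= q ->
  forall e, e \in kr w (v |: Q) -> w e <= q.
Proof.
move=> QS cQ zQ wz.
apply: (@kr_bottleneck _ _ _ w (fun t => t <= q)) => [a b /ltW ab|x y xP yP].
  exact: le_trans.
have vz : conn (below w (fun t => t <= q) (v |: Q)) v z.
  apply: conn1; rewrite adj_below wz in_setU1 eqxx /= in_setU1 zQ orbT !andbT.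
  by apply: contraNneq (vS) => ->; exact: (subsetP QS).
have toz u : u \in v |: Q -> conn (below w (fun t => t <= q) (v |: Q)) u z.
  rewrite in_setU1 => /orP[/eqP->//|uQ]; apply: conn_mono (cQ _ _ uQ zQ).
  apply/subsetP=> e; rewrite inE => /andP[eM eQ]; rewrite inE (subsetP (kr_cgraph _ _) _ eM).
  by rewrite D2 // andbT (subset_trans eQ (subsetUr _ _)).
by apply: (conn_trans (toz x xP)); rewrite connC; exact: toz.
Qed.

Lemma kr_P_M Q e : Q \subset S -> Jconn M Q -> e \in kr w (v |: Q) -> e \subset Q -> e \in M.
Proof.
move=> QS cQ eK eQ; have : e \in kr w Q by apply: kr_restr eK => //; exact: subsetUr.
by rewrite (kr_eq_induced inj QS cQ) inE => /andP[].
Qed.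

Lemma connected_star G Q : (forall u, u \in Q -> exists z,
    [/\ z \in Q, adj G v z & conn (induced G Q) u z]) ->
  connected_on (v |: Q) (induced G (v |: Q)).
Proof.
move=> h; have toz u : u \in v |: Q -> conn (induced G (v |: Q)) u v.
  rewrite in_setU1 => /orP[/eqP->|uQ]; first exact: conn0.
  have [z [zQ az cu]] := h u uQ; apply: (@conn_trans _ _ z).
    apply: conn_mono cu; apply/subsetP=> e; rewrite !inE => /andP[-> /= eQ].
    exact: subset_trans eQ (subsetUr _ _).
  by apply: conn1; rewrite adj_induced adjC az !in_setU1 eqxx zQ orbT.
apply/connP_on=> x y xP yP; apply: (conn_trans (toz x xP)); rewrite connC; exact: toz.
Qed.

(** Inside [Q] the subgraph only has edges of the forest [M] whose ends [J] joins, hence edges of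
    [J]; the terms [b1] and [b2] pay for at most two edges at [v]. *)
Lemma op_weight G Q J z1 z2 b1 b2 : G \subset cgraph V -> induced G S \subset M -> Q \subset S ->
  J \subset M -> Jconn J Q -> z1 \in S -> z2 \in S ->
  w [set v; z1] <= b1 -> w [set v; z2] <= b2 ->
  (forall z, z \in Q -> adj G v z -> z = z1 \/ z = z2) ->
  weight w (induced G (v |: Q)) <= weight w J + b1 + b2.
Proof.
move=> sG GM QS JM cJ z1S z2S wb1 wb2 hz.
have sub : induced G (v |: Q) \subset [set v; z1] |: ([set v; z2] |: J).
  apply/subsetP=> e; rewrite inE => /andP[eG eP]; rewrite !in_setU1.
  have [eQ|[z zQ Ez]] := star_case (subsetP sG _ eG) eP; last first.
    by have [E|E] := hz z zQ ltac:(by rewrite /adj -Ez); rewrite Ez E eqxx ?orbT.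
  have /edgeP[x [y [nxy E]]] := subsetP sG _ eG.
  move: eQ; rewrite E sub2 => /andP[xQ yQ]; apply/orP; right; apply/orP; right.
  apply: (forest_mem forM JM).
    by apply: (subsetP GM); rewrite inE -E eG E sub2 !(subsetP QS).
  by apply: conn_mono (cJ x y xQ yQ); exact: induced_sub.
have sJ : [set v; z2] |: J \subset cgraph V.
  by rewrite subUset sub1set vedge_in //= (subset_trans JM (kr_cgraph _ _)).
apply: le_trans (weight_sub w_ge0 sub _) _; first by rewrite subUset sub1set vedge_in.
apply: le_trans (weightU1 w_ge0 _ (vedge_in z1S)) _.
have := weightU1 w_ge0 J (vedge_in z2S); lra.
Qed.

Lemma inv_step G Q z : inv G -> Q \subset S -> Jconn M Q -> z \in Q -> adj G v z ->
  connected_on (v |: Q) (induced G (v |: Q)) -> inv (step w G (v |: Q)).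
Proof.
move=> [Gc GS GM Gq Gv] QS cQ zQ az cP.
have kle := kr_P_le QS cQ zQ (Gq _ az).
split.
- by rewrite subUset kr_cgraph andbT; apply: subset_trans Gc; exact: subsetDl.
- move=> e; rewrite in_step => /orP[/andP[/GS]//|/kr_in h].
  by apply: (subset_trans h); apply: setUS.
- apply/subsetP=> e; rewrite inE in_step andb_orl => /orP[/andP[/andP[eG _] eS]|/andP[eK eS]].
    by apply: (subsetP GM); rewrite inE eG.
  apply: (kr_P_M QS cQ) => //.
  have [//|[x xQ E]] := star_case (subsetP (kr_cgraph _ _) _ eK) (kr_in eK).
  by have := vedge_nS x; rewrite -E eS.
- by move=> u; rewrite /adj in_step => /orP[/andP[/Gq]//|/kle].
- by move=> u uS; apply: conn_step => //; exact: Gv.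
Qed.

(** An edge of [M'] inside the set is in the tree of the set by [kr_restr]. Hence a step never loses
    an edge of [M'] and creates all those inside its set. *)
Lemma step_keep G Q e : Q \subset S -> e \in M' -> (e \in G) || (e \subset v |: Q) ->
  e \in step w G (v |: Q).
Proof.
move=> QS eM; rewrite in_step; case: (boolP (e \subset v |: Q)) => eP; last by rewrite orbF => ->.
by move=> _; apply/orP; right; apply: kr_restr eM => //; exact: setUS.
Qed.

(* The set on which to optimize in order to treat an edge [v y]. *)
Lemma one_sided F (pi : pred V) y z : F \subset M -> y \in S -> conn F y z -> pi z ->
  exists Q J z', [/\ [/\ y \in Q, Q \subset S, J \subset M, Jconn J Q & weight w J <= c1],
    (forall u, u \in Q -> conn (induced F Q) u z'), z' \in Q, pi z' &
    forall u, u \in Q -> pi u -> u = z'].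
Proof.
move=> FM yS cF piz.
have zS : z \in S by apply: (conn_kr_S (conn_mono FM cF)).
have [J [JM cJ wJ]] := D1 yS zS.
(* Staying in [J] bounds the weight, and stopping at the first vertex satisfying [pi] lets only one
   such vertex into the set. *)
have cc := forest_cap forM FM JM cF cJ.
have [Q [yQ cQ [z' [zQ pz uz]]]] := first_hit cc piz.
have FJ : F :&: J \subset M by apply: subset_trans FM; exact: subsetIl.
exists Q, J, z'; split=> //.
  split=> //; first exact: Q_in_S cQ.
  by apply: Jconn_mono (Jconn_from cQ); exact: subsetIr.
have cQF := Jconn_mono (subsetIl F J) (Jconn_from cQ).
by move=> u uQ; exact: cQF.
Qed.

(* The set on which to optimize in order to treat an edge [a b] of the old tree. *)
Lemma two_sided F (pi : pred V) a b za zb : F \subset M -> adj M a b -> [set a; b] \notin F ->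
  conn F a za -> conn F b zb -> pi za -> pi zb ->
  exists Q J z1 z2, [/\ [/\ [set a; b] \subset Q, Q \subset S, J \subset M, Jconn J Q & weight w J <= c1],
    (forall u, u \in Q -> exists z, [/\ z \in Q, pi z & conn (induced F Q) u z]),
    z1 \in Q, z2 \in Q &
    forall u, u \in Q -> pi u -> u = z1 \/ u = z2].
Proof.
move=> FM ab eF ca cb pa pb.
have /andP[aS bS] := adj_kr_S ab.
have zaS : za \in S by apply: (conn_kr_S (conn_mono FM ca)).
have zbS : zb \in S by apply: (conn_kr_S (conn_mono FM cb)).
have FMe : F \subset M :\ [set a; b].
  by apply/subsetP=> e eFF; rewrite in_setD1 (subsetP FM) // andbT; apply: contraNneq eF => <-.
have br : ~~ conn (M :\ [set a; b]) a b := proj2 forM a b ab.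
have [J [JM cJ wJ]] := D1 zaS zbS.
have JMe : J :\ [set a; b] \subset M :\ [set a; b] by exact: setSD.
have caM := conn_mono FMe ca; have cbM := conn_mono FMe cb.
(* [F] joins [a] to [za] and [b] to [zb] without the bridge [[set a; b]], so a subtree joining [za]
   to [zb] must cross it. A single subtree [J] of weight at most [c1] therefore contains both
   arms. *)
have eJ : [set a; b] \in J.
  apply: contraNT br => nJ; apply: (conn_trans caM); apply: (@conn_trans _ _ zb); last by rewrite connC.
  apply: conn_mono cJ; apply/subsetP=> e eJJ; rewrite in_setD1 (subsetP JM) // andbT.
  by apply: contraNneq nJ => <-.
have [cJa cJb] : conn J a za /\ conn J b zb.
  move: cJ; rewrite -{1}(setD1K eJ) => /conn_add[h|[h1 h2]|[h1 h2]].
  - case/negP: br; apply: (conn_trans caM); apply: (@conn_trans _ _ zb); last by rewrite connC.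
    exact: conn_mono h.
  - by split; [rewrite connC; apply: conn_mono h1|apply: conn_mono h2]; exact: subsetDl.
  - by case/negP: br; apply: (conn_trans caM); exact: conn_mono h1.
have [Qa [aQ cQa [z1 [z1Q pz1 uz1]]]] := first_hit (forest_cap forM FM JM ca cJa) pa.
have [Qb [bQ cQb [z2 [z2Q pz2 uz2]]]] := first_hit (forest_cap forM FM JM cb cJb) pb.
have FJ : F :&: J \subset M by apply: subset_trans FM; exact: subsetIl.
have QaS := Q_in_S FJ aS cQa; have QbS := Q_in_S FJ bS cQb.
have sub (X : {set {set V}}) Q1 Q2 : Q1 \subset Q2 -> induced X Q1 \subset induced X Q2.
  by move=> s; apply/subsetP=> e; rewrite !inE => /andP[-> /subset_trans->].
exists (Qa :|: Qb), J, z1, z2; split.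
- split=> //; first by rewrite sub2 !inE aQ bQ orbT.
    by rewrite subUset QaS.
  have toa : forall u, u \in Qa -> conn (induced J (Qa :|: Qb)) a u.
    move=> u uQ; apply: conn_mono (Jconn_mono (subsetIr F J) (Jconn_from cQa) aQ uQ).
    by apply: sub; exact: subsetUl.
  have tob : forall u, u \in Qb -> conn (induced J (Qa :|: Qb)) b u.
    move=> u uQ; apply: conn_mono (Jconn_mono (subsetIr F J) (Jconn_from cQb) bQ uQ).
    by apply: sub; exact: subsetUr.
  apply: (@Jconn_from _ _ a) => u; rewrite in_setU => /orP[/toa//|/tob h].
  by apply: (conn_trans _ h); apply: conn1; rewrite adj_induced !inE aQ bQ orbT !andbT; exact: eJ.
- move=> u; rewrite in_setU => /orP[uQ|uQ].
    exists z1; split=> //; first by rewrite inE z1Q.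
    apply: conn_mono (Jconn_mono (subsetIl F J) (Jconn_from cQa) uQ z1Q).
    by apply: sub; exact: subsetUl.
  exists z2; split=> //; first by rewrite inE z2Q orbT.
  apply: conn_mono (Jconn_mono (subsetIl F J) (Jconn_from cQb) uQ z2Q).
  by apply: sub; exact: subsetUr.
- by rewrite inE z1Q.
- by rewrite inE z2Q orbT.
- by move=> u; rewrite in_setU => /orP[uQ pu|uQ pu]; [left; exact: uz1|right; exact: uz2].
Qed.

Definition good_op G P := [/\ P \subset S', connected_on P (induced G P),
  weight w (induced G P) <= c & inv (step w G P)].

Lemma induced_mono G1 G2 Q : G1 \subset G2 -> induced G1 Q \subset induced G2 Q.
Proof. by move=> s; apply/subsetP=> e; rewrite !inE => /andP[/(subsetP s)-> ->]. Qed.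

Lemma induced_inner G A Q : Q \subset A -> induced (induced G A) Q = induced G Q.
Proof. exact: induced_induced. Qed.

Lemma make_op G Q J z1 z2 : inv G -> Q \subset S -> J \subset M -> Jconn J Q -> weight w J <= c1 ->
  z1 \in Q -> z2 \in Q -> w [set v; z1] <= q -> w [set v; z2] <= q ->
  (forall u, u \in Q -> exists z, [/\ z \in Q, adj G v z & conn (induced G Q) u z]) ->
  (forall u, u \in Q -> adj G v u -> u = z1 \/ u = z2) -> good_op G (v |: Q).
Proof.
move=> iG QS JM cJ wJ z1Q z2Q w1 w2 hz uz.
have cP := connected_star hz.
have [z [zQ az _]] := hz z1 z1Q.
split=> //; first exact: setUS.
  have := op_weight (inv_c iG) (inv_M iG) QS JM cJ (subsetP QS _ z1Q) (subsetP QS _ z2Q) w1 w2 uz.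
  by move/le_trans; apply; apply: le_trans c1q; rewrite !lerD2r.
by apply: (inv_step iG QS (Jconn_mono JM cJ) zQ az).
Qed.

Lemma attached_to_v G u : inv G -> u \in S -> exists z, [/\ z \in S, adj G v z & conn (induced G S) u z].
Proof. by move=> [Gc GS _ _ Gv] uS; apply: conn_to_v => //; exact: Gv. Qed.

(** The set consists of [v], the ends of [e] and routes in [G] from these ends to the first
    neighbours of [v]. If [e] lies in [S], it is an edge of [M] missing from [G], so that
    [two_sided] applies. *)
Lemma add_mst_edge G e : inv G -> e \in M' -> e \notin G ->
  exists P, good_op G P /\ forall f, f \in M' -> (f \in G) || (f == e) -> f \in step w G P.
Proof.
move=> iG eM eG.
have keep Q : Q \subset S -> e \subset v |: Q ->
    forall f, f \in M' -> (f \in G) || (f == e) -> f \in step w G (v |: Q).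
  move=> QS eQ f fM h; apply: step_keep => //; move: h => /orP[->//|/eqP->].
  by rewrite eQ orbT.
have ZQ z : adj G v z -> w [set v; z] <= q by exact: (inv_q iG).
have [eS|[y yS Ey]] := star_case (subsetP (kr_cgraph _ _) _ eM) (kr_in eM); last first.
  have [z [zS az cz]] := attached_to_v iG yS.
  have [Q [J [z' [[yQ QS JM cJ wJ] cQ zQ pz uz]]]] := one_sided (inv_M iG) yS cz (az : (adj G v) z).
  exists (v |: Q); split; last by apply: keep => //; rewrite Ey sub2 !in_setU1 eqxx yQ orbT.
  apply: (make_op iG QS JM cJ wJ zQ zQ (ZQ _ pz) (ZQ _ pz)).
    by move=> u uQ; exists z'; split=> //; rewrite -(induced_inner G QS); exact: cQ.
  by move=> u uQ pu; left; exact: uz.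
have /edgeP[a [b [nab Ee]]] := subsetP (kr_cgraph _ _) _ eM.
have /andP[aS bS] : (a \in S) && (b \in S) by rewrite -sub2 -Ee.
have ab : adj M a b by rewrite /adj -Ee; apply: kr_restr eM => //; exact: subsetUr.
have [za [zaS aza cza]] := attached_to_v iG aS.
have [zb [zbS azb czb]] := attached_to_v iG bS.
have nF : [set a; b] \notin induced G S by rewrite inE -Ee negb_and eG.
have [Q [J [z1 [z2 [[abQ QS JM cJ wJ] cQ z1Q z2Q uz]]]]] :=
  two_sided (inv_M iG) ab nF cza czb (aza : (adj G v) za) azb.
have hz u : u \in Q -> exists z, [/\ z \in Q, adj G v z & conn (induced G Q) u z].
  by move=> /cQ[z [zQ az cz]]; exists z; split=> //; rewrite -(induced_inner G QS).
exists (v |: Q); split; last first.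
  by apply: keep => //; rewrite Ee; apply: (subset_trans abQ); exact: subsetUr.
pose g z := if adj G v z then z else zb.
have [z0 [z0Q az0 _]] := hz z1 z1Q.
(* [two_sided] does not assert that [z1] and [z2] are neighbours of [v]; replacing a non-neighbour
   by the neighbour [z0] yields the bounds by [q] that [make_op] requires. *)
pose f z := if adj G v z then z else z0.
have fQ z : z \in Q -> f z \in Q by rewrite /f; case: ifP.
have fw z : w [set v; f z] <= q by rewrite /f; case: ifP => // h; apply: ZQ.
apply: (make_op iG QS JM cJ wJ (fQ _ z1Q) (fQ _ z2Q)) => //.
by move=> u uQ au; have [E|E] := uz u uQ au; [left|right]; rewrite /f -E au.
Qed.

Lemma inv_M' : 0 <= q -> S != set0 -> inv M'.
Proof.
move=> q0 /set0Pn[x0 x0S]; split.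
- exact: kr_cgraph.
- by move=> e /kr_in.
- by apply/subsetP=> e; rewrite inE => /andP[eM eS]; apply: kr_restr eM => //; exact: subsetUr.
- have [y [_ [yS wy _ _ _]]] := D3 x0S.
  move=> z az; apply: (kr_P_le (subxx S) _ yS wy) => // a b aS bS.
  have -> : induced M S = M by apply/setP=> e; rewrite inE andb_idr // => /kr_in.
  exact: kr_conn.
- by move=> u uS; apply: kr_conn; rewrite in_setU1 ?eqxx ?uS ?orbT.
Qed.

Lemma step_M' G P g : M' \subset G -> G :\: M' != set0 -> P \subset S' -> g \in G -> g \notin M' ->
  g \subset P -> Jconn M' P ->
  M' \subset step w G P /\ (#|step w G P :\: M'| < #|G :\: M'|)%N.
Proof.
move=> sG nG PS gG gM gP cP.
have E := kr_eq_induced inj PS cP.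
split.
  apply/subsetP=> e eM; rewrite in_step E inducedE eM (subsetP sG) //=; by case: (e \subset P).
apply: proper_card; apply/properP; split.
  apply/subsetP=> e; rewrite !in_setD in_step E inducedE => /andP[nM]; rewrite nM (negbTE nM) /= orbF.
  by move=> /andP[->].
exists g; first by rewrite in_setD gM.
by rewrite in_setD in_step gP E inducedE (negbTE gM) !andbF.
Qed.

Lemma remove_extra_edge G : 0 <= q -> S != set0 -> inv G -> M' \subset G -> G :\: M' != set0 ->
  exists P, [/\ good_op G P, M' \subset step w G P & (#|step w G P :\: M'| < #|G :\: M'|)%N].
Proof.
move=> q0 nS iG sG nG; have iM := inv_M' q0 nS.
have subG Q : induced M' Q \subset induced G Q by exact: induced_mono.
pose ex z := adj G v z && ~~ adj M' v z.
case: (pselect (exists z, ex z)) => [[z exz]|no].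
  have /andP[az nz] := exz.
  have zS : z \in S.
    have := inv_S iG az; rewrite sub2 => /andP[_]; rewrite in_setU1 => /orP[/eqP E|//].
    by have := adj_neq (inv_c iG) az; rewrite E eqxx.
  have [y [yS ay cy]] := attached_to_v iM zS; rewrite connC in cy.
  have [Q [J [z' [[yQ QS JM cJ wJ] cQ zQ pz uz]]]] := one_sided (inv_M iM) yS cy exz.
  have cQ' u : u \in Q -> conn (induced M' Q) u y.
    move=> uQ; rewrite -(induced_inner M' QS); apply: conn_trans (cQ u uQ) _.
    by rewrite connC; exact: cQ.
  (* A second tree neighbour of [v] in [Q] would close a cycle of [M']. *)
  have onlyy u : u \in Q -> adj M' v u -> u = y.
    move=> uQ au; have uS := subsetP QS _ uQ.
    have sub : [set v; y] |: induced M' S \subset M'.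
      by rewrite subUset sub1set induced_sub andbT; exact: ay.
    have : [set v; u] \in [set v; y] |: induced M' S.
      apply: (forest_mem (kr_forest _ inj) sub au); apply: (@conn_trans _ _ y).
        by apply: conn1; exact: setU11.
      rewrite connC; apply: conn_mono (cQ' u uQ); rewrite -(induced_inner M' QS).
      by apply: subset_trans (induced_sub _ _) _; exact: subsetUr.
    by rewrite in_setU1 inE (negbTE (vedge_nS _)) andbF orbF => /eqP /(vedge_inj uS).
  have /andP[az' nz'] := pz.
  exists (v |: Q); have PS : v |: Q \subset S' by exact: setUS.
  have cP : Jconn M' (v |: Q).
    suff /connP_on : connected_on (v |: Q) (induced M' (v |: Q)) by [].
    by apply: connected_star => u uQ; exists y; split=> //; exact: cQ'.
  have [st1 st2] : _ /\ _ := step_M' sG nG PS (az' : [set v; z'] \in G) nz'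
    ltac:(by rewrite sub2 !in_setU1 eqxx zQ orbT) cP.
  split=> //.
  apply: (make_op iG QS JM cJ wJ yQ zQ (inv_q iM ay) (inv_q iG az')).
    move=> u uQ; exists y; split=> //; first exact: (subsetP sG).
    by apply: conn_mono (subG Q) _; exact: cQ'.
  move=> u uQ au; case: (boolP (adj M' v u)) => [/onlyy|nu]; first by left; auto.
  by right; apply: uz => //; rewrite /ex au.
have noex z : adj G v z -> adj M' v z.
  by move=> az; apply: contrapT => /negP nz; apply: no; exists z; rewrite /ex az.
have [g] := set0Pn _ nG; rewrite in_setD => /andP[gM gG].
have [gS|[y yS Ey]] := star_case (subsetP (inv_c iG) _ gG) (inv_S iG gG); last first.
  by have := noex y ltac:(by rewrite /adj -Ey); rewrite /adj -Ey (negbTE gM).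
have /edgeP[a [b [nab Ee]]] := subsetP (inv_c iG) _ gG.
have /andP[aS bS] : (a \in S) && (b \in S) by rewrite -sub2 -Ee.
have ab : adj M a b by rewrite /adj -Ee; apply: (subsetP (inv_M iG)); rewrite inE gG.
have [za [zaS aza cza]] := attached_to_v iM aS.
have [zb [zbS azb czb]] := attached_to_v iM bS.
have nF : [set a; b] \notin induced M' S by rewrite inE -Ee negb_and gM.
have [Q [J [z1 [z2 [[abQ QS JM cJ wJ] cQ z1Q z2Q uz]]]]] :=
  two_sided (inv_M iM) ab nF cza czb (aza : (adj M' v) za) azb.
have hz u : u \in Q -> exists z, [/\ z \in Q, adj M' v z & conn (induced M' Q) u z].
  by move=> /cQ[z [zQ az cz]]; exists z; split=> //; rewrite -(induced_inner M' QS).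
have PS : v |: Q \subset S' by exact: setUS.
have cP : Jconn M' (v |: Q).
  by have /connP_on : connected_on (v |: Q) (induced M' (v |: Q)) by exact: connected_star.
exists (v |: Q).
have [st1 st2] : _ /\ _ := step_M' sG nG PS gG gM
  ltac:(by rewrite Ee; apply: (subset_trans abQ); exact: subsetUr) cP.
split=> //.
have [z0 [z0Q az0 _]] := hz z1 z1Q.
pose f z := if adj M' v z then z else z0.
have fQ z : z \in Q -> f z \in Q by rewrite /f; case: ifP.
have fw z : w [set v; f z] <= q by rewrite /f; case: ifP => // h; apply: (inv_q iM).
apply: (make_op iG QS JM cJ wJ (fQ _ z1Q) (fQ _ z2Q)) => //.
  by move=> u /hz[z [zQ az cz]]; exists z; split=> //; [exact: (subsetP sG)|exact: conn_mono (subG Q) cz].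
by move=> u uQ /noex au; have [E|E] := uz u uQ au; [left|right]; rewrite /f -E au.
Qed.

Lemma reach_mst_of_sup G : 0 <= q -> S != set0 -> inv G -> M' \subset G -> reach w c S' G M'.
Proof.
move=> q0 nS; move: {-1}(#|G :\: M'|) (leqnn #|G :\: M'|) => n.
elim: n G => [|n IH] G le iG sG.
  move: le; rewrite leqn0 cards_eq0 setD_eq0 => sG'.
  have -> : G = M' by apply/eqP; rewrite eqEsubset sG' sG.
  exact: reach0.
case: (eqVneq (G :\: M') set0) => [E|nE]; first by apply: IH => //; rewrite E cards0.
have [P [[PS cP wP iP] sP lt]] := remove_extra_edge q0 nS iG sG nE.
apply: (reachS PS cP wP); apply: IH => //.
by rewrite -ltnS; exact: leq_trans lt le.
Qed.

Lemma reach_mst G : 0 <= q -> S != set0 -> inv G -> reach w c S' G M'.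
Proof.
move=> q0 nS; move: {-1}(#|M' :\: G|) (leqnn #|M' :\: G|) => n.
elim: n G => [|n IH] G le iG.
  move: le; rewrite leqn0 cards_eq0 setD_eq0 => sG'; exact: reach_mst_of_sup.
case: (eqVneq (M' :\: G) set0) => [E|/set0Pn[e]]; first by apply: IH => //; rewrite E cards0.
rewrite in_setD => /andP[eG eM].
have [P [[PS cP wP iP] keep]] := add_mst_edge iG eM eG.
apply: (reachS PS cP wP); apply: IH => //; rewrite -ltnS; apply: leq_trans le.
apply: proper_card; apply/properP; split.
  apply/subsetP=> f; rewrite !in_setD => /andP[nf fM]; rewrite fM andbT.
  by apply: contra nf => fG; apply: keep => //; rewrite fG.
by exists e; rewrite in_setD ?eG //= keep ?eqxx ?orbT.
Qed.

(** The state while heavy edges at [v] are removed: the old tree is intact and [v] hangs on it by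
    some edge, possibly heavy. *)
Record hinv G : Prop := Hinv {
  h_c : G \subset cgraph V;
  h_S : forall e, e \in G -> e \subset S';
  h_M : induced G S = M;
  h_v : exists2 z, z \in S & adj G v z }.

Definition heavy G := [set z in S | adj G v z && (q < w [set v; z])].

Lemma hinv_inv G : hinv G -> heavy G = set0 -> inv G.
Proof.
move=> [Gc GS GM [z zS az]] h0; split=> //; first by rewrite GM.
  move=> y ay; have yS : y \in S.
    have := GS _ ay; rewrite sub2 => /andP[_]; rewrite in_setU1 => /orP[/eqP E|//].
    by have := adj_neq Gc ay; rewrite E eqxx.
  have := in_set0 y; rewrite -h0 inE yS ay /=; by case: ltP.
move=> u uS; apply: (@conn_trans _ _ z); last by apply: conn1; rewrite adjC.
by apply: conn_mono (kr_conn w uS zS); rewrite -GM induced_sub.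
Qed.

(** A tree route from a heavy neighbour [z0] to the first vertex [y0] with [[set v; y0]] light is
    cut back, seen from [y0], to the first heavy neighbour [z1]. The only possible edges at [v] are
    then those to [y0] and [z1], which gives the weight [c3 + q + 1]. As [y0] is the only light
    candidate, the tree of the set is the route with [[set v; y0]]: the heavy edge disappears and
    the old tree survives. *)
Lemma heavy_step G : hinv G -> heavy G != set0 ->
  exists P, [/\ P \subset S', connected_on P (induced G P),
    weight w (induced G P) <= c, hinv (step w G P) & (#|heavy (step w G P)| < #|heavy G|)%N].
Proof.
move=> [Gc GS GM _] /set0Pn[z0 z0h].
have z0S : z0 \in S by move: z0h; rewrite inE => /andP[].
have [y [J [yS wy JM cJ wJ]]] := D3 z0S.
pose light u := w [set v; u] <= q.
have [Q1 [zQ1 cQ1 [y0 [y0Q1 ly0 uy0]]]] := first_hit cJ (wy : light y).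
have cyz : conn (induced J Q1) y0 z0 by rewrite connC; exact: cQ1.
have [Q [yQ cQ [z1 [z1Q hz1 uz1]]]] := first_hit cyz (z0h : (mem (heavy G)) z0).
have QQ1 : Q \subset Q1.
  by apply/subsetP=> u /cQ c'; apply: (conn_induced (conn_mono (induced_sub _ _) c')).
have cQJ : forall u, u \in Q -> conn (induced J Q) y0 u.
  move=> u uQ; apply: conn_mono (cQ u uQ); apply: induced_mono; exact: induced_sub.
have cJQ := Jconn_from cQJ.
have y0S : y0 \in S.
  exact: conn_kr_S (conn_mono (subset_trans (induced_sub _ _) JM) (cQ1 _ y0Q1)) z0S.
have QS := Q_in_S JM y0S cQJ.
have cMQ := Jconn_mono JM cJQ.
have z1S := subsetP QS _ z1Q.
have [az1 hz1'] : adj G v z1 /\ q < w [set v; z1].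
  by move: hz1; rewrite /= inE => /and3P[].
have GMQ : induced G Q = induced M Q by rewrite -GM induced_inner.
have cP : connected_on (v |: Q) (induced G (v |: Q)).
  by apply: connected_star => u uQ; exists z1; split=> //; rewrite GMQ; exact: cMQ.
have kle := kr_P_le QS cMQ yQ ly0.
have vK z : adj (kr w (v |: Q)) v z -> z = y0.
  move=> az; have /andP[_ zP] := adj_kr_S az.
  apply: uy0; last exact: kle az.
  apply: (subsetP QQ1); move: zP; rewrite in_setU1 => /orP[/eqP E|//].
  by have := adj_neq (kr_cgraph _ _) az; rewrite E eqxx.
have ay0 : adj (kr w (v |: Q)) v y0.
  have vP : v \in v |: Q by exact: setU11.
  have yP : y0 \in v |: Q by rewrite in_setU1 yQ orbT.
  have [a [b []]] : exists a b, [/\ a \in [set v], b \notin [set v] & adj (kr w (v |: Q)) a b].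
    apply: (cut_edge (kr_conn w vP yP)); rewrite inE //.
    by apply: contraNneq (vS) => <-.
  by rewrite inE => /eqP-> _ /[dup] /vK->.
have KM e : e \in kr w (v |: Q) -> e = [set v; y0] \/ e \in induced M Q.
  move=> eK; have [eQ|[z zQ E]] := star_case (subsetP (kr_cgraph _ _) _ eK) (kr_in eK).
    by right; rewrite inE eQ andbT; exact: (kr_P_M QS cMQ).
  by left; rewrite E (vK z) // /adj -E.
(* [v] is a leaf of the new tree, so lighter tree edges that join two vertices of [Q] can do so
   without passing through [v]. *)
have MK e : e \in M -> e \subset Q -> e \in kr w (v |: Q).
  move=> eM eQ; have /edgeP[a [b [nab Ee]]] := subsetP (kr_cgraph _ _) _ eM.
  move: eQ; rewrite Ee sub2 => /andP[aQ bQ].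
  have naM : ~~ conn (lighter w [set a; b] S) a b.
    by have : adj M a b; [rewrite /adj -Ee|rewrite adj_kr => /and4P[]].
  rewrite -/(adj _ a b) adj_kr nab !in_setU1 aQ bQ !orbT /=; apply: contra naM => cl.
  have := kr_minimax (fun a b ab => lt_trans ab) cl.
  set X := _ :&: _ => cX.
  pose Y := X :&: induced M Q.
  have XY : X \subset [set v; y0] |: Y.
    apply/subsetP=> e' e'X; rewrite in_setU1 in_setI e'X /=.
    by move: e'X; rewrite in_setI => /andP[/KM[->|->]]; rewrite ?eqxx ?orbT.
  have YL : Y \subset lighter w [set a; b] S.
    apply/subsetP=> e'; rewrite !in_setI => /andP[/andP[_ +]]; rewrite inducedE !inE.
    by move=> /and3P[-> _ ->] /andP[_ /subset_trans->].
  have viso u : conn Y v u -> u = v.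
    move: u; apply: conn_ind => // u u' _ -> ; rewrite /adj in_setI => /andP[_].
    by rewrite inducedE sub2 => /andP[_ /andP[vQ _]]; move: (vS); rewrite (subsetP QS).
  have := conn_mono XY cX => /conn_add[h|[h _]|[_ h]].
  - exact: conn_mono h.
  - by move: (vS); rewrite -(viso a) ?(subsetP QS) // connC.
  - by move: (vS); rewrite -(viso b h) ?(subsetP QS).
exists (v |: Q); split=> //; first exact: setUS.
- have z1w : w [set v; z1] <= 1 by apply: w_le1; exact: vedge_in.
  have GM' : induced G S \subset M by rewrite GM.
  have uz u : u \in Q -> adj G v u -> u = y0 \/ u = z1.
    move=> uQ au; case: (leP (w [set v; u]) q) => h; first by left; apply: uy0 => //; exact: (subsetP QQ1).
    by right; apply: uz1 => //=; rewrite inE (subsetP QS _ uQ) au h.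
  have := op_weight Gc GM' QS JM cJQ y0S z1S ly0 z1w uz.
  by move/le_trans; apply; apply: le_trans c3q; rewrite !lerD2r.
- split.
  + by rewrite subUset kr_cgraph andbT; apply: subset_trans Gc; exact: subsetDl.
  + move=> e; rewrite in_step => /orP[/andP[/GS]//|/kr_in h].
    by apply: (subset_trans h); apply: setUS.
  + apply/setP=> e; have MG : (e \in M) = (e \in G) && (e \subset S) by rewrite -[in LHS]GM inducedE.
    rewrite inducedE in_step MG; case eS : (e \subset S); rewrite ?andbF // !andbT.
    have GMe : (e \in G) = (e \in M) by rewrite MG eS andbT.
    rewrite GMe; case: (boolP (e \in kr w (v |: Q))) => [eK|eK]; last first.
      rewrite orbF; case eM : (e \in M) => //=; apply: contra eK => eP; apply: MK => //.
      have [//|[z zQ E]] := star_case (subsetP (kr_cgraph _ _) _ eM) eP.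
      by have := vedge_nS z; rewrite -E eS.
    rewrite orbT; have [E|] := KM e eK; first by move: eS; rewrite E (negbTE (vedge_nS _)).
    by rewrite inducedE => /andP[->].
  + by exists y0 => //; rewrite /adj in_step; apply/orP; right; exact: ay0.
- apply: proper_card; apply/properP; split.
    apply/subsetP=> u; rewrite !inE => /and3P[uS + hu]; rewrite uS hu /adj in_step andbT.
    by move=> /orP[/andP[]//|/kle]; rewrite leNgt hu.
  exists z1 => //; rewrite inE hz1' andbT negb_and; apply/orP; right.
  rewrite /adj in_step sub2 !in_setU1 eqxx z1Q orbT /= andbF /=; apply/negP=> /kle.
  by rewrite leNgt hz1'.
Qed.

Lemma grow_in G : 0 <= q -> hinv G -> reach w c S' G M'.
Proof.
move=> q0; move: {-1}(#|heavy G|) (leqnn #|heavy G|) => n.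
elim: n G => [|n IH] G le hG.
  move: le; rewrite leqn0 cards_eq0 => /eqP h0; apply: reach_mst (hinv_inv hG h0) => //.
  by have [z zS _] := h_v hG; apply/set0Pn; exists z.
case: (eqVneq (heavy G) set0) => [E|nE]; first by apply: IH => //; rewrite E cards0.
have [P [PS cP wP iP lt]] := heavy_step hG nE.
apply: (reachS PS cP wP); apply: IH => //.
by rewrite -ltnS; exact: leq_trans lt le.
Qed.

Theorem growth H : 0 <= q -> H \subset cgraph V -> induced H S = M ->
  (exists2 z, z \in S & adj H v z) ->
  reach w c [set: V] H ((H :\: induced H S') :|: M').
Proof.
move=> q0 sH HM [z zS az]; apply: reach_lift; apply: grow_in => //; split.
- by apply: subset_trans (induced_sub _ _) sH.
- by move=> e; rewrite inE => /andP[].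
- by rewrite induced_inner // subsetUr.
- by exists z => //; rewrite adj_induced az !in_setU1 eqxx zS orbT.
Qed.

End Growth.

(** * Prim's algorithm *)

Section Prim.
Import mathcomp.boot.fintype mathcomp.boot.finset Pilot.Defs.
Local Open Scope set_scope.
Local Open Scope order_scope.
Variables (V : finType) (disp : Order.disp_t) (T : orderType disp).
Implicit Types (w : {set V} -> T) (x y z a b u v : V) (A B S U : {set V}) (e : {set V}) (J : {set {set V}}).

Definition crossing U A : {set {set V}} :=
  [set e in cgraph V | [&& e \subset U, ~~ (e \subset A) & ~~ [disjoint e & A]]].

Definition lightest w U A (e : {set V}) :=
  (e \in crossing U A) && [forall e' in crossing U A, w e <= w e'].

(* The first [i] steps of Prim's algorithm started from [x] inside [U]. *)
Fixpoint prim w U x i : {set V} :=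
  if i is j.+1 then
    let A := prim w U x j in
    if [pick e | lightest w U A e] is Some e then A :|: e else A
  else [set x].

Lemma crossing2 U A a y : a \in A -> y \notin A -> a \in U -> y \in U ->
  [set a; y] \in crossing U A.
Proof.
move=> aA yA aU yU; rewrite inE edge2 !sub2 aU yU aA (negbTE yA) /=.
apply/andP; split; first by apply: contraNneq yA => <-.
by apply/negP=> /pred0P/(_ a); rewrite /= !inE eqxx aA.
Qed.

Lemma crossingP U A e : e \in crossing U A -> exists a y,
  [/\ a \in A, y \notin A, a \in U, y \in U & e = [set a; y]].
Proof.
rewrite inE => /andP[/edgeP[a [b [nab ->]]]]; rewrite !sub2 => /and3P[/andP[aU bU]].
rewrite negb_and => h1 /pred0Pn[c /andP[/=]]; rewrite !inE => h2 cA.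
case aA : (a \in A); case bA : (b \in A); move: h1; rewrite aA bA //= => _.
- by exists a, b; rewrite aA bA.
- by exists b, a; rewrite aA bA; split=> //; rewrite setUC.
- by move: h2 => /orP[]/eqP E; rewrite -E cA in aA bA.
Qed.

Lemma lightest_ex w U A e : e \in crossing U A -> exists e', lightest w U A e'.
Proof.
move=> eC; have eC' : (mem (crossing U A)) e by [].
case: (arg_minP w eC') => e' e'C mn; exists e'; rewrite /lightest.
by apply/andP; split; [exact: e'C|apply/forall_inP=> g gC; exact: mn].
Qed.

Lemma prim_sub w U x i : x \in U -> prim w U x i \subset U.
Proof.
move=> xU; elim: i => [|i IH] /=; first by rewrite sub1set.
case: pickP => [e /andP[]|_] //; rewrite inE => /and3P[_ eU _] _.
by rewrite subUset IH.
Qed.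

Lemma prim_in w U x i : x \in prim w U x i.
Proof.
elim: i => [|i IH] /=; first by rewrite inE.
by case: pickP => [e _|_] //; rewrite inE IH.
Qed.

Lemma card_prim w U x i : x \in U -> (i < #|U|)%N -> #|prim w U x i| = i.+1.
Proof.
move=> xU; elim: i => [|i IH] lt /=; first by rewrite cards1.
have cA := IH (ltnW lt); have AU := prim_sub w i xU.
case: pickP => [e /andP[eC _]|no].
  have [a [y [aA yA aU yU ->]]] := crossingP eC.
  have -> : prim w U x i :|: [set a; y] = y |: prim w U x i.
    apply/setP=> z; rewrite !inE; case: (eqVneq z a) => [->|_] /=; last by rewrite orbC.
    by rewrite aA !orbT.
  by rewrite cardsU1 yA cA.
have [y yU yA] : exists2 y, y \in U & y \notin prim w U x i.
  by have /properP[_ [y yU yA]] : prim w U x i \proper U;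
    [rewrite properEcard AU cA | exists y].
have [e h] := lightest_ex w (crossing2 (prim_in w U x i) yA xU yU).
by rewrite no in h.
Qed.

(** Only the weights inside [U] matter; this makes the visited set independent of the edges that
    leave [U]. *)
Lemma eq_prim w1 w2 U x i : (forall e, e \in cgraph V -> e \subset U -> w1 e = w2 e) ->
  prim w1 U x i = prim w2 U x i.
Proof.
move=> h; elim: i => //= i ->; set A := prim _ _ _ _.
rewrite (@eq_pick _ _ (lightest w2 U A)) // => e; rewrite /lightest; apply: andb_id2l => eC.
apply: eq_forallb_in => g gC.
by rewrite !h //; [move: gC|move: gC|move: eC|move: eC]; rewrite inE => /and4P[].
Qed.

(* Prim's steps inside [U = S :\: B] are edges of the minimum spanning tree of [S]
   as long as they do not meet the hub [B]. *)
Lemma prim_hub w S B x i : {in cgraph V &, injective w} -> B \subset S -> x \in S :\: B ->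
  exists J, [/\ J \subset kr w S, (#|J| <= i)%N &
    (exists2 b, b \in B & conn J x b) \/
    ((B = set0 \/ (i < #|S :\: B|)%N) /\
     forall y, y \in prim w (S :\: B) x i -> conn J x y)].
Proof.
move=> inj BS xU; set U := S :\: B in xU *.
have xS : x \in S by move: xU; rewrite inE => /andP[].
elim: i => [|i [J [JM cJ IH]]].
  exists set0; rewrite sub0set cards0; split=> //; right; split.
    by right; apply/card_gt0P; exists x.
  by move=> y; rewrite inE => /eqP->; exact: conn0.
case: IH => [h|[hB h]]; first by exists J; split=> //; [exact: leqW|left].
set A := prim w U x i in h.
have AU : A \subset U by exact: prim_sub.
have AS : A \subset S by apply: (subset_trans AU); exact: subsetDl.
have xA : x \in A by exact: prim_in.
case: (eqVneq A S) => [AE|AnS].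
  have B0 : B = set0.
    apply/eqP; rewrite -subset0; apply/subsetP=> b bB.
    by have := subsetP AU b; rewrite AE (subsetP BS _ bB) => /(_ isT); rewrite inE bB.
  exists J; split=> //; first exact: leqW.
  right; split; first by left.
  move=> y yp; apply: h; rewrite AE; apply: (subsetP (subsetDl S B)).
  by apply: (subsetP (prim_sub w i.+1 xU)).
have [y0 y0S y0A] : exists2 y, y \in S & y \notin A.
  have /properP[_ [y yS yA]] : A \proper S by rewrite properEneq AnS.
  by exists y.
have [e /andP[eC /forall_inP emin]] := lightest_ex w (crossing2 xA y0A xS y0S).
have [a [y [aA yA aS yS E]]] := crossingP eC.
(* The lightest edge leaving [A] in all of [S] is a tree edge. Either it enters the hub, or it stays
   in [U] and is the one chosen by Prim's algorithm there. *)
have eM : e \in kr w S.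
  rewrite E; apply: (kr_cut aA yA) => // u v uA uS vA vS; rewrite -E.
  by apply: emin; exact: crossing2.
have xy : conn (e |: J) x y.
  apply: (@conn_trans _ _ a); first by apply: conn_mono (h a aA); exact: subsetUr.
  by apply: conn1; rewrite /adj -E setU11.
have eJM : e |: J \subset kr w S by rewrite subUset sub1set eM.
have ceJ : (#|e |: J| <= i.+1)%N by rewrite cardsU1; case: (e \notin J) => //; exact: leqW.
exists (e |: J); split=> //.
case yB : (y \in B); first by left; exists y.
right.
have yU : y \in U by rewrite inE yB.
have aU : a \in U by exact: (subsetP AU).
have eU : e \in crossing U A by rewrite E; exact: crossing2.
have le : lightest w U A e.
  rewrite /lightest eU; apply/forall_inP=> g /crossingP[c [d [cA dA cU dU ->]]].
  by apply: emin; apply: crossing2 => //; apply: (subsetP (subsetDl S B)).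
split.
  case: hB => [|hi]; [by left|right].
  rewrite -(card_prim w xU hi); apply: proper_card; apply/properP; split=> //.
  by exists y.
rewrite /=; case: pickP => [g /andP[gC /forall_inP gm]|]; last by move/(_ e); rewrite le.
have -> : g = e.
  have inC f : f \in crossing U A -> f \in cgraph V by rewrite inE => /andP[].
  apply: inj; rewrite ?inC //; apply/eqP; rewrite eq_le gm //=.
  by case/andP: le => _ /forall_inP; apply.
move=> z; rewrite in_setU => /orP[zA|].
  by apply: conn_mono (h z zA); exact: subsetUr.
rewrite E !inE => /orP[]/eqP->; last by rewrite -E.
by apply: conn_mono (h a aA); exact: subsetUr.
Qed.

(** Within [I] tree edges the exploration has either entered [B] or visited a vertex with an edge
    lighter than [c] to [B]; in the latter case [kr_minimax] supplies a route of tree edges lighter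
    than [c]. Exhausting [S :\: B] is impossible without entering [B]. *)
Lemma hub_conn w S B (c : T) I x : {in cgraph V &, injective w} -> B \subset S -> B != set0 -> x \in S ->
  (x \in S :\: B -> (I < #|S :\: B|)%N ->
     exists a b, [/\ a \in prim w (S :\: B) x I, b \in B & w [set a; b] < c]) ->
  exists J b, [/\ J \subset kr w S, (#|J| <= I)%N, b \in B &
     conn (J :|: (kr w S :&: below w (fun t => t < c) S)) x b].
Proof.
move=> inj BS B0 xS; case xB : (x \in B).
  by move=> _; exists set0, x; rewrite sub0set cards0; split=> //; exact: conn0.
have xU : x \in S :\: B by rewrite inE xB.
have [J [JM cJ [[b bB c1]|[hB c1]]]] := prim_hub I inj BS xU => hI.
  by exists J, b; split=> //; apply: conn_mono c1; exact: subsetUl.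
case: hB => [E|lt]; first by rewrite E eqxx in B0.
have [a [b [aP bB wab]]] := hI xU lt.
exists J, b; split=> //; apply: (@conn_trans _ _ a).
  by apply: conn_mono (c1 a aP); exact: subsetUl.
have aU := subsetP (prim_sub w I xU) _ aP.
have aS : a \in S by move: aU; rewrite inE => /andP[].
have nab : a != b by move: aU; rewrite inE => /andP[aB _]; apply: contraNneq aB => ->.
apply: conn_mono (subsetUr _ _) _; apply: kr_minimax => [t u tu uc|]; first exact: lt_trans uc.
by apply: conn1; rewrite adj_below nab aS (subsetP BS) // wab.
Qed.

Lemma prim_conn w S x i : {in cgraph V &, injective w} -> x \in S ->
  exists J, [/\ J \subset kr w S, (#|J| <= i)%N &
    forall y, y \in prim w S x i -> conn J x y].
Proof.
move=> inj xS; have xS0 : x \in S :\: set0 by rewrite setD0.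
have [J [JM cJ h]] := prim_hub i inj (sub0set S) xS0.
exists J; split=> //; case: h => [[b]|[_]]; first by rewrite inE.
by rewrite setD0.
Qed.

Lemma hub_bottleneck w S B (c m : T) : B \subset S -> B != set0 -> c <= m ->
  (forall a b, a \in B -> b \in B -> conn (below w (fun t => t < c) S) a b) ->
  (forall x, x \in S :\: B -> exists2 b, b \in B & w [set x; b] < m) ->
  forall e, e \in kr w S -> w e < m.
Proof.
move=> BS /set0Pn[b0 b0B] cm hB hx.
have sub : below w (fun t => t < c) S \subset below w (fun t => t < m) S.
  by apply: below_imp => t tc; exact: lt_le_trans cm.
have to u : u \in S -> conn (below w (fun t => t < m) S) u b0.
  move=> uS; case uB : (u \in B); first by apply: conn_mono (hB _ _ uB b0B).
  have [|b bB wb] := hx u; first by rewrite inE uB.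
  apply: (@conn_trans _ _ b); last by apply: conn_mono (hB _ _ bB b0B).
  apply: conn1; rewrite adj_below uS (subsetP BS) // wb !andbT.
  by apply: contraFneq uB => ->.
apply: (@kr_bottleneck _ _ _ w (fun t => t < m)) => [t u tu um|x y xS yS]; first exact: lt_trans um.
by apply: (conn_trans (to x xS)); rewrite connC; exact: to.
Qed.

End Prim.

(** * Independent uniform discrete weights *)

HB.lock Definition Ex (R : realType) (I : finType) (N : nat) (X : {ffun I -> 'I_N} -> R) : R :=
  (\sum_f X f) / #|{: {ffun I -> 'I_N}}|%:R.

Section FinProb.
Import mathcomp.boot.fintype mathcomp.boot.finset Pilot.Defs.
Local Open Scope set_scope.
Local Open Scope ring_scope.
Variables (R : realType) (I : finType) (N : nat).
Hypothesis N0 : (0 < N)%N.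
Local Notation Om := {ffun I -> 'I_N}.
Implicit Types (X Y : Om -> R) (A B : pred Om) (D : {set I}) (f g : Om).

Local Notation Ex := (@Ex R I N).
Definition Pr A : R := Ex (fun f => (A f)%:R).

Definition dep (Z : Type) D (X : Om -> Z) :=
  forall f g, (forall e, e \in D -> f e = g e) -> X f = X g.

Lemma card_Om_gt0 : 0 < #|{: Om}|%:R :> R.
Proof. by rewrite ltr0n card_ffun card_ord expn_gt0 N0. Qed.

Lemma eq_Ex X Y : X =1 Y -> Ex X = Ex Y.
Proof. by move=> h; rewrite !Ex.unlock; congr (_ / _); apply: eq_bigr. Qed.

Lemma le_Ex X Y : (forall f, X f <= Y f) -> Ex X <= Ex Y.
Proof. by move=> h; rewrite !Ex.unlock ler_pM2r ?invr_gt0 ?card_Om_gt0 //; apply: ler_sum. Qed.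

Lemma Ex_const (c : R) : Ex (fun=> c) = c.
Proof.
rewrite !Ex.unlock sumr_const -[c *+ _]mulr_natr -mulrA divff ?mulr1 //.
by rewrite gt_eqF // card_Om_gt0.
Qed.

Lemma Ex_sum (J : finType) (P : pred J) (F : J -> Om -> R) :
  Ex (fun f => \sum_(j | P j) F j f) = \sum_(j | P j) Ex (F j).
Proof. by rewrite !Ex.unlock exchange_big mulr_suml. Qed.

Lemma Ex_add X Y : Ex (fun f => X f + Y f) = Ex X + Ex Y.
Proof. by rewrite !Ex.unlock big_split mulrDl. Qed.

Lemma Ex_scale (c : R) X : Ex (fun f => c * X f) = c * Ex X.
Proof. by rewrite !Ex.unlock -mulr_sumr mulrA. Qed.

Lemma Ex_ge0 X : (forall f, 0 <= X f) -> 0 <= Ex X.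
Proof. by move=> h; rewrite -[0]Ex_const; apply: le_Ex. Qed.

Lemma Pr_ge0 A : 0 <= Pr A.
Proof. by apply: Ex_ge0 => f; case: (A f). Qed.

Lemma Pr_le A B : (forall f, A f -> B f) -> Pr A <= Pr B.
Proof.
move=> h; apply: le_Ex => f; case Af : (A f); last by rewrite ler0n.
by rewrite (h f Af).
Qed.

Lemma eq_Pr A B : A =1 B -> Pr A = Pr B.
Proof. by move=> h; apply: eq_Ex => f; rewrite h. Qed.

Lemma Pr_le1 A : Pr A <= 1.
Proof. by rewrite -[1]Ex_const; apply: le_Ex => f; case: (A f); rewrite ?ler01. Qed.

Lemma Pr_false : Pr (fun=> false) = 0.
Proof. exact: Ex_const. Qed.

Lemma Pr_all A : (forall f, A f) -> Pr A = 1.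
Proof. by move=> h; rewrite -[RHS]Ex_const; apply: eq_Ex => f; rewrite h. Qed.

Lemma Pr_or A B : Pr (fun f => A f || B f) <= Pr A + Pr B.
Proof.
rewrite -Ex_add; apply: le_Ex => f.
by case: (A f); case: (B f) => /=; rewrite ?addr0 ?add0r ?lerDl ?ler01.
Qed.

Lemma Pr_union (J : finType) (P : pred J) (F : J -> pred Om) A :
  (forall f, A f -> exists2 j, P j & F j f) -> Pr A <= \sum_(j | P j) Pr (F j).
Proof.
move=> h; rewrite -Ex_sum; apply: le_Ex => f; case Af : (A f); last first.
  by apply: sumr_ge0 => j _; case: (F j f).
have [j Pj Fj] := h f Af; rewrite (bigD1 j) //= Fj lerDl.
by apply: sumr_ge0 => i _; case: (F i f).
Qed.

Lemma Pr_partition (J : finType) (Z : Om -> J) A :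
  Pr A = \sum_j Pr (fun f => A f && (Z f == j)).
Proof.
rewrite -Ex_sum; apply: eq_Ex => f; rewrite (bigD1 (Z f)) //= eqxx andbT big1 ?addr0 // => j.
by rewrite eq_sym => /negbTE->; rewrite andbF.
Qed.

Lemma Markov X (a : R) : 0 < a -> (forall f, 0 <= X f) -> Pr (fun f => a <= X f) <= Ex X / a.
Proof.
move=> a0 X0; rewrite ler_pdivlMr // mulrC -Ex_scale; apply: le_Ex => f.
by case: (leP a (X f)) => h; rewrite ?mulr1 ?mulr0.
Qed.

Definition mix D f g : Om := [ffun e => if e \in D then f e else g e].

Lemma mix_in D f g e : e \in D -> mix D f g e = f e.
Proof. by move=> h; rewrite ffunE h. Qed.
Lemma mix_out D f g e : e \notin D -> mix D f g e = g e.
Proof. by move=> /negbTE h; rewrite ffunE h. Qed.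

(** For a pair [(f, g)] of independent copies, exchanging the coordinates outside [D1] turns the sum
    of [X f * Y f] into that of [X f * Y g]. *)
Lemma Ex_indep D1 D2 X Y : [disjoint D1 & D2] -> dep D1 X -> dep D2 Y ->
  Ex (fun f => X f * Y f) = Ex X * Ex Y.
Proof.
move=> dis dX dY.
pose sw (p : Om * Om) := (mix D1 p.1 p.2, mix D1 p.2 p.1).
have swK : involutive sw.
  by move=> [f g]; congr pair; apply/ffunP=> e; rewrite !ffunE; case: (e \in D1).
have E1 : (\sum_f X f) * (\sum_g Y g) = \sum_p X p.1 * Y p.2.
  by rewrite -(pair_bigA _ (fun f g => X f * Y g)) mulr_suml; apply: eq_bigr => f _; rewrite mulr_sumr.
have E2 : \sum_p X p.1 * Y p.2 = \sum_(p : Om * Om) X p.1 * Y p.1.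
  rewrite [RHS](reindex_inj (inv_inj swK)) /=; apply: eq_bigr => -[f g] _ /=; congr (_ * _).
    by apply: dX => e eD; rewrite mix_in.
  by apply: dY => e eD; rewrite mix_out // (disjointFl dis).
have E3 : \sum_(p : Om * Om) X p.1 * Y p.1 = (\sum_f X f * Y f) * #|{: Om}|%:R.
  rewrite -(pair_bigA _ (fun f g => X f * Y f)) mulr_suml; apply: eq_bigr => f _ /=.
  by rewrite sumr_const mulr_natr.
have n0 : #|{: Om}|%:R != 0 :> R by rewrite gt_eqF // card_Om_gt0.
rewrite !Ex.unlock mulrACA E1 E2 E3 -invfM.
by rewrite invfM mulrA mulfK.
Qed.

Lemma Pr_indep D1 D2 A B : [disjoint D1 & D2] -> dep D1 A -> dep D2 B ->
  Pr (fun f => A f && B f) = Pr A * Pr B.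
Proof.
move=> dis dA dB; rewrite -(Ex_indep dis (X := fun f => (A f)%:R) (Y := fun f => (B f)%:R)).
- by apply: eq_Ex => f; rewrite -natrM mulnb.
- by move=> f g h; rewrite (dA f g h).
- by move=> f g h; rewrite (dB f g h).
Qed.

Lemma Ex_prod D (G : I -> 'I_N -> R) :
  Ex (fun f => \prod_(e in D) G e (f e)) = \prod_(e in D) ((\sum_v G e v) / N%:R).
Proof.
have n0 : N%:R != 0 :> R by rewrite pnatr_eq0 -lt0n.
pose G' e v := if e \in D then G e v else 1.
have E1 : \sum_(f : Om) \prod_(e in D) G e (f e) = \sum_(f : Om) \prod_e G' e (f e).
  by apply: eq_bigr => f _; rewrite [LHS]big_mkcond; apply: eq_bigr => e _.
rewrite !Ex.unlock E1 -(bigA_distr_bigA G') card_ffun card_ord natrX.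
have -> : (N%:R : R) ^+ #|I| = \prod_(e : I) N%:R by rewrite prodr_const.
rewrite -prodf_div [RHS]big_mkcond /=; apply: eq_bigr => e _; rewrite /G'.
by case: (e \in D) => //; rewrite sumr_const card_ord divff.
Qed.

Lemma Pr_rect D (Q : I -> pred 'I_N) :
  Pr (fun f => [forall e in D, Q e (f e)]) = \prod_(e in D) (#|Q e|%:R / N%:R).
Proof.
have -> : Pr (fun f => [forall e in D, Q e (f e)]) = Ex (fun f => \prod_(e in D) (Q e (f e))%:R).
  apply: eq_Ex => f; case: (boolP [forall e in D, _]) => [/forall_inP h|/forall_inPn[e eD /negbTE h]].
    by rewrite big1 // => e eD; rewrite h.
  by rewrite (bigD1 e) //= h mul0r.
rewrite (Ex_prod D (fun e v => (Q e v)%:R)); apply: eq_bigr => e _; congr (_ / _).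
rewrite -sum1_card natr_sum [RHS]big_mkcond /=; apply: eq_bigr => v _.
by rewrite unfold_in; case: (Q e v).
Qed.

Lemma card_ord_lt c : (c <= N)%N -> #|[pred v : 'I_N | (v < c)%N]| = c.
Proof.
by move=> h; rewrite -sum1_card -(big_ord_widen _ (fun=> 1%N)) // sum1_card card_ord.
Qed.

Lemma card_ord_ge c : (c <= N)%N -> #|[pred v : 'I_N | (c <= v)%N]| = (N - c)%N.
Proof.
move=> h; have := cardC [pred v : 'I_N | (v < c)%N].
rewrite card_ord_lt // card_ord => E; rewrite -[X in (X - c)%N]E addKn.
by apply: eq_card => v; rewrite !inE leqNgt.
Qed.

End FinProb.

(** * Counts, clusters and Prim's algorithm under random levels *)

Section GraphProb.
Import mathcomp.boot.fintype mathcomp.boot.finset Pilot.Defs.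
Local Open Scope set_scope.
Local Open Scope ring_scope.
Variables (R : realType) (V : finType) (N : nat).
Hypothesis N0 : (0 < N)%N.
Local Notation Om := {ffun {set V} -> 'I_N}.
Local Notation Pr := (@Pr R {set V} N).
Local Notation Ex := (@Ex R {set V} N).
Implicit Types (f : Om) (x y r : V) (S U J b a : {set V}) (e : {set V}) (D : {set {set V}}) (c : nat).

Definition wt f : {set V} -> nat := fun e => f e.

Definition cnt D c f := #|[set e in D | (f e < c)%N]|.

Let Nr0 : N%:R != 0 :> R. Proof. by rewrite pnatr_eq0 -lt0n. Qed.
Let pr0 (A : pred Om) : 0 <= Pr A. Proof. exact: Pr_ge0. Qed.
Let prF : Pr (fun=> false) = 0. Proof. exact: Pr_false. Qed.

(** The generating function of a binomial variable. It is used at [z = 0] in [Pr_all_ge], for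
    [z >= 1] in [cnt_tail] and for [z <= 1] in [closure_tail]. *)
Lemma Ex_pow_cnt D c (z : R) : (c <= N)%N ->
  Ex (fun f => z ^+ cnt D c f) = (1 - c%:R / N%:R * (1 - z)) ^+ #|D|.
Proof.
move=> cN; pose G (e : {set V}) (v : 'I_N) : R := if (v < c)%N then z else 1.
have -> : Ex (fun f => z ^+ cnt D c f) = Ex (fun f => \prod_(e in D) G e (f e)).
  apply: eq_Ex => f; rewrite /G -big_mkcondr /= /cnt -prodr_const.
  by apply: eq_bigl => e; rewrite inE.
rewrite (Ex_prod N0) /G /= prodr_const; congr (_ ^+ _).
rewrite (bigID (fun v : 'I_N => (v < c)%N)) /=.
rewrite (eq_bigr (fun=> z)) => [|v ->//].
rewrite [X in _ + X](eq_bigr (fun=> 1)) => [|v /negbTE->//].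
rewrite !sumr_const (eq_card (B := [pred v : 'I_N | (v < c)%N])) // card_ord_lt //.
rewrite (eq_card (A := fun v : 'I_N => ~~ (v < c)%N) (B := [pred v : 'I_N | (c <= v)%N])); last first.
  by move=> v; rewrite !unfold_in /= -leqNgt.
rewrite card_ord_ge // natrB // -[z *+ c]mulr_natr; field.
exact: Nr0.
Qed.

Lemma Pr_all_ge D c : (c <= N)%N ->
  Pr (fun f => [forall e in D, (c <= f e)%N]) = (1 - c%:R / N%:R) ^+ #|D|.
Proof.
move=> cN; rewrite -[c%:R / _]mulr1 -[X in _ * X]subr0 -Ex_pow_cnt //.
apply: eq_Ex => f; case: (boolP [forall e in D, _]) => [/forall_inP h|/forall_inPn[e eD]].
  rewrite /cnt (_ : [set e in D | _] = set0) ?cards0 //.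
  by apply/setP=> e; rewrite !inE; apply/andP=> -[/h]; rewrite leqNgt => /negbTE->.
rewrite -ltnNge => lt; rewrite expr0n /cnt.
by rewrite (_ : _ == _ = false) //; apply/negbTE; rewrite -lt0n; apply/card_gt0P; exists e; rewrite inE eD.
Qed.

Lemma cnt_tail D c t (z : R) : (c <= N)%N -> 1 <= z ->
  Pr (fun f => (t <= cnt D c f)%N) <= (1 + c%:R / N%:R * (z - 1)) ^+ #|D| / z ^+ t.
Proof.
move=> cN z1; have z0 : 0 < z by exact: lt_le_trans z1.
have -> : 1 + c%:R / N%:R * (z - 1) = 1 - c%:R / N%:R * (1 - z) by ring.
rewrite -Ex_pow_cnt //; apply: le_trans (Markov N0 (exprn_gt0 t z0) _).
  by apply: Pr_le => // f h; rewrite ler_weXn2l.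
by move=> f; rewrite exprn_ge0 // ltW.
Qed.

Definition EK U : {set {set V}} := [set e in cgraph V | e \subset U].
Definition cutset b U : {set {set V}} := [set [set p.1; p.2] | p in setX b U].

Lemma in_cut b U x y : x \in b -> y \in U -> [set x; y] \in cutset b U.
Proof. by move=> xb yU; apply/imsetP; exists (x, y); rewrite ?inE ?xb. Qed.

Lemma cutsetP b U e : e \in cutset b U -> exists x y, [/\ x \in b, y \in U & e = [set x; y]].
Proof. by move=> /imsetP[[x y]]; rewrite inE => /andP[xb yU] ->; exists x, y. Qed.

Lemma set2_inj_disj b U x y x' y' : [disjoint b & U] -> x \in b -> y \in U -> x' \in b -> y' \in U ->
  [set x; y] = [set x'; y'] -> x = x' /\ y = y'.
Proof.
move=> dis xb yU xb' yU' E.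
have : x \in [set x'; y'] by rewrite -E !inE eqxx.
have : y \in [set x'; y'] by rewrite -E !inE eqxx orbT.
rewrite !inE => /orP[/eqP E1|/eqP->]; first by rewrite -E1 (disjointFl dis) in xb'.
by move=> /orP[/eqP->//|/eqP E1]; rewrite -E1 (disjointFr dis) in yU'.
Qed.

Lemma card_cut b U : [disjoint b & U] -> #|cutset b U| = (#|b| * #|U|)%N.
Proof.
move=> dis; rewrite card_in_imset ?cardsX // => -[x y] [x' y'].
rewrite !inE /= => /andP[xb yU] /andP[xb' yU'] E.
by have [-> ->] := set2_inj_disj dis xb yU xb' yU' E.
Qed.

Lemma cut_EK_disj b U : [disjoint b & U] -> [disjoint cutset b U & EK b :|: EK U].
Proof.
move=> dis; apply/pred0P=> e /=; apply/negbTE/negP=> /andP[/cutsetP[x [y [xb yU ->]]]].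
rewrite !inE !sub2 (disjointFr dis xb) (disjointFl dis yU) /= andbF.
by rewrite !andbF.
Qed.

Lemma EK_disj b U : [disjoint b & U] -> [disjoint EK b & EK U].
Proof.
move=> dis; apply/pred0P=> e /=; apply/negbTE/negP=> /andP[].
move=> /setIdP[/edgeP[x [y [_ ->]]]]; rewrite sub2 => /andP[xb _] /setIdP[_].
by rewrite sub2 (disjointFr dis xb).
Qed.

Lemma cutset_sub b U U' : U \subset U' -> cutset b U \subset cutset b U'.
Proof.
move=> s; apply/subsetP=> e /cutsetP[x [y [xb yU ->]]]; apply: in_cut => //; exact: (subsetP s).
Qed.

Definition lo f c S := below (wt f) (fun t => (t < c)%N) S.

Lemma lo_dep (Z : Type) (F : {set {set V}} -> Z) c S :
  dep (EK S) (fun f => F (lo f c S)).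
Proof.
move=> f g h; congr F; apply/setP=> e; rewrite !inE; apply: andb_id2l => ec.
by apply: andb_id2l => eS; rewrite /wt h // !inE ec.
Qed.

Definition cl f c S J := [set x in S | [exists r in J, conn (lo f c S) r x]].

Lemma cl_self f c S J : J \subset S -> J \subset cl f c S J.
Proof.
move=> s; apply/subsetP=> r rJ; rewrite inE (subsetP s) //=.
by apply/exists_inP; exists r => //; exact: conn0.
Qed.

Lemma cl_dep c S J : dep (EK S) (fun f => cl f c S J).
Proof. exact: (lo_dep (fun G => [set x in S | [exists r in J, conn G r x]])). Qed.

Definition nbr f c r S := [set y in S | (f [set r; y] < c)%N].

Lemma cl_step f c S J r : r \in J -> J \subset S ->
  r |: cl f c (S :\ r) ((J :\ r) :|: nbr f c r (S :\ r)) \subset cl f c S J.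
Proof.
move=> rJ JS; have rS := subsetP JS _ rJ; apply/subsetP=> x.
rewrite in_setU1 => /orP[/eqP->|]; first exact: (subsetP (cl_self f c JS)).
rewrite !inE => /andP[/andP[xr xS] /exists_inP[y yJ cy]]; rewrite xS /=.
have cy' : conn (lo f c S) y x.
  by apply: conn_mono cy; apply: below_sub; exact: subsetDl.
move: yJ; rewrite in_setU => /orP[/setD1P[_ yJ]|]; first by apply/exists_inP; exists y.
rewrite inE => /andP[/setD1P[yr yS] lt]; apply/exists_inP; exists r => //.
apply: conn_trans cy'; apply: conn1.
by rewrite adj_below eq_sym yr rS yS /= /wt lt.
Qed.

(* The cluster of [J] is explored one vertex of [J] at a time; [z] dominates the
   probability that the revealed neighbourhood does not compensate for the vertex used. *)
Lemma closure_tail c (z : R) (n0 : nat) T S J : (c <= N)%N -> 0 <= z <= 1 ->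
  (1 - c%:R / N%:R * (1 - z)) ^+ n0 <= z -> (T + n0 <= #|S|)%N -> J \subset S ->
  Pr (fun f => (#|cl f c S J| <= T)%N) <= z ^+ #|J|.
Proof.
move=> cN /andP[z0 z1] hz.
set q := 1 - _ in hz.
have p01 : 0 <= c%:R / N%:R :> R by rewrite divr_ge0.
have p1 : c%:R / N%:R <= 1 :> R by rewrite ler_pdivrMr ?ltr0n // mul1r ler_nat.
have q01 : 0 <= q <= 1.
  by rewrite /q; apply/andP; split; nra.
have big T' S' J' : J' \subset S' -> (T' < #|J'|)%N ->
    Pr (fun f => (#|cl f c S' J'| <= T')%N) <= z ^+ #|J'|.
  move=> JS lt; rewrite (@eq_Pr _ _ _ _ (fun=> false)) ?prF ?exprn_ge0 // => f.
  apply/negbTE; rewrite -ltnNge; apply: (leq_trans lt); apply: subset_leq_card; exact: cl_self.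
elim: T S J => [|T IH] S J hS JS.
  case: (posnP #|J|) => [->|J0]; first by rewrite expr0 Pr_le1.
  exact: big.
case: (posnP #|J|) => [->|/card_gt0P[r rJ]]; first by rewrite expr0 Pr_le1.
case: (ltnP T.+1 #|J|) => [|hJ]; first exact: big.
have rS := subsetP JS _ rJ.
set S1 := S :\ r.
have cS1 : #|S| = #|S1|.+1 by rewrite (cardsD1 r) rS.
have le1 : Pr (fun f => (#|cl f c S J| <= T.+1)%N) <=
   Pr (fun f => (#|cl f c S1 ((J :\ r) :|: nbr f c r S1)| <= T)%N).
  apply: Pr_le => // f h; rewrite -ltnS; apply: leq_trans h.
  have := subset_leq_card (cl_step f c rJ JS); rewrite cardsU1.
  have -> // : r \notin cl f c (S :\ r) (J :\ r :|: nbr f c r (S :\ r)).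
  by rewrite !inE eqxx.
apply: (le_trans le1); rewrite (Pr_partition _ (fun f => nbr f c r S1)).
have nbr_sub f : nbr f c r S1 \subset S1 by apply/subsetP=> y; rewrite inE => /andP[].
have nbr_dep : dep (cutset [set r] S1) (fun f => nbr f c r S1).
  move=> f g h; rewrite /nbr; apply/eq_finset => y; apply: andb_id2l => yS.
  by rewrite h // in_cut // set11.
have dis : [disjoint [set r] & S1] by rewrite disjoints1 !inE eqxx.
apply: (@le_trans _ _ (\sum_B z ^+ #|(J :\ r) :|: B| * Pr (fun f => nbr f c r S1 == B))).
  apply: ler_sum => B _; case: (boolP (B \subset S1)) => BS; last first.
    rewrite (@eq_Pr _ _ _ _ (fun=> false)) ?prF.
      by apply: mulr_ge0; rewrite ?exprn_ge0 ?pr0.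
    by move=> f; apply/negbTE; apply: contra BS => /andP[_ /eqP <-].
  have -> : Pr (fun f => (#|cl f c S1 (J :\ r :|: nbr f c r S1)| <= T)%N && (nbr f c r S1 == B)) =
     Pr (fun f => (#|cl f c S1 (J :\ r :|: B)| <= T)%N && (nbr f c r S1 == B)).
    by apply: eq_Pr => f; case: eqP => [->|]; rewrite ?andbF.
  rewrite (@Pr_indep _ _ _ N0 (EK S1) (cutset [set r] S1)).
  - apply: ler_wpM2r; first exact: pr0.
    apply: IH; first by rewrite -ltnS -cS1.
    by rewrite subUset BS andbT setSD.
  - rewrite disjoint_sym; apply: disjointWr (cut_EK_disj dis); exact: subsetUr.
  - by move=> f g /cl_dep h; rewrite h.
  - by move=> f g /nbr_dep h; rewrite h.
have -> : \sum_B z ^+ #|(J :\ r) :|: B| * Pr (fun f => nbr f c r S1 == B) =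
   Ex (fun f => z ^+ #|(J :\ r) :|: nbr f c r S1|).
  rewrite (@eq_Ex _ _ _ _ (fun f => \sum_B z ^+ #|(J :\ r) :|: B| * (nbr f c r S1 == B)%:R)).
    by rewrite Ex_sum; apply: eq_bigr => B _; rewrite Ex_scale.
  move=> f; rewrite (bigD1 (nbr f c r S1)) //= eqxx mulr1 big1 ?addr0 // => B.
  by rewrite eq_sym => /negbTE->; rewrite mulr0.
rewrite (@eq_Ex _ _ _ _ (fun f => z ^+ #|J :\ r| * z ^+ cnt (cutset [set r] (S :\: J)) c f)); last first.
  move=> f; rewrite -exprD; congr (_ ^+ _); rewrite /cnt.
  have -> : [set e in cutset [set r] (S :\: J) | (f e < c)%N] =
     [set [set r; y] | y in nbr f c r (S :\: J)].
    apply/setP=> e; apply/idP/imsetP => [|[y]].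
      move=> /setIdP[/cutsetP[x [y [/set1P-> yS ->]]] lt]; exists y => //.
      by apply/setIdP.
    move=> /setIdP[yS lt] ->; apply/setIdP; split=> //; apply: in_cut => //; exact: set11.
  rewrite card_in_imset; last first.
    move=> y y' /setIdP[/setDP[_ yJ] _] _ E.
    have : y \in [set r; y'] by rewrite -E !inE eqxx orbT.
    by rewrite !inE => /orP[/eqP yr|/eqP//]; rewrite yr rJ in yJ.
  rewrite -cardsUI; have -> : (J :\ r) :&: nbr f c r (S :\: J) = set0.
    apply/setP=> y; rewrite in_setI in_setD1 in_set0; apply/negbTE/negP.
    by move=> /andP[/andP[_ yJ] /setIdP[/setDP[_ /negP]]].
  rewrite cards0 addn0; apply: eq_card => y; rewrite !in_setU !in_setD1 /nbr !inE.
  by case: (eqVneq y r) => [->|]; rewrite ?rJ //=; case: (y \in J); case: (y \in S).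
(* There remains the generating function of the number of new vertices found from [r]. By [hz] its
   value at [z] is at most [z], as for the extinction probability of a branching process. At least
   [n0] candidates are left since [J] has at most [T.+1] elements. *)
rewrite Ex_scale Ex_pow_cnt // -/q.
have disJ : [disjoint [set r] & S :\: J] by rewrite disjoints1 !inE rJ.
rewrite card_cut // cards1 mul1n (cardsD1 r J) rJ exprS mulrC.
apply: ler_wpM2r; first exact: exprn_ge0.
apply: le_trans hz; case/andP: q01 => q0 q1; apply: ler_wiXn2l => //.
by rewrite cardsD (setIidPr JS) leq_subRL ?(subset_leq_card JS) // (leq_trans _ hS) // leq_add2r.
Qed.

(** [A], [Z] and the set visited inside [U] are independent of the edges between [b] and [U]. Each
    of the [I.+1] times [#|b|] edges from the visited set to [b] costs a factor at most [rho], even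
    if it lies in [Ec] and is thus already known to have level at least [c0]. *)
Lemma hub_bound b U (Ec : {set {set V}}) c0 q (rho : R) (A Z : pred Om) x I :
  [disjoint b & U] -> Ec \subset cutset b U -> (c0 <= q)%N -> (q <= N)%N -> 0 <= rho ->
  (1 - q%:R / N%:R) <= rho * (1 - c0%:R / N%:R) ->
  dep (EK b) A -> dep (EK U) Z -> x \in U -> (I < #|U|)%N ->
  Pr (fun f => [&& A f, Z f, [forall e in Ec, (c0 <= f e)%N] &
     [forall a in prim (wt f) U x I, forall y in b, (q <= f [set a; y])%N]])
  <= Pr A * Pr Z * Pr (fun f => [forall e in Ec, (c0 <= f e)%N]) * rho ^+ (I.+1 * #|b|).
Proof.
move=> dis EcU c0q qN r0 hr dA dZ xU IU.
have c0N := leq_trans c0q qN.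
set X := Pr (fun f => [forall e in Ec, _]).
have X0 : 0 <= X by exact: pr0.
set u := 1 - c0%:R / N%:R in hr *; set v := 1 - q%:R / N%:R in hr *.
have u01 : 0 <= u <= 1.
  by rewrite /u subr_ge0 ler_pdivrMr ?ltr0n // mul1r ler_nat c0N lerBlDr lerDl divr_ge0.
have v0 : 0 <= v by rewrite /v subr_ge0 ler_pdivrMr ?ltr0n // mul1r ler_nat.
case/andP: u01 => u0 u1.
have cutE a : a \subset U -> #|a| = I.+1 ->
   Pr (fun f => [forall e in Ec, (c0 <= f e)%N] && [forall e in cutset b a, (q <= f e)%N]) <=
   X * rho ^+ (I.+1 * #|b|).
  move=> aU ca; set C := cutset b a.
  have cC : #|C| = (I.+1 * #|b|)%N.
    by rewrite card_cut ?ca 1?mulnC //; apply: disjointWr dis.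
  pose thr e := if e \in C then q else c0.
  apply: (@le_trans _ _ (Pr (fun f => [forall e in Ec :\: C, (c0 <= f e)%N] && [forall e in C, (q <= f e)%N]))).
    apply: Pr_le => // f /andP[/forall_inP h1 ->]; rewrite andbT.
    by apply/forall_inP=> e /setDP[eE _]; exact: h1.
  rewrite (@Pr_indep _ _ _ N0 (Ec :\: C) C).
  - rewrite /X !Pr_all_ge // -/u -/v cC.
    have -> : #|Ec| = (#|Ec :\: C| + #|Ec :&: C|)%N by rewrite addnC cardsID.
    rewrite exprD -mulrA; apply: ler_wpM2l; first exact: exprn_ge0.
    apply: (@le_trans _ _ ((rho * u) ^+ (I.+1 * #|b|))).
      by apply: lerXn2r; rewrite ?nnegrE // mulr_ge0.
    rewrite exprMn mulrC; apply: ler_wpM2r; first exact: exprn_ge0.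
    by apply: ler_wiXn2l => //; rewrite -cC; apply: subset_leq_card; exact: subsetIr.
  - by rewrite disjoint_sym disjoints_subset; apply/subsetP=> e; rewrite !inE => ->.
  - by move=> f g h; apply: eq_forallb_in => e eE; rewrite h.
  - by move=> f g h; apply: eq_forallb_in => e eE; rewrite h.
pose P a f := Z f && (prim (wt f) U x I == a).
apply: (@le_trans _ _ (\sum_a Pr A * Pr (P a) * (X * rho ^+ (I.+1 * #|b|)))); last first.
  by rewrite -mulr_suml -mulr_sumr -Pr_partition mulrA.
rewrite (Pr_partition _ (fun f => prim (wt f) U x I)); apply: ler_sum => a _.
case: (boolP ((a \subset U) && (#|a| == I.+1))) => [/andP[aU /eqP ca]|na]; last first.
  rewrite (@eq_Pr _ _ _ _ (fun=> false)) ?prF; last first.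
    move=> f; apply/negbTE; apply: contra na => /andP[_ /eqP <-].
    by rewrite prim_sub // card_prim //= eqxx.
  by apply: mulr_ge0; apply: mulr_ge0; rewrite ?pr0 ?exprn_ge0.
apply: (@le_trans _ _ (Pr (fun f => (A f && P a f) &&
    ([forall e in Ec, (c0 <= f e)%N] && [forall e in cutset b a, (q <= f e)%N])))).
  apply: Pr_le => // f /andP[/and4P[hA hZ hE /forall_inP h] /eqP pa].
  rewrite /P hA hZ hE pa eqxx /=; apply/forall_inP=> e /cutsetP[y [z [yb za ->]]].
  by rewrite setUC; have := h z; rewrite pa => /(_ za)/forall_inP; apply.
rewrite (@Pr_indep _ _ _ N0 (EK b :|: EK U) (cutset b U)).
- rewrite (@Pr_indep _ _ _ N0 (EK b) (EK U)) //; first 1 last.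
  + exact: EK_disj.
  + move=> f g h; rewrite /P (dZ f g h); congr (_ && (_ == _)); apply: eq_prim => e ec eU.
    by rewrite /wt h // inE ec.
  by apply: ler_wpM2l; [rewrite mulr_ge0 // pr0|exact: cutE].
- by rewrite disjoint_sym; exact: cut_EK_disj.
- move=> f g h; congr (_ && _); first by apply: dA => e eb; rewrite h // inE eb.
  have hU : forall e, e \in EK U -> f e = g e by move=> e eU; rewrite h // inE eU orbT.
  rewrite /P (dZ f g hU); congr (_ && (_ == _)); apply: eq_prim => e ec eU.
  by rewrite /wt hU // inE ec.
- move=> f g h; congr (_ && _); apply: eq_forallb_in => e eE.
    by rewrite h // (subsetP EcU).
  by rewrite h // (subsetP (cutset_sub b aU)).
Qed.

End GraphProb.

(** * The probability that a stage fails *)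

Section Stage.
Import mathcomp.boot.fintype mathcomp.boot.finset Pilot.Defs.
Local Open Scope set_scope.
Variables (V : finType) (N : nat) (f : {ffun {set V} -> 'I_N}).
Implicit Types (x y z a b v : V) (S B U : {set V}) (e : {set V}) (J F D : {set {set V}}).
Hypothesis inj : {in cgraph V &, injective (wt f)}.
Local Notation w := (wt f).

(** An upper bound for [N] times the weight of [J], when the levels are the weights rounded down to
    multiples of [1/N]. *)
Definition height J := (\sum_(e in J) (f e).+1)%N.

(** The hypotheses of [growth] in terms of levels, with [c1 = 1] and [q = c3 = 1/Q]. *)
Definition stage_ok Q S v :=
  [/\ forall x y, x \in S -> y \in S ->
        exists J, [/\ J \subset kr w S, conn J x y & (height J <= N)%N],
      forall e, e \in kr w S -> (Q * (f e).+1 <= N)%N &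
      forall z, z \in S -> exists y J, [/\ y \in S, (Q * (f [set v; y]).+1 <= N)%N,
        J \subset kr w S, conn J z y & (Q * height J <= N)%N] ].

Lemma heightU J1 J2 : (height (J1 :|: J2) <= height J1 + height J2)%N.
Proof.
rewrite /height (big_setID J1) /= setUK setDUl setDv set0U leq_add2l.
by rewrite [leqRHS](big_setID J1) /= leq_addl.
Qed.

Lemma height_le J c : (forall e, e \in J -> (f e < c)%N) -> (height J <= #|J| * c)%N.
Proof.
move=> h; rewrite -sum_nat_const; exact: leq_sum.
Qed.

Lemma in_lo c S e : (e \in lo f c S) = [&& e \in cgraph V, e \subset S & (f e < c)%N].
Proof. by rewrite inE. Qed.

Section Hub.
Variables (S B : {set V}) (F : {set {set V}}) (I t l c1 cm cG Q : nat).
Hypothesis BS : B \subset S.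
Hypothesis B0 : B != set0.
Hypothesis c1m : (c1 <= cm)%N.
Hypothesis hB : forall a b, a \in B -> b \in B -> conn (lo f c1 S) a b.
Hypothesis h1 : forall x, x \in S :\: B -> exists2 b, b \in B & (f [set x; b] < cm)%N.
Hypothesis h2 : forall x, x \in S :\: B -> (I < #|S :\: B|)%N ->
  exists a b, [/\ a \in prim w (S :\: B) x I, b \in B & (f [set a; b] < c1)%N].
Hypothesis hF : forall e, e \in F -> (f e < cG)%N.
Hypothesis cF : (#|F| <= l)%N.
Hypothesis hcnt : (cnt (EK S :\: F) c1 f <= t)%N.
Hypothesis hN : (2 * I * cm + l * cG + t * c1 <= N)%N.
Hypothesis hQ : (Q * cm <= N)%N.

Lemma hub_D2 e : e \in kr w S -> (f e < cm)%N.
Proof. exact: (hub_bottleneck (w := w) (c := c1) (m := cm) BS B0 c1m hB h1). Qed.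

(** The subtree consists of at most [I] tree edges for each of [x] and [y] and of all tree edges
    below [c1], which connect the hub. The latter are counted crudely among all edges of [S] below
    [c1]; those of [F] are bounded apart, because their levels will be conditioned on. *)
Lemma hub_D1 x y : x \in S -> y \in S ->
  exists J, [/\ J \subset kr w S, conn J x y & (height J <= N)%N].
Proof.
move=> xS yS.
have to u : u \in S -> exists J b, [/\ J \subset kr w S, (#|J| <= I)%N, b \in B &
     conn (J :|: (kr w S :&: lo f c1 S)) u b].
  by move=> uS; apply: (hub_conn (w := w) (c := c1) inj BS B0 uS) => uU; exact: h2.
have [Jx [bx [Jxs cJx bxB cx]]] := to x xS.
have [Jy [by_ [Jys cJy byB cy]]] := to y yS.
set L := kr w S :&: lo f c1 S in cx cy.
exists (Jx :|: Jy :|: L); split.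
- by rewrite !subUset Jxs Jys subsetIl.
- apply: (@conn_trans _ _ bx); first by apply: conn_mono cx; apply: setSU; exact: subsetUl.
  apply: (@conn_trans _ _ by_).
    apply: (@conn_mono _ L); first exact: subsetUr.
    have dc : forall a b : nat, (a < b)%O -> (b < c1)%N -> (a < c1)%N by move=> a b; exact: ltn_trans.
    exact: (kr_minimax (w := w) dc (hB bxB byB)).
  by rewrite connC; apply: conn_mono cy; apply: setSU; exact: subsetUr.
- have hJ J : J \subset kr w S -> (#|J| <= I)%N -> (height J <= I * cm)%N.
    move=> s c; apply: leq_trans (height_le (c := cm) _) _; last by rewrite leq_mul2r c orbT.
    by move=> e /(subsetP s); exact: hub_D2.
  have hL : (height L <= l * cG + t * c1)%N.
    have -> : L = (L :&: F) :|: (L :\: F) by rewrite setID.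
    apply: leq_trans (heightU _ _) _; apply: leq_add.
      apply: leq_trans (height_le (c := cG) _) _; first by move=> e /setIP[_ /hF].
      by rewrite leq_mul2r (leq_trans _ cF) ?orbT // subset_leq_card ?subsetIr.
    apply: leq_trans (height_le (c := c1) _) _.
      by move=> e /setDP[/setIP[_]]; rewrite in_lo => /and3P[].
    rewrite leq_mul2r (leq_trans _ hcnt) ?orbT // subset_leq_card //; apply/subsetP=> e.
    move=> /setDP[/setIP[_]]; rewrite in_lo => /and3P[ec eS lt] eF.
    by rewrite inE in_setD eF inE ec eS lt.
  apply: leq_trans hN; apply: leq_trans (heightU _ _) _; rewrite -addnA; apply: leq_add => //.
  apply: leq_trans (heightU _ _) _; rewrite -mulnA mul2n -addnn; apply: leq_add; exact: hJ.
Qed.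

Lemma hub_stage v r cq : (forall z, z \in S -> exists2 a, a \in prim w S z r & (f [set v; a] < cq)%N) ->
  (Q * (r * cm) <= N)%N -> (Q * cq <= N)%N -> stage_ok Q S v.
Proof.
move=> h3 hr hq; split.
- exact: hub_D1.
- by move=> e eM; apply: leq_trans hQ; rewrite leq_mul2l hub_D2 ?orbT.
- move=> z zS; have [a aP lt] := h3 z zS.
  have [J [JM cJ cn]] := prim_conn r inj zS.
  exists a, J; split=> //.
  + exact: (subsetP (prim_sub w r zS)).
  + by apply: leq_trans hq; rewrite leq_mul2l lt orbT.
  + exact: cn.
  apply: leq_trans hr; rewrite leq_mul2l; apply/orP; right.
  apply: leq_trans (height_le (c := cm) _) _; last by rewrite leq_mul2r cJ orbT.
  by move=> e /(subsetP JM); exact: hub_D2.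
Qed.

End Hub.

(** All tree edges are below [cG], and there are at most [#|S| ^ 2] of them; this crude bound covers
    every requirement. *)
Lemma light_stage S v F cG Q : (0 < Q)%N -> S != set0 ->
  (forall x y, x \in S -> y \in S -> conn (F :&: EK S) x y) ->
  (exists2 y, y \in S & [set v; y] \in F) ->
  (forall e, e \in F -> (f e < cG)%N) ->
  (Q * (#|S| ^ 2 * cG) <= N)%N -> stage_ok Q S v.
Proof.
move=> Q0 S0 cS [y0 y0S vy] hF hN.
have k0 : (0 < #|S|)%N by rewrite card_gt0.
have hG : (Q * cG <= N)%N.
  by apply: leq_trans hN; rewrite leq_mul2l leq_pmull ?orbT // expn_gt0 k0.
have dc : forall a b : nat, (a < b)%O -> (b < cG)%N -> (a < cG)%N by move=> a b; exact: ltn_trans.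
have cl x y : x \in S -> y \in S -> conn (lo f cG S) x y.
  move=> xS yS; apply: conn_mono (cS x y xS yS); apply/subsetP=> e /setIP[eF].
  by rewrite inE in_lo => /andP[-> ->]; rewrite hF.
pose J := kr w S :&: lo f cG S.
have cJ x y : x \in S -> y \in S -> conn J x y.
  by move=> xS yS; apply: (kr_minimax (w := w) dc); exact: cl.
have lt e : e \in kr w S -> (f e < cG)%N.
  by apply: (kr_bottleneck (w := w) (P := fun t => (t < cG)%N)).
have hJ : (Q * height J <= N)%N.
  apply: leq_trans hN; rewrite leq_mul2l; apply/orP; right.
  apply: leq_trans (height_le (c := cG) _) _; first by move=> e /setIP[/lt].
  rewrite leq_mul2r; apply/orP; right; apply: (leq_trans (n := #|cutset S S|)).
    apply: subset_leq_card; apply/subsetP=> e /setIP[eK _].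
    have /edgeP[x [y [nxy E]]] := subsetP (kr_cgraph _ _) _ eK.
    have := kr_in eK; rewrite E sub2 => /andP[xS yS]; exact: in_cut.
  by apply: leq_trans (leq_imset_card _ _) _; rewrite cardsX mulnn.
split.
- move=> x y xS yS; exists J; split=> //; first exact: subsetIl.
    exact: cJ.
  by apply: leq_trans hJ; rewrite leq_pmull.
- by move=> e /lt h; apply: leq_trans hG; rewrite leq_mul2l h orbT.
- move=> z zS; exists y0, J; split=> //; [|exact: subsetIl|exact: cJ].
  by apply: leq_trans hG; rewrite leq_mul2l hF ?orbT.
Qed.

End Stage.

(** * Failure probabilities relative to a light starting group *)

Section StageProb.
Import mathcomp.boot.fintype mathcomp.boot.finset Pilot.Defs.
Local Open Scope set_scope.
Local Open Scope ring_scope.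
Variables (R : realType) (V : finType) (N : nat).
Hypothesis N0 : (0 < N)%N.
Local Notation Om := {ffun {set V} -> 'I_N}.
Local Notation Pr := (@Pr R {set V} N).
Local Notation Ex := (@Ex R {set V} N).
Implicit Types (f : Om) (x y z r a : V) (B b J U : {set V}) (e : {set V}).
Variables (S S0 : {set V}) (F : {set {set V}}) (v : V).
Hypothesis S0S : S0 \subset S.
Hypothesis FS0 : F \subset EK S0.
Hypothesis vS : v \notin S.
Variables (I c0 c1 cm cq cG : nat).
Local Notation p c := (c%:R / N%:R : R).

Let pr0 (A : pred Om) : 0 <= Pr A. Proof. exact: Pr_ge0. Qed.

Lemma EK_mono U1 U2 : U1 \subset U2 -> EK U1 \subset EK U2.
Proof.
by move=> s; apply/subsetP=> e /setIdP[ec eU]; apply/setIdP; split=> //; exact: subset_trans s.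
Qed.

Lemma dep_mono (Z : Type) (D1 D2 : {set {set V}}) (X : Om -> Z) :
  D1 \subset D2 -> dep D1 X -> dep D2 X.
Proof. by move=> s d f g h; apply: d => e /(subsetP s); exact: h. Qed.

Definition light f := [forall e in F, (f e < cG)%N].

Lemma light_dep : dep F light.
Proof. by move=> f g h; apply: eq_forallb_in => e eF; rewrite h. Qed.

(** The two ways in which the hypotheses [h1] and [h2] on a hub can fail. No edge to the hub is
    asked for when the exploration could exhaust [S :\: B]. *)
Definition badhub f B :=
  [exists x in S :\: B, [forall y in B, (cm <= f [set x; y])%N]] ||
  (I < #|S :\: B|)%N && [exists x in S :\: B,
     [forall a in prim (wt f) (S :\: B) x I, forall y in B, (c1 <= f [set a; y])%N]].

(** Union bound over the starting vertex. Zero steps of Prim's algorithm visit this vertex alone, so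
    both kinds of failure are instances of [hub_bound]. *)
Lemma hub_fail b (Ec : {set {set V}}) d0 (A Z : pred Om) (rm r1 : R) h : b \subset S ->
  Ec \subset cutset b (S :\: b) -> (d0 <= cm)%N -> (d0 <= c1)%N -> (cm <= N)%N -> (c1 <= N)%N ->
  0 <= rm <= 1 -> 0 <= r1 <= 1 -> 1 - p cm <= rm * (1 - p d0) -> 1 - p c1 <= r1 * (1 - p d0) ->
  dep (EK b) A -> dep (EK (S :\: b)) Z -> (h <= #|b|)%N ->
  Pr (fun f => [&& A f, Z f, [forall e in Ec, (d0 <= f e)%N] & badhub f b])
  <= Pr A * Pr Z * Pr (fun f => [forall e in Ec, (d0 <= f e)%N]) *
     (#|S|%:R * (rm ^+ h + r1 ^+ (I.+1 * h))).
Proof.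
move=> bS EcU d0m d01 cmN c1N /andP[rm0 rm1] /andP[r10 r11] hm h1 dA dZ hb.
have dis : [disjoint b & S :\: b].
  by rewrite disjoint_sym disjoints_subset; apply/subsetP=> x; rewrite !inE => /andP[].
set X := Pr A * Pr Z * _.
have X0 : 0 <= X by rewrite /X !mulr_ge0 ?pr0.
have U_le : #|S :\: b|%:R <= #|S|%:R :> R by rewrite ler_nat subset_leq_card // subsetDl.
pose E1 x f := [&& A f, Z f, [forall e in Ec, (d0 <= f e)%N] &
   [forall a in prim (wt f) (S :\: b) x 0, forall y in b, (cm <= f [set a; y])%N]].
pose E2 x f := [&& A f, Z f, [forall e in Ec, (d0 <= f e)%N] &
   (I < #|S :\: b|)%N && [forall a in prim (wt f) (S :\: b) x I, forall y in b, (c1 <= f [set a; y])%N]].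
have PE1 x : x \in S :\: b -> Pr (E1 x) <= X * rm ^+ h.
  move=> xU; have U0 : (0 < #|S :\: b|)%N by apply/card_gt0P; exists x.
  apply: le_trans (hub_bound N0 dis EcU d0m cmN rm0 hm dA dZ xU U0) _.
  by rewrite mul1n; apply: ler_wpM2l => //; apply: ler_wiXn2l.
have PE2 x : x \in S :\: b -> Pr (E2 x) <= X * r1 ^+ (I.+1 * h).
  move=> xU; case: (ltnP I #|S :\: b|) => IU; last first.
    rewrite (@eq_Pr _ _ _ _ (fun=> false)) ?Pr_false ?mulr_ge0 ?exprn_ge0 // => f.
    by rewrite /E2 ltnNge IU !andbF.
  apply: (@le_trans _ _ (X * r1 ^+ (I.+1 * #|b|))); last first.
    by apply: ler_wpM2l => //; apply: ler_wiXn2l => //; rewrite leq_mul2l hb orbT.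
  apply: (le_trans _ (hub_bound N0 dis EcU d01 c1N r10 h1 dA dZ xU IU)).
  by apply: Pr_le => // f; rewrite /E2 IU.
apply: (@le_trans _ _ (\sum_(x in S :\: b) (Pr (E1 x) + Pr (E2 x)))).
  have -> : \sum_(x in S :\: b) (Pr (E1 x) + Pr (E2 x)) =
     \sum_(x in S :\: b) Pr (E1 x) + \sum_(x in S :\: b) Pr (E2 x) by rewrite big_split.
  pose EE1 f := [exists x in S :\: b, E1 x f]; pose EE2 f := [exists x in S :\: b, E2 x f].
  apply: (@le_trans _ _ (Pr (fun f => EE1 f || EE2 f))).
    apply: Pr_le => // f /and4P[hA hZ hE /orP[/exists_inP[x xU h']|/andP[IU /exists_inP[x xU h']]]].
      apply/orP; left; apply/exists_inP; exists x => //; rewrite /E1 hA hZ hE /=.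
      by apply/forall_inP=> a; rewrite inE => /eqP->.
    apply/orP; right; apply/exists_inP; exists x => //; rewrite /E2 hA hZ hE IU /=; exact: h'.
  apply: (le_trans (Pr_or R N0 EE1 EE2)); apply: lerD.
    by apply: Pr_union => // f /exists_inP[x xU hx]; exists x.
  by apply: Pr_union => // f /exists_inP[x xU hx]; exists x.
apply: (@le_trans _ _ (\sum_(x in S :\: b) (X * (rm ^+ h + r1 ^+ (I.+1 * h))))).
  by apply: ler_sum => x xU; rewrite mulrDr; apply: lerD; [exact: PE1|exact: PE2].
rewrite sumr_const -[_ *+ _]mulr_natl mulrCA; apply: ler_wpM2l => //; apply: ler_wpM2r => //.
by rewrite addr_ge0 ?exprn_ge0.
Qed.

Section Bounds.
Variables (rm r1 : R) (h : nat).
Hypotheses (c01 : (c0 <= c1)%N) (c0m : (c0 <= cm)%N) (cmN : (cm <= N)%N) (c1N : (c1 <= N)%N).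
Hypotheses (rm01 : 0 <= rm <= 1) (r101 : 0 <= r1 <= 1).
Hypothesis hm : 1 - p cm <= rm * (1 - p c0).
Hypothesis h1 : 1 - p c1 <= r1 * (1 - p c0).
Local Notation eta := (#|S|%:R * (rm ^+ h + r1 ^+ (I.+1 * h))).

Lemma eta_ge0 : 0 <= eta.
Proof.
by case/andP: rm01 => ? _; case/andP: r101 => ? _; rewrite mulr_ge0 // addr_ge0 ?exprn_ge0.
Qed.

(** The starting group is itself the hub; nothing has been revealed about its boundary, whence
    [Ec = set0] and [d0 = 0]. *)
Lemma early_hub : (h <= #|S0|)%N -> Pr (fun f => light f && badhub f S0) <= Pr light * eta.
Proof.
move=> hS0.
have p0 : 0 <= p c0 by rewrite divr_ge0.
have hm0 : 1 - p cm <= rm * (1 - p 0%N).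
  apply: (le_trans hm); case/andP: rm01 => rm0 _; apply: ler_wpM2l => //.
  by rewrite mul0r subr0 lerBlDr lerDl.
have h10 : 1 - p c1 <= r1 * (1 - p 0%N).
  apply: (le_trans h1); case/andP: r101 => r10 _; apply: ler_wpM2l => //.
  by rewrite mul0r subr0 lerBlDr lerDl.
have dZ : dep (EK (S :\: S0)) (fun _ : Om => true) by [].
have := hub_fail (Ec := set0) (d0 := 0) S0S (sub0set _) (leq0n _) (leq0n _) cmN c1N rm01 r101
  hm0 h10 (dep_mono FS0 light_dep) dZ hS0.
have -> : Pr (fun _ : Om => true) = 1 by exact: Pr_all.
have -> : Pr (fun f : Om => [forall e in set0, (0 <= f e)%N]) = 1.
  by apply: Pr_all => // f; apply/forall_inP=> e; rewrite inE.
rewrite !mulr1 => le; apply: le_trans le; apply: Pr_le => // f /andP[-> ->] /=.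
by rewrite andbT; apply/forall_inP=> e; rewrite inE.
Qed.

Local Notation V' := (S :\: S0).
(** Clusters are taken outside [S0], to be independent of [light]. *)
Definition component f r := cl f c0 V' [set r].

(** That the cluster is [b] splits into a condition inside [b] and the absence of edges below [c0]
    on its boundary in [V']: these are the events [A] and [Ec] of [hub_fail]. *)
Lemma component_eq f r b : b \subset V' -> r \in b ->
  (component f r == b) = (cl f c0 b [set r] == b) && [forall e in cutset b (V' :\: b), (c0 <= f e)%N].
Proof.
move=> bV rb; have rV := subsetP bV _ rb; apply/eqP/andP => [E|[/eqP E /forall_inP hc]].
  split.
    rewrite eqEsubset; apply/andP; split; first by apply/subsetP=> x /setIdP[].
    apply/subsetP=> x xb; apply/setIdP; split=> //; apply/exists_inP; exists r; first exact: set11.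
    have : x \in component f r by rewrite E.
    move=> /setIdP[_ /exists_inP[r' /set1P->]]; move: x {xb}; apply: conn_ind => [|x y cx cx' a].
      exact: conn0.
    apply: conn_trans cx' _; apply: conn1.
    have inb u : u \in V' -> conn (lo f c0 V') r u -> u \in b.
      by move=> uV cu; rewrite -E; apply/setIdP; split=> //; apply/exists_inP; exists r; rewrite ?set11.
    move: (a); rewrite !adj_below => /and4P[-> xV yV ->]; rewrite andbT /=; apply/andP; split.
      exact: inb.
    by apply: inb => //; apply: conn_trans cx _; exact: conn1.
  apply/forall_inP=> e /cutsetP[x [y [xb /setDP[yV yb] ->]]].
  rewrite leqNgt; apply: contra (yb) => lt; rewrite -E; apply/setIdP; split=> //.
  apply/exists_inP; exists r; first exact: set11.
  have : x \in component f r by rewrite E.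
  move=> /setIdP[xV /exists_inP[r' /set1P->] cx]; apply: conn_trans cx _; apply: conn1.
  rewrite adj_below xV yV /wt lt !andbT; apply/eqP=> xy.
  by rewrite -xy xb in yb.
apply/eqP; rewrite eqEsubset; apply/andP; split; last first.
  apply/subsetP=> x; rewrite -{1}E => /setIdP[xb /exists_inP[r' /set1P-> cx]].
  apply/setIdP; split; first exact: (subsetP bV).
  apply/exists_inP; exists r; first exact: set11.
  by apply: conn_mono cx; exact: below_sub.
apply/subsetP=> x /setIdP[xV /exists_inP[r' /set1P-> cx]]; apply: contrapT => /negP xb.
have [u [w [ub wb]]] := cut_edge cx rb xb; rewrite adj_below => /and4P[_ uV wV lt].
have := hc [set u; w]; rewrite leqNgt; move: lt; rewrite /wt => -> /(_ _)/negP; apply => //.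
by apply: in_cut => //; rewrite inE wb.
Qed.

(** Sprinkling: given that the cluster is [b], its boundary edges in [V'] are only known to have
    level at least [c0], and the other edges leaving [b] are free. The sum over [b] costs nothing,
    the events [component f r == b] being disjoint. *)
Lemma late_hub J : J \subset V' ->
  Pr (fun f => light f && [exists r in J, (h <= #|component f r|)%N && badhub f (component f r)])
  <= Pr light * (#|J|%:R * eta).
Proof.
move=> JV; pose E r f := light f && ((h <= #|component f r|)%N && badhub f (component f r)).
apply: (@le_trans _ _ (\sum_(r in J) Pr (E r))).
  by apply: Pr_union => // f /andP[lf /exists_inP[r rJ hr]]; exists r => //; rewrite /E lf.
suff hE r : r \in J -> Pr (E r) <= Pr light * eta.
  apply: (@le_trans _ _ (\sum_(r in J) Pr light * eta)); first exact: ler_sum.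
  by rewrite sumr_const -[_ *+ _]mulr_natl mulrCA.
move=> rJ; have rV := subsetP JV _ rJ.
have X0 : 0 <= Pr light * eta by apply: mulr_ge0; [exact: pr0|exact: eta_ge0].
rewrite (Pr_partition _ (fun f => component f r)).
apply: (@le_trans _ _ (\sum_b Pr light * eta * Pr (fun f => true && (component f r == b)))); last first.
  rewrite -mulr_sumr -Pr_partition; apply: ler_piMr; last exact: Pr_le1.
  exact: X0.
apply: ler_sum => b _.
case: (boolP [&& b \subset V', r \in b & (h <= #|b|)%N]) => [/and3P[bV rb hb]|nb]; last first.
  rewrite (@eq_Pr _ _ _ _ (fun=> false)) ?Pr_false ?(mulr_ge0 X0 (pr0 _)) // => f.
  apply/negbTE; apply: contra nb => /andP[/andP[_ /andP[hc _]] /eqP E1].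
  rewrite -E1 hc andbT; apply/andP; split; first by apply/subsetP=> x /setIdP[].
  by apply: (subsetP (cl_self _ _ _)); rewrite ?sub1set // set11.
have bS : b \subset S := subset_trans bV (subsetDl _ _).
pose A f := cl f c0 b [set r] == b.
have dA : dep (EK b) A by move=> f g /cl_dep hfg; rewrite /A hfg.
have dL : dep (EK (S :\: b)) light.
  apply: dep_mono light_dep; apply: (subset_trans FS0); apply: EK_mono.
  apply/subsetP=> x xS0; rewrite inE (subsetP S0S) // andbT.
  by apply: contraL xS0 => /(subsetP bV); rewrite inE => /andP[].
set Ec := cutset b (V' :\: b).
have EcU : Ec \subset cutset b (S :\: b).
  by apply: cutset_sub; apply: setSD; exact: subsetDl.
have disb : [disjoint b & S :\: b].
  by rewrite disjoint_sym disjoints_subset; apply/subsetP=> x; rewrite !inE => /andP[].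
have -> : Pr (fun f => true && (component f r == b)) =
   Pr A * Pr (fun f => [forall e in Ec, (c0 <= f e)%N]).
  rewrite -(@Pr_indep _ _ _ N0 (EK b) (cutset b (S :\: b))) //.
  - by apply: eq_Pr => f; rewrite (component_eq f bV rb).
  - by rewrite disjoint_sym; apply: disjointWr (cut_EK_disj disb); exact: subsetUl.
  - by move=> f g hfg; apply: eq_forallb_in => e eE; rewrite hfg // (subsetP EcU).
have := hub_fail bS EcU c0m c01 cmN c1N rm01 r101 hm h1 dA dL hb.
set Y := Pr (fun f => [forall e in Ec, _]) => le.
have -> : Pr light * eta * (Pr A * Y) = Pr A * Pr light * Y * eta by ring.
apply: le_trans le; apply: Pr_le => // f /andP[/andP[lf /andP[_ bh]] cb].
move: (cb); rewrite /A (component_eq f bV rb) => /andP[-> ->]; rewrite lf /=.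
by rewrite -(eqP cb).
Qed.

(** If all clusters of elements of [J] were small, their union would have at most [T] vertices,
    which [closure_tail] makes unlikely. *)
Lemma late_exists J (z : R) n0 T : J \subset V' -> (#|J| * h <= T)%N -> (0 < #|J|)%N -> 0 <= z <= 1 ->
  (1 - p c0 * (1 - z)) ^+ n0 <= z -> (T + n0 <= #|V'|)%N ->
  Pr (fun f => light f && [forall r in J, (#|component f r| < h)%N]) <= Pr light * z ^+ #|J|.
Proof.
move=> JV JT J0 z01 hz hV.
have disS : [disjoint S0 & V'].
  by rewrite disjoint_sym disjoints_subset; apply/subsetP=> x; rewrite !inE => /andP[].
apply: (@le_trans _ _ (Pr (fun f => light f && (#|cl f c0 V' J| <= T)%N))).
  apply: Pr_le => // f /andP[-> /forall_inP hr] /=; apply: leq_trans JT.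
  have -> : cl f c0 V' J = \bigcup_(r in J) component f r.
    apply/setP=> x; apply/idP/bigcupP => [/setIdP[xV /exists_inP[r rJ cx]]|[r rJ /setIdP[xV /exists_inP[r' /set1P-> cx]]]].
      by exists r => //; apply/setIdP; split=> //; apply/exists_inP; exists r; rewrite ?set11.
    by apply/setIdP; split=> //; apply/exists_inP; exists r.
  apply: (@leq_trans (\sum_(r in J) #|component f r|)).
    elim/big_rec2: _ => [|r n X rJ IH]; first by rewrite cards0.
    by apply: leq_trans (leq_of_leqif (leq_card_setU _ _)) _; rewrite leq_add2l.
  by rewrite -sum_nat_const; apply: leq_sum => r rJ; apply: ltnW; exact: hr.
rewrite (@Pr_indep _ _ _ N0 (EK S0) (EK V')).
- apply: ler_wpM2l; first exact: pr0.
  by apply: closure_tail hV JV => //; exact: leq_trans c01 c1N.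
- exact: EK_disj.
- exact: dep_mono light_dep.
- by move=> f g /cl_dep hfg; rewrite hfg.
Qed.

End Bounds.

Lemma count_fail t (z : R) : (c1 <= N)%N -> 1 <= z ->
  Pr (fun f => light f && (t <= cnt (EK S :\: F) c1 f)%N) <=
  Pr light * ((1 + p c1 * (z - 1)) ^+ #|EK S :\: F| / z ^+ t).
Proof.
move=> c1N z1; rewrite (@Pr_indep _ _ _ N0 F (EK S :\: F)).
- by apply: ler_wpM2l; [exact: pr0|exact: cnt_tail].
- by rewrite disjoint_sym disjoints_subset; apply/subsetP=> x; rewrite !inE => /andP[].
- exact: light_dep.
- move=> f g hfg; congr (_ <= _)%N; rewrite /cnt; apply: eq_card => e.
  by apply/setIdP/setIdP => -[eE lt]; split=> //; move: lt; rewrite hfg.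
Qed.

Definition far_from_v f rr := (rr < #|S|)%N && [exists z in S, [forall a in prim (wt f) S z rr, (cq <= f [set v; a])%N]].

(** [hub_bound] with [[set v]] as the hub: edges at [v] are independent of an exploration inside
    [S]. *)
Lemma far_from_v_fail rr : (cq <= N)%N ->
  Pr (fun f => light f && far_from_v f rr) <= Pr light * (#|S|%:R * (1 - p cq) ^+ rr.+1).
Proof.
move=> cqN.
have q0 : 0 <= 1 - p cq by rewrite subr_ge0 ler_pdivrMr ?ltr0n // mul1r ler_nat.
case: (ltnP rr #|S|) => rS; last first.
  rewrite (@eq_Pr _ _ _ _ (fun=> false)) ?Pr_false ?mulr_ge0 ?pr0 ?exprn_ge0 // => f.
  by rewrite /far_from_v ltnNge rS andbF.
have dis : [disjoint [set v] & S] by rewrite disjoints1.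
have dL : dep (EK S) light by apply: dep_mono light_dep; apply: (subset_trans FS0); exact: EK_mono.
have dA : dep (EK [set v]) (fun _ : Om => true) by [].
have hr : 1 - p cq <= (1 - p cq) * (1 - p 0%N) by rewrite mul0r subr0 mulr1.
pose E z f := light f && [forall a in prim (wt f) S z rr, (cq <= f [set v; a])%N].
apply: (@le_trans _ _ (\sum_(z in S) Pr (E z))).
  by apply: Pr_union => // f /andP[lf /andP[_ /exists_inP[z zS hz]]]; exists z => //; rewrite /E lf.
apply: (@le_trans _ _ (\sum_(z in S) Pr light * (1 - p cq) ^+ rr.+1)); last first.
  by rewrite sumr_const -[_ *+ _]mulr_natl mulrCA.
apply: ler_sum => z zS.
have := hub_bound (Ec := set0) N0 dis (sub0set _) (leq0n cq) cqN q0 hr dA dL zS rS.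
rewrite cards1 muln1 -/Pr.
have -> : Pr (fun _ : Om => true) = 1 by exact: Pr_all.
have -> : Pr (fun f : Om => [forall e in set0, (0 <= f e)%N]) = 1.
  by apply: Pr_all => // f; apply/forall_inP=> e; rewrite inE.
rewrite mul1r mulr1; apply: le_trans; apply: Pr_le => // f /andP[-> /forall_inP hz] /=.
apply/andP; split; first by apply/forall_inP=> e; rewrite inE.
apply/forall_inP=> a aP; apply/forall_inP=> y /set1P->; rewrite setUC; exact: hz.
Qed.

End StageProb.

(** * Numerical estimates *)

Section Numeric.
Variable R : realType.
Local Open Scope ring_scope.

Lemma pow_decay (u : R) n : 0 <= u <= 1 -> (1 - u) ^+ n * (1 + n%:R * u) <= 1.
Proof.
move=> /andP[u0 u1]; elim: n => [|n IH]; first by rewrite expr0 mul0r addr0 mulr1.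
apply: le_trans IH; rewrite exprS [_ * (1 - u) ^+ n]mulrC -mulrA.
apply: ler_wpM2l; first by rewrite exprn_ge0 // subr_ge0.
rewrite -natr1; have n0 : 0 <= n%:R :> R by []. nra.
Qed.

Lemma pow_decay_le (u g : R) n : 0 <= u <= 1 -> 0 < g -> 1 <= g * (1 + n%:R * u) -> (1 - u) ^+ n <= g.
Proof.
move=> hu g0 h; have d := pow_decay n hu; case/andP: hu => u0 u1.
have n0 : 0 < 1 + n%:R * u by rewrite ltr_pwDl // mulr_ge0.
by rewrite -(ler_pM2r n0); apply: le_trans d h.
Qed.

Lemma late_sum (K C Z E : R) : E <= K * (2 * K * C) -> Z <= C -> 0 <= C -> 1 <= K ->
  Z + (E + (3 + K) * C) <= 7 * K ^+ 2 * C.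
Proof.
move=> h1 h2 h3 h4.
have h5 : C <= K * C by rewrite ler_peMl.
have h6 : K * C <= K * K * C by rewrite -mulrA ler_peMl // mulr_ge0 // (le_trans ler01).
have -> : 7 * K ^+ 2 * C = 7 * (K * K * C) by ring.
have -> : (3 + K) * C = 3 * C + K * C by ring.
have h7 : K * (2 * K * C) = 2 * (K * K * C) by ring.
lra.
Qed.

Lemma early_sum (K C E : R) : E <= 2 * K * C -> 0 <= C -> 1 <= K -> E + (3 + K) * C <= 7 * K ^+ 2 * C.
Proof.
move=> h1 h3 h4.
have h5 : C <= K * C by rewrite ler_peMl.
have h6 : K * C <= K * K * C by rewrite -mulrA ler_peMl // mulr_ge0 // (le_trans ler01).
have -> : 7 * K ^+ 2 * C = 7 * (K * K * C) by ring.
have -> : (3 + K) * C = 3 * C + K * C by ring.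
have h7 : 2 * K * C = 2 * (K * C) by ring.
lra.
Qed.

(** In units of [N]: 2/100 + 1/100 + 96/100 is at most 1. *)
Lemma arith_sum (N A B C D : nat) : (100 * A <= N)%N -> (100 * B <= N)%N -> (5 * C <= 96 * D)%N ->
  (20 * D = N)%N -> (2 * A + B + C <= N)%N.
Proof. lia. Qed.

Lemma arith_count (k a : nat) : (5 * (4 * (k %/ 5) * (24 * a)) <= 96 * (a * k))%N.
Proof.
have h := leq_trunc_div k 5; set q := (k %/ 5)%N in h *.
have := leq_mul (leqnn (96 * a)%N) h; lia.
Qed.

Lemma arith_threshold (X k a m : nat) : (0 < X)%N -> (2 * X <= k)%N -> (20 * k * a = X * m)%N ->
  (24 * a <= m)%N.
Proof.
move=> X0 h E; rewrite -(leq_pmul2l X0) -E.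
by have := leq_mul h (leqnn (20 * a)%N); lia.
Qed.

Lemma arith_light (k G a g : nat) : (0 < k)%N -> (k <= G)%N -> (20 * k * a = G * g)%N -> (g <= 24 * a)%N.
Proof.
move=> k0 h E; have G0 := leq_trans k0 h; rewrite -(leq_pmul2l G0) -E.
by have := leq_mul h (leqnn (20 * a)%N); lia.
Qed.

Lemma arith_late (k l : nat) : (200 <= k)%N -> (100 * l.+1 <= k)%N ->
  (k %/ 50 + (24 * k %/ 25).+1 <= k - l.+1)%N.
Proof.
move=> k2 lk; have h1 := leq_trunc_div k 50; have h2 := leq_trunc_div (24 * k) 25.
move: h1 h2; set q1 := (k %/ 50)%N; set q2 := (_ %/ 25)%N; lia.
Qed.

Lemma exists_subset_card (T : finType) (A : {set T}) n : (n <= #|A|)%N ->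
  exists2 B : {set T}, B \subset A & #|B| = n.
Proof.
move=> h; exists [set x in take n (enum A)].
  by apply/fintype.subsetP=> x; rewrite inE => /mem_take; rewrite mem_enum.
by rewrite cardsE (card_uniqP _) ?take_uniq ?enum_uniq // size_takel // -cardE.
Qed.

Lemma expR1_le3 : expR 1 <= 3 :> R.
Proof.
have h : expR (1 / 10) <= 10 / 9 :> R.
  have h1 : 9 / 10 <= expR (- (1 / 10)) :> R by apply: le_trans (expR_ge1Dx _); lra.
  rewrite expRN in h1; have e0 := expR_gt0 (1 / 10 : R).
  by have := ler_wpM2l (ltW e0) h1; rewrite mulfV ?gt_eqF //; lra.
have -> : (1 : R) = 10%:R * (1 / 10) by lra.
rewrite expRM_natl; apply: (@le_trans _ _ ((10 / 9) ^+ 10)); last by lra.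
by apply: lerXn2r; rewrite ?nnegrE ?expR_ge0 //; lra.
Qed.

End Numeric.

(** * One stage fails with small probability *)

Section StageFail.
Import mathcomp.boot.fintype mathcomp.boot.finset Pilot.Defs.
Local Open Scope set_scope.
Local Open Scope ring_scope.
Variables (R : realType) (V : finType) (N : nat).
Hypothesis N0 : (0 < N)%N.
Local Notation Om := {ffun {set V} -> 'I_N}.
Local Notation Pr := (@Pr R {set V} N).
Implicit Types (f : Om) (x y z r a : V) (B b J U : {set V}) (e : {set V}).
Variables (S S0 : {set V}) (F : {set {set V}}) (v : V).
Hypothesis S0S : S0 \subset S.
Hypothesis FS0 : F \subset EK S0.
Hypothesis vS : v \notin S.
Hypothesis cS0 : forall x y, x \in S0 -> y \in S0 -> conn F x y.
Variables (s l Q G a m b g : nat).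
Local Notation k := #|S|.
Hypothesis s150 : (150 <= s)%N.
Hypothesis sk : (s ^ 10 <= k)%N.
Hypothesis ks : (k <= 1024 * s ^ 10)%N.
Hypothesis cF : #|F| = l.
Hypothesis cardS0 : #|S0| = l.+1.
Hypothesis Na : N = (20 * k * a)%N.
Hypothesis Nm : N = (s ^ 7 * m)%N.
Hypothesis Nb : N = (Q * b)%N.
Hypothesis Ng : N = (G * g)%N.
Hypothesis Q20 : (20 <= Q)%N.
Hypothesis Qs : (Q <= s)%N.
Hypothesis Gl : (100 * l.+1 <= G)%N.
Local Notation gam := (1 - Q%:R^-1 : R).

(** Ties are left out here, to be counted once for all stages by [tie]. *)
Definition bad_stage f := `[< {in cgraph V &, injective (wt f)} /\ ~ stage_ok f Q S v >].

Let s0 : (0 < s)%N. Proof. exact: leq_trans s150. Qed.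
Let k0 : (0 < k)%N. Proof. by apply: leq_trans sk; rewrite expn_gt0 s0. Qed.
Let a0 : (0 < a)%N. Proof. by move: N0; rewrite Na; case: (a) => //; rewrite muln0. Qed.
Let m0 : (0 < m)%N. Proof. by move: N0; rewrite Nm; case: (m) => //; rewrite muln0. Qed.
Let b0 : (0 < b)%N. Proof. by move: N0; rewrite Nb; case: (b) => //; rewrite muln0. Qed.
Let g0 : (0 < g)%N. Proof. by move: N0; rewrite Ng; case: (g) => //; rewrite muln0. Qed.

Lemma sk_exp i j : (i + j <= 10)%N -> (150 ^ j * s ^ i <= k)%N.
Proof.
move=> ij; apply: leq_trans sk; apply: (@leq_trans (s ^ (j + i))%N).
  by rewrite expnD leq_mul2r; apply/orP; right; case: (j) => // j'; rewrite leq_exp2r.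
by rewrite leq_exp2l ?(leq_trans _ s150) // addnC.
Qed.

(** Since [k] is of order [s^10], the exponents balance as follows. Level [m] is the weight [s^-7],
    so [2 * I] edges below it weigh at most [2 s^-2]. A vertex has about [s^8 s^-7 = s] edges below
    [m] to a hub of [h = s^8] vertices. An exploration meets the hub through about [s^13] edges,
    each sprinkled with probability of order [1/k], which makes about [s^3] of them light. Levels
    [c0] and [c1] are the weights [23/(20k)] and [24/(20k)], and [t] is about [4k/5]. *)
Let I := (s ^ 5)%N.
Let t := (4 * (k %/ 5))%N.
Let h := (s ^ 8)%N.
Let c0 := (23 * a)%N.
Let c1 := (24 * a)%N.

Lemma gam_gt : 19 / 20 <= gam /\ gam < 1.
Proof.
have q : (20 : R) <= Q%:R by rewrite (ler_nat R 20).
have q0 : 0 < Q%:R :> R by lra.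
split; last by rewrite ltrBlDr ltrDl invr_gt0.
have : Q%:R^-1 <= 20^-1 :> R by rewrite lef_pV2 // posrE; lra.
lra.
Qed.

Lemma p_a j : (j * a)%N%:R / N%:R = j%:R / (20 * k%:R) :> R.
Proof.
have k1 : k%:R != 0 :> R by rewrite pnatr_eq0 -lt0n.
have a1 : a%:R != 0 :> R by rewrite pnatr_eq0 -lt0n.
by rewrite Na !natrM; field; rewrite k1 a1.
Qed.

Lemma p_m : m%:R / N%:R = (s%:R ^+ 7)^-1 :> R.
Proof.
have s1 : s%:R != 0 :> R by rewrite pnatr_eq0 -lt0n.
have m1 : m%:R != 0 :> R by rewrite pnatr_eq0 -lt0n.
by rewrite Nm natrM natrX; field; rewrite s1 m1.
Qed.

Lemma p_b : b%:R / N%:R = Q%:R^-1 :> R.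
Proof.
have s1 : Q%:R != 0 :> R by rewrite pnatr_eq0 -lt0n (leq_trans _ Q20).
have m1 : b%:R != 0 :> R by rewrite pnatr_eq0 -lt0n.
by rewrite Nb natrM; field; rewrite s1 m1.
Qed.

Let rm := 1 - (2 * s%:R ^+ 7)^-1 : R.
Let r1 := 1 - (20 * k%:R)^-1 : R.

Let c0k : (1 : R) <= s%:R ^+ 7. Proof. by apply: exprn_ege1; rewrite ler1n. Qed.

Lemma rm01 : 0 <= rm <= 1.
Proof.
have h1 : 0 <= (2 * s%:R ^+ 7)^-1 :> R by rewrite invr_ge0; move: c0k; lra.
have h2 : (2 * s%:R ^+ 7)^-1 <= 1 :> R by rewrite invf_le1; move: c0k; lra.
rewrite /rm; lra.
Qed.

Let k1R : (1 : R) <= k%:R. Proof. by rewrite ler1n. Qed.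

Lemma r101 : 0 <= r1 <= 1.
Proof.
have h1 : 0 <= (20 * k%:R)^-1 :> R by rewrite invr_ge0; move: k1R; lra.
have h2 : (20 * k%:R)^-1 <= 1 :> R by rewrite invf_le1; move: k1R; lra.
rewrite /r1; lra.
Qed.

Lemma hm : 1 - m%:R / N%:R <= rm * (1 - c0%:R / N%:R).
Proof.
rewrite p_m p_a /rm; set u := (2 * _)^-1; set y := _ / (_ * _).
have -> : (s%:R ^+ 7)^-1 = 2 * u.
  by rewrite /u; field; rewrite gt_eqF // ltr0n.
have y0 : 0 <= y by rewrite divr_ge0 // mulr_ge0.
have u0 : 0 <= u by rewrite invr_ge0 mulr_ge0 // exprn_ge0.
suff yu : y <= u by nra.
have kk : 20 * k%:R > 0 :> R by move: k1R; lra.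
have ss : 2 * s%:R ^+ 7 > 0 :> R by move: c0k; lra.
rewrite /y /u ler_pdivrMr // mulrC ler_pdivlMr //.
have := sk_exp (i := 7) (j := 1) isT; rewrite expn1 -(ler_nat R) natrM natrX.
move: c0k; lra.
Qed.

Lemma h1 : 1 - c1%:R / N%:R <= r1 * (1 - c0%:R / N%:R).
Proof.
rewrite !p_a /r1; set y := (20 * k%:R)^-1.
have y0 : 0 <= y by rewrite invr_ge0 mulr_ge0.
by rewrite -[in X in X <= _](mulrC y); nra.
Qed.

Lemma rm_pow : rm ^+ h <= gam ^+ s.
Proof.
have [g1 g2] := gam_gt.
rewrite /h (expnSr s 7) exprM; apply: lerXn2r; rewrite ?nnegrE ?exprn_ge0 //.
- by case/andP: rm01.
- lra.
have hu : 0 <= ((2 * s%:R ^+ 7)^-1 : R) <= 1.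
  by have := rm01; rewrite /rm; lra.
apply: (pow_decay_le hu); first lra.
have -> : (s ^ 7)%N%:R * (2 * s%:R ^+ 7)^-1 = 1 / 2 :> R.
  by rewrite natrX; field; rewrite gt_eqF // ltr0n.
lra.
Qed.

Lemma r1_pow : r1 ^+ (I.+1 * h) <= gam ^+ s.
Proof.
have [g1 g2] := gam_gt.
apply: (@le_trans _ _ (r1 ^+ (s ^ 12 * s))).
  case/andP: r101 => ? ?; apply: ler_wiXn2l => //.
  by rewrite -expnSr (expnD s 5 8) leq_mul2r leqnSn orbT.
rewrite exprM; apply: lerXn2r; rewrite ?nnegrE ?exprn_ge0 //.
- by case/andP: r101.
- lra.
have hu : 0 <= ((20 * k%:R)^-1 : R) <= 1 by have := r101; rewrite /r1; lra.
apply: (pow_decay_le hu); first lra.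
have kk : 20 * k%:R > 0 :> R by move: k1R; lra.
suff : 1 <= (s ^ 12)%N%:R * (20 * k%:R)^-1 :> R by nra.
rewrite ler_pdivlMr // mul1r -natrM ler_nat.
apply: (@leq_trans (20 * (1024 * s ^ 10))%N); first by rewrite leq_mul2l ks.
rewrite mulnA -[12%N]/(2 + 10)%N expnD leq_mul2r; apply/orP; right.
by apply: (@leq_trans (150 ^ 2)%N) => //; rewrite leq_exp2r.
Qed.

Lemma eta_le : k%:R * (rm ^+ h + r1 ^+ (I.+1 * h)) <= 2 * k%:R * gam ^+ s.
Proof.
have := rm_pow; have := r1_pow; move: k1R; set A := rm ^+ h; set B := r1 ^+ _; set C := gam ^+ s.
nra.
Qed.

(** Exponential tail bound at [4/3]: at most about [3k/5] edges below [c1] are expected, while [t]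
    is about [4k/5]. The numerator is at most [expR (k/5)], hence about [3^(k/5)], and
    [(4/3)^4 = 256/81] exceeds 3 by so little that [gam] has to be at least 19/20; this is where
    [Q >= 20] is used. *)
Lemma count_le : (1 + c1%:R / N%:R * (4 / 3 - 1)) ^+ #|EK S :\: F| / (4 / 3) ^+ t <= 3 * gam ^+ s.
Proof.
have [g1 g2] := gam_gt.
rewrite p_a; set u : R := _ * (4 / 3 - 1).
have uE : u = 2 / 5 / k%:R by rewrite /u; field; rewrite gt_eqF // ltr0n.
have u0 : 0 <= u by rewrite uE divr_ge0.
have cD : (2 * #|EK S :\: F| <= k * k)%N.
  apply: (@leq_trans (2 * 'C(k, 2))%N).
    rewrite leq_mul2l /=; apply: (leq_trans (subset_leq_card (subsetDl _ _))).
    rewrite -cards_draws; apply: subset_leq_card; apply/subsetP=> e /setIdP[ec eS].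
    by rewrite inE eS; move: ec; rewrite inE.
  rewrite bin2 mul2n; apply: (@leq_trans (k * k.-1)%N); last by rewrite leq_mul2l leq_pred orbT.
  by rewrite -[leqRHS]odd_double_half leq_addl.
have t0 : 0 < (4 / 3 : R) ^+ t by apply: exprn_gt0; lra.
have gg : 3 <= gam * (4 / 3) ^+ 4 by rewrite !exprS expr0; lra.
have e1 : (1 + u) ^+ #|EK S :\: F| <= 3 ^+ (k %/ 5).+1.
  apply: (@le_trans _ _ (expR u ^+ #|EK S :\: F|)).
    by apply: lerXn2r; rewrite ?nnegrE ?expR_ge0 ?expR_ge1Dx //; lra.
  rewrite -expRM_natl; apply: (@le_trans _ _ (expR ((k %/ 5).+1%:R * 1))).
    rewrite ler_expR mulr1 uE.
    have : (2 * #|EK S :\: F|)%N%:R <= (k * k)%N%:R :> R by rewrite ler_nat.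
    have : (k%:R : R) <= 5 * (k %/ 5).+1%:R.
      by rewrite -natrM ler_nat mulnC; exact: ltnW (ltn_ceil k (isT : (0 < 5)%N)).
    rewrite !natrM; set D := #|_|%:R; set K := (_.+1)%:R => hK hD.
    have k2 : 0 <= k%:R :> R by [].
    have := ler_wpM2r k2 hK; rewrite mulrA ler_pdivrMr; last by move: k1R; lra.
    by move: hD; lra.
  rewrite expRM_natl; apply: lerXn2r; rewrite ?nnegrE ?expR_ge0 //.
  exact: expR1_le3.
rewrite ler_pdivrMr //; apply: (le_trans e1); clear e1; rewrite exprS -mulrA ler_pM2l //.
apply: (@le_trans _ _ (gam ^+ (k %/ 5) * (4 / 3) ^+ t)); last first.
  rewrite ler_pM2r //; apply: ler_wiXn2l; [by apply: le_trans g1|exact: ltW|].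
  rewrite leq_divRL //; have := sk_exp (i := 1) (j := 1) isT; rewrite !expn1 mulnC.
  by apply: leq_trans; rewrite leq_mul2l orbT.
rewrite /t exprM -exprMn; apply: lerXn2r; rewrite ?nnegrE //.
by apply: le_trans gg.
Qed.

Lemma height_arith : (2 * I * m + l * g + t * c1 <= N)%N.
Proof.
have h2 : (100 * (I * m) <= N)%N.
  rewrite Nm -[7%N]/(2 + 5)%N expnD -mulnA leq_mul2r; apply/orP; right.
  by apply: (@leq_trans (150 ^ 2)%N) => //; rewrite leq_exp2r.
have h3 : (100 * (l * g) <= N)%N.
  by rewrite Ng mulnA leq_mul2r (leq_trans _ Gl) ?orbT // leq_mul2l leqnSn.
have h4 : (5 * (t * c1) <= 96 * (a * k))%N by exact: arith_count.
have h5 : (20 * (a * k) = N)%N by rewrite Na -mulnA (mulnC a).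
by rewrite -mulnA; exact: arith_sum h5.
Qed.

Let c1m : (c1 <= m)%N.
Proof.
apply: (arith_threshold (X := (s ^ 7)%N) (k := k)); rewrite -?Nm ?Na ?expn_gt0 ?s0 //.
have := sk_exp (i := 7) (j := 1) isT; rewrite expn1.
by apply: leq_trans; rewrite leq_mul2r orbT.
Qed.

Lemma bad_cases f : light F g f -> bad_stage f ->
  forall B, B \subset S -> B != set0 -> (forall x y, x \in B -> y \in B -> conn (lo f c1 S) x y) ->
  [|| badhub S I c1 m f B, (t <= cnt (EK S :\: F) c1 f)%N | far_from_v S v b f I].
Proof.
move=> /forall_inP lf /asboolP[inj nok] B BS B0 hB; apply: contrapT => /negP.
rewrite !negb_or -ltnNge => /and3P[/andP[n1 n2] ct n3]; apply: nok.
have hI : forall z, z \in S -> exists2 x, x \in prim (wt f) S z I & (f [set v; x] < b)%N.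
  move=> z zS; move: n3; rewrite /far_from_v negb_and.
  have -> /= : (I < k)%N.
    have := sk_exp (i := 5) (j := 5) isT; apply: leq_trans; rewrite /I.
    by rewrite ltn_Pmull // expn_gt0 s0.
  rewrite negb_exists_in => /forall_inP/(_ z zS); rewrite negb_forall_in => /exists_inP[x xp].
  by rewrite -ltnNge => lt; exists x.
apply: (@hub_stage _ _ _ inj S B F I t l c1 m g Q) hI _ _ => //.
- move=> x xU; move: n1; rewrite negb_exists_in => /forall_inP/(_ x xU).
  by rewrite negb_forall_in => /exists_inP[y yB]; rewrite -ltnNge; exists y.
- move=> x xU IU; move: n2; rewrite IU /= negb_exists_in => /forall_inP/(_ x xU).
  rewrite negb_forall_in => /exists_inP[u uP]; rewrite negb_forall_in => /exists_inP[y yB].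
  by rewrite -ltnNge => lt; exists u, y.
- by rewrite cF.
- exact: ltnW.
- exact: height_arith.
- rewrite Nm leq_mul2r; apply/orP; right; apply: (leq_trans Qs).
  by rewrite -{1}(expn1 s) leq_exp2l // (leq_trans _ s150).
- rewrite Nm -[7%N]/(2 + 5)%N expnD -mulnA leq_mul2r; apply/orP; right; apply: (leq_trans Qs).
  by rewrite -{1}(expn1 s) leq_exp2l // (leq_trans _ s150).
- by rewrite Nb.
Qed.

Let c1N : (c1 <= N)%N. Proof.
rewrite Na /c1 leq_mul2r; apply/orP; right.
have := sk_exp (i := 0) (j := 1) isT; rewrite expn1 muln1 => h150.
by apply: (@leq_trans (20 * 150)%N) => //; rewrite leq_mul2l.
Qed.
Let c01 : (c0 <= c1)%N. Proof. by rewrite leq_mul2r orbT. Qed.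
Let mN : (m <= N)%N. Proof. by rewrite Nm leq_pmull // expn_gt0 s0. Qed.
Let bN : (b <= N)%N. Proof. by rewrite Nb leq_pmull // (leq_trans _ Q20). Qed.
Let c0m : (c0 <= m)%N.
Proof.
by apply: leq_trans c1m; rewrite leq_mul2r orbT.
Qed.

Let gam_s_ge0 : 0 <= gam ^+ s.
Proof. by have [? ?] := gam_gt; apply: exprn_ge0; lra. Qed.
Let pr0 (A : pred Om) : 0 <= Pr A. Proof. exact: Pr_ge0. Qed.

Lemma tail_le : Pr (fun f => light F g f && ((t <= cnt (EK S :\: F) c1 f)%N || far_from_v S v b f I))
  <= Pr (light F g) * ((3 + k%:R) * gam ^+ s).
Proof.
rewrite mulrDl mulrDr.
apply: (@le_trans _ _ (Pr (fun f => (light F g f && (t <= cnt (EK S :\: F) c1 f)%N) ||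
   (light F g f && far_from_v S v b f I)))).
  by apply: Pr_le => // f /andP[-> /orP[->|->]]; rewrite ?orbT.
apply: le_trans (Pr_or R N0 _ _) _; apply: lerD.
  have z1 : 1 <= 4 / 3 :> R by lra.
  apply: (le_trans (count_fail N0 S F g t c1N z1)).
  by apply: ler_wpM2l => //; exact: count_le.
apply: (le_trans (far_from_v_fail R N0 S0S FS0 vS g I bN)); rewrite p_b.
apply: ler_wpM2l => //; apply: ler_wpM2l => //.
have [? ?] := gam_gt; apply: ler_wiXn2l; [lra|lra|].
by apply: leqW; rewrite /I -{1}(expn1 s) leq_exp2l // (leq_trans _ s150).
Qed.

Let T := (k %/ 50)%N.
Let n0 := (24 * k %/ 25).+1.

(** With [24k/25] candidates left, the mean number of new vertices, 23/20 times 24/25, still exceeds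
    1. [pow_decay] gives 10/11 because [n0] times [23/(220k)] is at least 1/10. *)
Lemma late_z : (1 - c0%:R / N%:R * (1 - 10 / 11)) ^+ n0 <= 10 / 11 :> R.
Proof.
have kp : 0 < 20 * k%:R :> R by rewrite mulr_gt0 // ltr0n.
have uE : c0%:R / N%:R * (1 - 10 / 11) = 23 / 220 / k%:R :> R.
  by rewrite p_a; field; rewrite gt_eqF // ltr0n.
have k1 : 0 < k%:R :> R by rewrite ltr0n.
rewrite uE; apply: pow_decay_le.
- rewrite divr_ge0 //= ler_pdivrMr // mul1r; apply: le_trans k1R.
  by rewrite ler_pdivrMr ?mul1r ?ler_nat ?ltr0n.
- lra.
- have : (24 * k)%N%:R <= (25 * n0)%N%:R :> R.
    by rewrite ler_nat [leqRHS]mulnC; exact: ltnW (ltn_ceil _ (isT : (0 < 25)%N)).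
  rewrite !natrM => hn.
  suff : 1 / 10 <= n0%:R * (23 / 220 / k%:R) :> R by lra.
  by rewrite mulrA ler_pdivlMr //; lra.
Qed.

Let k1_big : (200 <= k)%N.
Proof.
have := sk_exp (i := 1) (j := 1) isT; rewrite !expn1; apply: leq_trans.
by apply: (@leq_trans (150 * 150)%N) => //; rewrite leq_mul2l.
Qed.

Lemma late_size : (100 * l.+1 <= k)%N -> (T + n0 <= #|S :\: S0|)%N.
Proof.
move=> lk; rewrite cardsD (setIidPr S0S) cardS0 /T /n0.
by apply: arith_late => //; apply: leq_trans k1_big.
Qed.

(** The clusters of [s] vertices outside [S0] are tried as hubs; all of them are small with
    probability at most [(10/11)^s]. As [S0] is at most a hundredth of [S], discarding it keeps the
    clusters supercritical. *)
Lemma late_fail : (100 * l.+1 <= k)%N ->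
  Pr (fun f => light F g f && bad_stage f) <= Pr (light F g) * (7 * k%:R ^+ 2 * gam ^+ s).
Proof.
move=> lk; have hV := late_size lk.
have [J JV cJ] : exists2 J : {set V}, J \subset S :\: S0 & #|J| = s.
  apply: exists_subset_card; apply: leq_trans hV; apply: (@leq_trans T); last exact: leq_addr.
  rewrite /T leq_divRL //; have := sk_exp (i := 1) (j := 1) isT; rewrite !expn1.
  by apply: leq_trans; rewrite mulnC leq_mul2r orbT.
have JT : (#|J| * h <= T)%N.
  rewrite cJ /h -expnS /T leq_divRL //; have := sk_exp (i := 9) (j := 1) isT; rewrite expn1.
  by apply: leq_trans; rewrite mulnC leq_mul2r orbT.
have J0 : (0 < #|J|)%N by rewrite cJ.
have z01 : 0 <= (10 / 11 : R) <= 1 by lra.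
have ex := late_exists N0 FS0 g c01 c1N JV JT J0 z01 late_z hV.
have hub := late_hub N0 S0S FS0 I g h c01 c0m mN c1N rm01 r101 hm h1 JV.
pose A1 f := light F g f && [forall r in J, (#|component S S0 c0 f r| < h)%N].
pose A2 f := light F g f && [exists r in J, (h <= #|component S S0 c0 f r|)%N && badhub S I c1 m f (component S S0 c0 f r)].
pose A3 f := light F g f && ((t <= cnt (EK S :\: F) c1 f)%N || far_from_v S v b f I).
apply: (@le_trans _ _ (Pr (fun f => A1 f || (A2 f || A3 f)))).
  apply: Pr_le => // f /andP[lf bs]; rewrite /A1 /A2 /A3 lf /=.
  case: (boolP [forall r in J, _]) => //= /forall_inPn[r rJ]; rewrite -leqNgt => hr.
  have rV := subsetP JV _ rJ.
  have rC : r \in component S S0 c0 f r by apply: (subsetP (cl_self _ _ _)); rewrite ?sub1set // set11.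
  have CS : component S S0 c0 f r \subset S.
    by apply/subsetP=> x /setIdP[/setDP[]].
  have C0 : component S S0 c0 f r != set0 by apply/set0Pn; exists r.
  have hC x y : x \in component S S0 c0 f r -> y \in component S S0 c0 f r -> conn (lo f c1 S) x y.
    move=> /setIdP[_ /exists_inP[r1' /set1P-> cx]] /setIdP[_ /exists_inP[r2' /set1P-> cy]].
    have sub : lo f c0 (S :\: S0) \subset lo f c1 S.
      apply: subset_trans (below_sub _ _ (subsetDl S S0)) _.
      by apply: below_imp => u uc; exact: leq_trans uc c01.
    by apply: (conn_trans _ (conn_mono sub cy)); rewrite connC; exact: conn_mono cx.
  have /or3P[bh|->|->] := bad_cases lf bs CS C0 hC; rewrite ?orbT //.
  by apply/orP; left; apply/exists_inP; exists r => //; rewrite hr.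
apply: le_trans (Pr_or R N0 _ _) _; apply: le_trans (lerD ex (Pr_or R N0 _ _)) _.
apply: le_trans (lerD (lexx _) (lerD hub tail_le)) _.
rewrite -!mulrDr; apply: ler_wpM2l => //; rewrite cJ.
have [g1 g2] := gam_gt.
have z_le : (10 / 11) ^+ s <= gam ^+ s.
  apply: lerXn2r; rewrite ?nnegrE //; lra.
have sk' : s%:R <= k%:R :> R.
  rewrite ler_nat; have := sk_exp (i := 1) (j := 0) isT; by rewrite expn1 mul1n.
have := eta_le; set E := k%:R * (_ + _) => hE.
have hE2 : s%:R * E <= k%:R * (2 * k%:R * gam ^+ s).
  apply: (le_trans (ler_wpM2l (ler0n R s) hE)); apply: ler_wpM2r => //.
  by rewrite mulr_ge0 // mulr_ge0.
by apply: late_sum; rewrite ?k1R ?gam_s_ge0.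
Qed.

(** [S0] is more than a hundredth of [S], thus larger than [h], and it is connected by edges of
    weight at most [1/G], which are below [c1] because [G] exceeds [k]. *)
Lemma early_fail : (k < 100 * l.+1)%N ->
  Pr (fun f => light F g f && bad_stage f) <= Pr (light F g) * (7 * k%:R ^+ 2 * gam ^+ s).
Proof.
move=> lk.
have hB f : light F g f -> forall x y, x \in S0 -> y \in S0 -> conn (lo f c1 S) x y.
  move=> /forall_inP lf x y xS yS; apply: conn_mono (cS0 xS yS).
  apply/subsetP=> e eF; have /setIdP[ec eS] := subsetP FS0 _ eF.
  rewrite inE ec (subset_trans eS S0S) /wt; apply: (leq_trans (lf e eF)).
  apply: (@arith_light k G) => //; first exact: leq_trans (ltnW lk) Gl.
  by rewrite -Na.
have S00 : S0 != set0 by rewrite -card_gt0 cardS0.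
have hS0 : (h <= #|S0|)%N.
  rewrite cardS0 -(leq_pmul2l (isT : (0 < 100)%N)); apply: leq_trans (ltnW lk).
  have := sk_exp (i := 8) (j := 1) isT; rewrite expn1.
  by apply: leq_trans; rewrite leq_mul2r orbT.
have hub := early_hub N0 S0S FS0 I g mN c1N rm01 r101 hm h1 hS0.
pose A2 f := light F g f && badhub S I c1 m f S0.
pose A3 f := light F g f && ((t <= cnt (EK S :\: F) c1 f)%N || far_from_v S v b f I).
apply: (@le_trans _ _ (Pr (fun f => A2 f || A3 f))).
  by apply: Pr_le => // f /andP[lf bs]; have := bad_cases lf bs S0S S00 (hB f lf); rewrite /A2 /A3 lf.
apply: le_trans (Pr_or R N0 _ _) _; apply: le_trans (lerD hub tail_le) _.
rewrite -!mulrDr; apply: ler_wpM2l => //.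
have := eta_le; set E := k%:R * (_ + _) => hE.
by apply: early_sum; rewrite ?k1R ?gam_s_ge0.
Qed.

Theorem stage_fail : Pr (fun f => light F g f && bad_stage f) <=
  Pr (light F g) * (7 * k%:R ^+ 2 * gam ^+ s).
Proof.
by case: (leqP (100 * l.+1) k) => lk; [exact: late_fail|exact: early_fail].
Qed.

End StageFail.

(** * Running all the stages *)

Section Order.
Import mathcomp.boot.fintype mathcomp.boot.finset Pilot.Defs.
Local Open Scope set_scope.
Local Open Scope ring_scope.
Variables (V : finType) (R : realType).
Implicit Types (x y z : V) (S : {set V}) (e : {set V}) (H J F : {set {set V}}) (o : seq V).

Definition first k o : {set V} := [set x in take k o].

Definition search_order H o :=
  [/\ uniq o, forall x, x \in o &
      forall p x q, o = p ++ x :: q -> p != [::] -> exists2 y, y \in p & adj H x y].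

Variable w : {set V} -> R.
Hypothesis inj : {in cgraph V &, injective w}.
Hypothesis w_ge0 : forall e, e \in cgraph V -> 0 <= w e.
Hypothesis w_le1 : forall e, e \in cgraph V -> w e <= 1.

Lemma kr_set1 x : kr w [set x] = set0.
Proof.
apply/setP=> e; rewrite [RHS]inE; apply/negbTE/negP=> eK.
have := subsetP (kr_cgraph w _) _ eK; have := subset_leq_card (kr_in eK).
by rewrite cards1 inE => + /eqP E; rewrite E.
Qed.

Definition real_stage (q : R) S v :=
  [/\ forall x y, x \in S -> y \in S ->
        exists J, [/\ J \subset kr w S, conn J x y & weight w J <= 1],
      forall e, e \in kr w S -> w e <= q &
      forall z, z \in S -> exists y J, [/\ y \in S, w [set v; y] <= q, J \subset kr w S,
        conn J z y & weight w J <= q] ].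

(** Along the prefixes [p] the subgraph is the minimum spanning tree on [p] and agrees with [H] on
    all edges not inside [p], so that the next vertex still has its edge to [p]. With [c1 = 1] and
    [c3 = q], both bounds of [growth] become [1 + q + q]. *)
Lemma reach_order H o q : 0 <= q -> H \subset cgraph V -> search_order H o ->
  (forall p x r, o = p ++ x :: r -> p != [::] -> real_stage q [set y in p] x) ->
  reach w (1 + q + q) [set: V] H (kr w [set: V]).
Proof.
move=> q0 HK [uo fo ao] st.
suff main p r : o = p ++ r -> p != [::] -> exists2 H', reach w (1 + q + q) [set: V] H H' &
    [/\ H' \subset cgraph V, induced H' [set y in p] = kr w [set y in p] &
     forall e, ~~ (e \subset [set y in p]) -> (e \in H') = (e \in H)].
  case E : o => [|x o'].
    have -> : H = kr w [set: V]; last exact: reach0.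
    have noV x : False by have := fo x; rewrite E.
    apply/setP=> e; apply/idP/idP => [/(subsetP HK)|/(subsetP (kr_cgraph _ _))] /edgeP[x];
      by case: (noV x).
  have o0 : o != [::] by rewrite E.
  have [H' rH [HK' HM _]] := main o [::] (esym (cats0 o)) o0.
  have oT : [set y in o] = [set: V] by apply/setP=> y; rewrite !inE fo.
  move: HM; rewrite oT => HM.
  have -> // : kr w [set: V] = H'.
  by rewrite -HM; apply/setP=> e; rewrite inducedE subsetT andbT.
elim/last_ind: p r => // p x IH r E _.
case: (eqVneq p [::]) => [p0|p0].
  exists H; first exact: reach0.
  have -> : [set y in rcons p x] = [set x] by rewrite p0; apply/setP=> y; rewrite !inE.
  split=> //; rewrite kr_set1; apply/setP=> e; rewrite [RHS]inE; apply/negbTE/negP.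
  rewrite inducedE => /andP[/(subsetP HK) eK /subset_leq_card]; rewrite cards1.
  by move: eK; rewrite inE => /eqP->.
have E' : o = p ++ x :: r by rewrite E cat_rcons.
have [H' rH [HK' HM out]] := IH (x :: r) E' p0.
have Sx : [set y in rcons p x] = x |: [set y in p].
  by apply/setP=> y; rewrite !inE mem_rcons inE.
have xp : x \notin [set y in p].
  by move: uo; rewrite E' cat_uniq /= inE => /and3P[_ /norP[]].
have [D1 D2 D3] := st p x r E' p0.
have [y yp axy] := ao p x r E' p0.
have at' : exists2 z, z \in [set y in p] & adj H' x z.
  exists y; first by rewrite inE.
  by rewrite /adj out // sub2 negb_and xp.
exists ((H' :\: induced H' (x |: [set y in p])) :|: kr w (x |: [set y in p])).
  apply: reach_trans rH _; apply: (growth inj w_ge0 w_le1 xp D1 D2 D3) => //.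
  by rewrite addrC addrA.
rewrite Sx; split.
- by rewrite subUset kr_cgraph andbT; apply: subset_trans HK'; exact: subsetDl.
- apply/setP=> e; rewrite inducedE -/(step w H' _) in_step.
  case eK : (e \in kr w _); first by rewrite orbT (kr_in eK).
  by rewrite orbF -andbA andNb andbF.
- move=> e ne; rewrite -/(step w H' _) in_step ne andbT.
  case eK : (e \in kr w _); first by rewrite (kr_in eK) in ne.
  rewrite orbF; apply: out; apply: contra ne => h; apply: (subset_trans h); exact: subsetUr.
Qed.

End Order.

(** * From levels to real weights *)

Section Transfer.
Import mathcomp.boot.fintype mathcomp.boot.finset Pilot.Defs.
Local Open Scope set_scope.
Variables (V : finType) (d1 d2 : Order.disp_t) (T1 : orderType d1) (T2 : orderType d2).
Variables (w1 : {set V} -> T1) (w2 : {set V} -> T2).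

Lemma kr_ext S : (forall e e', e \in cgraph V -> e' \in cgraph V -> (w1 e < w1 e')%O = (w2 e < w2 e')%O) ->
  kr w1 S = kr w2 S.
Proof.
move=> h; apply/setP=> e; rewrite !inE; apply: andb_id2l => ec; apply: andb_id2l => eS.
have -> // : lighter w1 e S = lighter w2 e S.
by apply/setP=> g; rewrite !inE; apply: andb_id2l => gc; rewrite h // ?inE.
Qed.

End Transfer.

Section RealStage.
Import mathcomp.boot.fintype mathcomp.boot.finset Pilot.Defs.
Local Open Scope set_scope.
Local Open Scope ring_scope.
Variables (V : finType) (R : realType) (N : nat).
Hypothesis N0 : (0 < N)%N.
Variables (w : {set V} -> R) (f : {ffun {set V} -> 'I_N}).
Hypothesis iso : forall e e', e \in cgraph V -> e' \in cgraph V -> (wt f e < wt f e')%O = (w e < w e')%O.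
Hypothesis wf : forall e, e \in cgraph V -> w e <= (f e).+1%:R / N%:R.

Lemma weight_height (J : {set {set V}}) : J \subset cgraph V -> weight w J <= (height f J)%:R / N%:R.
Proof.
move=> JK; rewrite /height natr_sum mulr_suml; apply: ler_sum => e eJ.
by apply: wf; exact: (subsetP JK).
Qed.

Lemma real_stageP Q (S : {set V}) v : (0 < Q)%N -> v \notin S -> stage_ok f Q S v -> real_stage w Q%:R^-1 S v.
Proof.
move=> Q0 vS [D1 D2 D3].
have kE : kr (wt f) S = kr w S by apply: kr_ext.
have NR : 0 < N%:R :> R by rewrite ltr0n.
have QR : 0 < Q%:R :> R by rewrite ltr0n.
have le n : (Q * n <= N)%N -> n%:R / N%:R <= Q%:R^-1 :> R.
  move=> h; rewrite ler_pdivrMr // mulrC ler_pdivlMr // -natrM ler_nat mulnC //.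
split; rewrite -kE.
- move=> x y xS yS; have [J [JM cJ hJ]] := D1 x y xS yS; exists J; split=> //.
  apply: le_trans (weight_height (subset_trans JM (kr_cgraph _ _))) _.
  by rewrite ler_pdivrMr // mul1r ler_nat.
- by move=> e eM; apply: le_trans (wf (subsetP (kr_cgraph _ _) _ eM)) _; apply: le; exact: D2.
- move=> z zS; have [y [J [yS wy JM cJ hJ]]] := D3 z zS; exists y, J; split=> //.
    apply: le_trans (le _ wy); apply: wf; rewrite edge2; by apply: contraNneq vS => ->.
  by apply: le_trans (weight_height (subset_trans JM (kr_cgraph _ _))) _; exact: le.
Qed.

End RealStage.

(** * Summability of the failure probabilities *)

Section Decay.
Variable R : realType.
Local Open Scope ring_scope.

(** As [k] is at most [c s^10], a bound on [s^40 (1 - u)^s] absorbs four powers of [k]: two from the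
    stage estimate and two for summability. That bound comes from [pow_decay] applied to each of 40
    equal parts of the exponent. *)
Lemma poly_exp_decay (u : R) (c : nat) : 0 < u <= 1 ->
  exists C, 0 <= C /\ forall k s : nat, (0 < k)%N -> (k <= c * s ^ 10)%N ->
    7 * k%:R ^+ 2 * (1 - u) ^+ s <= C / k%:R ^+ 2.
Proof.
move=> /andP[u0 u1].
have u01 : 0 <= 1 - u <= 1 by lra.
case/andP: (u01) => v0 v1.
have key s : s%:R ^+ 40 * (1 - u) ^+ s <= (40%:R / u) ^+ 40.
  have -> : (1 - u) ^+ s = (1 - u) ^+ (s %% 40) * ((1 - u) ^+ (s %/ 40)) ^+ 40.
    by rewrite -exprM -exprD addnC -divn_eq.
  set j := (s %/ 40)%N.
  have d : (1 - u) ^+ j * (1 + j%:R * u) <= 1 by apply: pow_decay; rewrite (ltW u0).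
  have sj : s%:R <= 40%:R * (j%:R + 1) :> R.
    by rewrite natr1 -natrM ler_nat mulnC; exact: ltnW (ltn_ceil s (isT : (0 < 40)%N)).
  have w0 : 0 <= (1 - u) ^+ j by exact: exprn_ge0.
  apply: (@le_trans _ _ (s%:R ^+ 40 * ((1 - u) ^+ j) ^+ 40)).
    apply: ler_wpM2l; first exact: exprn_ge0.
    by apply: ler_piMl; [exact: exprn_ge0|exact: exprn_ile1].
  rewrite -exprMn; apply: lerXn2r; rewrite ?nnegrE ?mulr_ge0 ?divr_ge0 ?invr_ge0 ?(ltW u0) //.
  rewrite ler_pdivlMr //; set b := (1 - u) ^+ j in d w0 *; set S := s%:R in sj *.
  have j0 : 0 <= j%:R :> R by [].
  have h1 : S * b <= 40%:R * (j%:R + 1) * b by apply: ler_wpM2r.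
  have h2 : S * b * u <= 40%:R * (j%:R + 1) * b * u by apply: ler_wpM2r => //; exact: ltW.
  apply: (le_trans h2).
  have h3 : b * u <= b by apply: ler_piMr.
  have -> : 40%:R * (j%:R + 1) * b * u = 40%:R * (b * (j%:R * u) + b * u) by ring.
  rewrite -[leRHS]mulr1; apply: ler_wpM2l => //; apply: le_trans d.
  by rewrite mulrDr mulr1 addrC lerD2r.
set D := (40%:R / u) ^+ 40 in key.
have D0 : 0 <= D by apply: exprn_ge0; rewrite divr_ge0 // ltW.
exists (7 * (c%:R ^+ 4 * D)); split; first by apply: mulr_ge0 => //; apply: mulr_ge0 => //; exact: exprn_ge0.
move=> k s k0 ks; have k1 : 0 < k%:R :> R by rewrite ltr0n.
rewrite ler_pdivlMr ?exprn_gt0 //.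
have -> : 7 * k%:R ^+ 2 * (1 - u) ^+ s * k%:R ^+ 2 = 7 * (k%:R ^+ 4 * (1 - u) ^+ s) by ring.
apply: ler_wpM2l => //.
have ks' : k%:R ^+ 4 <= c%:R ^+ 4 * s%:R ^+ 40 :> R.
  have -> : (s%:R : R) ^+ 40 = (s%:R ^+ 10) ^+ 4 by rewrite -exprM.
  rewrite -exprMn; apply: lerXn2r; rewrite ?nnegrE ?mulr_ge0 ?exprn_ge0 //.
  by rewrite -natrX -natrM ler_nat.
apply: (@le_trans _ _ (c%:R ^+ 4 * s%:R ^+ 40 * (1 - u) ^+ s)).
  by apply: ler_wpM2r => //; exact: exprn_ge0.
by rewrite -mulrA; apply: ler_wpM2l => //; exact: exprn_ge0.
Qed.

(** The integer tenth root; 1024 is [2^10], from [s.+1 <= 2 * s]. *)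
Lemma root10 k c : (c ^ 10 <= k)%N -> (0 < c)%N -> exists s, [/\ (c <= s)%N, (s ^ 10 <= k)%N, (s <= k)%N & (k <= 1024 * s ^ 10)%N].
Proof.
move=> ck c0; have ex : exists s, (s ^ 10 <= k)%N by exists c.
have bd s : (s ^ 10 <= k)%N -> (s <= k)%N.
  case: s => // s; apply: leq_trans; rewrite -{1}(expn1 s.+1); exact: leq_pexp2l.
have [s sk mx] := ex_maxnP ex bd; exists s; have cs := mx c ck; split=> //; first exact: bd.
have s0 : (0 < s)%N := leq_trans c0 cs.
have lt : (k < s.+1 ^ 10)%N by rewrite ltnNge; apply/negP=> /mx; rewrite ltnn.
apply: (leq_trans (ltnW lt)); apply: (@leq_trans ((2 * s) ^ 10)%N).
  by rewrite leq_exp2r // mul2n -addnn -addn1 leq_add2l.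
by rewrite expnMn.
Qed.

(** Telescoping, with [1/(x+1)^2 <= 1/x - 1/(x+1)]. *)
Lemma sum_inv_sq (C : R) L n : 0 <= C -> (0 < L)%N ->
  \sum_(k < n | (L < k)%N) C / k%:R ^+ 2 <= C / L%:R.
Proof.
move=> C0 L0; have LR : 0 < L%:R :> R by rewrite ltr0n.
have CL : 0 <= C / L%:R by rewrite divr_ge0.
case: (leqP n L.+1) => nL.
  rewrite big_pred0 // => k; apply/negbTE; rewrite -leqNgt -ltnS.
  exact: leq_trans (ltn_ord k) nL.
have -> : n = (L.+1 + (n - L.+1))%N by rewrite subnKC // ltnW.
move: (n - L.+1)%N => m.
suff h : \sum_(k < L.+1 + m | (L < k)%N) C / k%:R ^+ 2 <= C / L%:R - C / (L + m)%:R.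
  apply: (le_trans h); rewrite gerBl divr_ge0 //.
elim: m => [|m IH].
  rewrite !addn0 subrr big_pred0 // => k; apply/negbTE; rewrite -leqNgt -ltnS.
  exact: ltn_ord.
rewrite addnS big_mkcond big_ord_recr -big_mkcond /=.
have -> : (L < L.+1 + m)%N by rewrite addSn ltnS leq_addr.
apply: (le_trans (lerD IH (lexx _))); rewrite -addrA lerD2l.
have x0 : 0 < (L + m)%:R :> R by rewrite ltr0n addn_gt0 L0.
rewrite addSn addnS -natr1; set x := (L + m)%:R in x0 *.
have x1 : 0 < x + 1 by lra.
have -> : C / (x + 1) ^+ 2 = C / (x + 1) * (x + 1)^-1 by field; rewrite gt_eqF //.
have E : C / x = C / (x + 1) * (1 + x^-1) by field; rewrite -natrD !gt_eqF //.
rewrite E; set y := C / (x + 1).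
have y0 : 0 <= y by rewrite divr_ge0 // ltW.
have : (x + 1)^-1 <= x^-1 by rewrite lef_pV2 ?posrE // lerDl.
rewrite -subr_ge0 => h; have := mulr_ge0 y0 h; lra.
Qed.

End Decay.

(** * Choosing a starting group *)

Section SecondMoment.
Import mathcomp.boot.fintype mathcomp.boot.finset.
Local Open Scope ring_scope.
Variables (R : realType) (I : finType) (N : nat).
Hypothesis N0 : (0 < N)%N.
Local Notation Om := {ffun I -> 'I_N}.
Local Notation Pr := (@Pr R I N).
Local Notation Ex := (@Ex R I N).

(** If every [A i] entails [B i], the number [X] of events [A i] equals the number [Y] of events
    [A i && B i]. So either [X] is at most half its mean, unlikely by Chebyshev's inequality, or [Y]
    is at least that half, unlikely by Markov's inequality as its mean is at most [beta] times that
    of [X]. *)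
Lemma second_moment (J : finType) (A B : J -> pred Om) (mu beta : R) :
  (0 < #|J|)%N -> 0 < mu -> 0 <= beta ->
  (forall i, Pr (A i) = mu) -> (forall i j, i != j -> Pr (fun f => A i f && A j f) = mu ^+ 2) ->
  (forall i, Pr (fun f => A i f && B i f) <= mu * beta) ->
  Pr (fun f => [forall i, A i f ==> B i f]) <= 4 / (#|J|%:R * mu) + 2 * beta.
Proof.
move=> J0 mu0 beta0 hA hAA hB.
have M0 : 0 < #|J|%:R :> R by rewrite ltr0n.
set M := #|J|%:R in M0 *.
have T0 : 0 < M * mu by rewrite mulr_gt0.
pose X f : R := \sum_i (A i f)%:R; pose Y f : R := \sum_i (A i f && B i f)%:R.
apply: (@le_trans _ _ (Pr (fun f => ((M * mu / 2) ^+ 2 <= (X f - M * mu) ^+ 2) || (M * mu / 2 <= Y f)))).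
  apply: Pr_le => // f /forallP h; have XY : X f = Y f.
    by apply: eq_bigr => i _; have := h i; case: (A i f) => //= ->.
  case: (leP (M * mu / 2) (Y f)) => hY; rewrite ?orbT // orbF -XY in hY *.
  have X0 : 0 <= X f by apply: sumr_ge0 => i _; case: (A i f).
  nra.
apply: le_trans (Pr_or R N0 _ _) _; apply: lerD.
  have S0 : 0 < (M * mu / 2) ^+ 2 by rewrite exprn_gt0 // divr_gt0.
  apply: le_trans (Markov N0 S0 _) _; first by move=> f; exact: sqr_ge0.
  have EX : Ex X = M * mu.
    rewrite Ex_sum (eq_bigr (fun=> mu)) => [|i _]; last exact: hA.
    by rewrite sumr_const -[_ *+ _]mulr_natl.
  have EX2 : Ex (fun f => X f ^+ 2) <= M * mu + (M * mu) ^+ 2.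
    have -> : Ex (fun f => X f ^+ 2) = \sum_i \sum_j Pr (fun f => A i f && A j f).
      rewrite -(eq_bigr _ (fun i _ => Ex_sum _ _)) -Ex_sum; apply: eq_Ex => f.
      rewrite expr2 mulr_suml; apply: eq_bigr => i _; rewrite mulr_sumr; apply: eq_bigr => j _.
      by rewrite -natrM mulnb.
    apply: (@le_trans _ _ (\sum_(i : J) (mu + M * mu ^+ 2))).
      apply: ler_sum => i _; rewrite (bigD1 i) //=; apply: lerD.
        by rewrite -(hA i); apply: Pr_le => // f /andP[].
      apply: (@le_trans _ _ (\sum_(j : J) mu ^+ 2)).
        rewrite [leRHS](bigID (fun j => j != i)) /= -[leLHS]addr0; apply: lerD.
          by apply: ler_sum => j ji; rewrite hAA // eq_sym.
        by apply: sumr_ge0 => j _; exact: sqr_ge0.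
      by rewrite sumr_const -[_ *+ _]mulr_natl.
    rewrite sumr_const -[_ *+ _]mulr_natl -/M.
    by have -> : M * (mu + M * mu ^+ 2) = M * mu + (M * mu) ^+ 2 by ring.
  have -> : Ex (fun f => (X f - M * mu) ^+ 2) = Ex (fun f => X f ^+ 2) - (M * mu) ^+ 2.
    have -> : Ex (fun f => (X f - M * mu) ^+ 2) =
       Ex (fun f => X f ^+ 2 + (- (2 * (M * mu)) * X f + (M * mu) ^+ 2)).
      by apply: eq_Ex => f; ring.
    by rewrite Ex_add Ex_add Ex_scale Ex_const // EX; ring.
  rewrite ler_pdivrMr //.
  have -> : 4 / (M * mu) * (M * mu / 2) ^+ 2 = M * mu.
    by field; rewrite !gt_eqF.
  by rewrite lerBlDr.
have H0 : 0 < M * mu / 2 by rewrite divr_gt0.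
apply: le_trans (Markov N0 H0 _) _; first by move=> f; apply: sumr_ge0 => i _; case: (_ && _).
rewrite Ex_sum ler_pdivrMr //; apply: (@le_trans _ _ (\sum_(i : J) mu * beta)).
  by apply: ler_sum => i _; exact: hB.
rewrite sumr_const -[_ *+ _]mulr_natl -/M.
by have -> : 2 * beta * (M * mu / 2) = M * (mu * beta) by field.
Qed.

End SecondMoment.

(** * Starting groups and the stages that follow them *)

Section Group.
Import mathcomp.boot.fintype mathcomp.boot.finset Pilot.Defs.
Local Open Scope set_scope.
Local Open Scope ring_scope.
Variables (V : finType) (R : realType) (N : nat).
Hypothesis N0 : (0 < N)%N.
Local Notation Om := {ffun {set V} -> 'I_N}.
Local Notation Pr := (@Pr R {set V} N).
Implicit Types (x y z : V) (S : {set V}) (e : {set V}) (H J F : {set {set V}}) (o p : seq V) (f : Om).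

(** [F] is a spanning tree of the first [L.+1] vertices, each attached to an earlier one. Having
    exactly [L] edges, all groups are light with the same probability. *)
Definition group_start L (F : {set {set V}}) o :=
  [/\ uniq o, (L < size o)%N, F \subset EK [set x in take L.+1 o], #|F| = L &
      forall p x q, o = p ++ x :: q -> p != [::] -> (size p <= L)%N ->
        exists2 y, y \in p & [set x; y] \in F].

Lemma card_seq p : uniq p -> #|[set x in p]| = size p.
Proof. by move=> u; rewrite cardsE; apply/card_uniqP. Qed.

Section Fixed.
Variables (L : nat) (F : {set {set V}}) (o : seq V) (Q G g : nat).
Hypothesis st : group_start L F o.
Hypothesis L0 : (0 < L)%N.
Hypothesis Q20 : (20 <= Q)%N.
Hypothesis Ng : N = (G * g)%N.
Hypothesis GQ : (Q * L ^ 2 <= G)%N.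

Lemma group_conn p q : o = p ++ q -> (size p <= L.+1)%N ->
  forall x y, x \in [set u in p] -> y \in [set u in p] -> conn (F :&: EK [set u in p]) x y.
Proof.
have [_ _ FK _ hF] := st.
elim/last_ind: p q => [|p z IH] q E sz x y; first by rewrite !inE.
rewrite size_rcons ltnS in sz; rewrite cat_rcons in E.
set P := [set u in p] in IH; set P' := [set u in rcons p z].
have P'E u : (u \in P') = (u == z) || (u \in P) by rewrite !inE mem_rcons inE.
have sub : F :&: EK P \subset F :&: EK P'.
  by apply: setIS; apply: EK_mono; apply/subsetP=> u uP; rewrite P'E uP orbT.
have old u v : u \in P -> v \in P -> conn (F :&: EK P') u v.
  by move=> uP vP; apply: conn_mono sub _; apply: (IH _ E (leqW sz)).
case: (eqVneq p [::]) => [p0|p0].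
  by rewrite !P'E /P p0 !inE !orbF => /eqP-> /eqP->; exact: conn0.
have [y0 y0p zy] := hF p z q E p0 sz.
have zc : forall u, u \in P -> conn (F :&: EK P') z u.
  move=> u uP; apply: (@conn_trans _ _ y0); last by apply: old => //; rewrite inE.
  have /setIdP[ec _] := subsetP FK _ zy.
  by apply: conn1; rewrite /adj in_setI zy inE ec sub2 !P'E eqxx /= inE y0p orbT.
rewrite !P'E => /orP[/eqP->|xP] /orP[/eqP->|yP]; rewrite ?conn0 //.
- exact: zc.
- by rewrite connC; exact: zc.
- exact: old.
Qed.

(** The list [drop k (take k.+1 o)] consists of the vertex in position [k]; this form avoids a
    default vertex. *)
Definition bad_later f := [exists k : 'I_(size o), (L < k)%N &&
  [exists x in drop k (take k.+1 o), bad_stage [set y in take k o] x Q f]].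

Lemma drop_take1 p x q : o = p ++ x :: q -> drop (size p) (take (size p).+1 o) = [:: x].
Proof.
by move=> ->; rewrite take_cat ltnNge leqnSn /= subSnn /= take0 drop_size_cat.
Qed.

Lemma good_stages f : {in cgraph V &, injective (wt f)} -> light F g f -> ~~ bad_later f ->
  forall p x q, o = p ++ x :: q -> p != [::] -> stage_ok f Q [set y in p] x.
Proof.
move=> inj /forall_inP lf nb p x q E p0.
have [uo So FK cF hF] := st.
have up : uniq p by move: uo; rewrite E cat_uniq => /and3P[].
case: (leqP (size p) L) => sz.
  apply: (@light_stage _ _ _ _ _ F g) => //.
  - exact: leq_trans Q20.
  - by case: p p0 {E sz up} => // y p _; apply/set0Pn; exists y; rewrite inE mem_head.
  - exact: (group_conn E (leqW sz)).
  - by have [y yp xy] := hF p x q E p0 sz; exists y => //; rewrite inE.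
  rewrite Ng mulnA leq_mul2r; apply/orP; right; apply: leq_trans GQ.
  by rewrite leq_mul2l leq_exp2r // card_seq // sz orbT.
apply: contrapT => nok; case/negP: nb; apply/existsP.
have lt : (size p < size o)%N by rewrite E size_cat /= -addSnnS leq_addr.
exists (Ordinal lt); rewrite /= sz /=; apply/exists_inP; exists x.
  by rewrite (drop_take1 E) mem_seq1.
have -> : take (size p) o = p by rewrite E take_size_cat.
by apply/asboolP.
Qed.

Variables (C : R) (c : nat).
Hypothesis C0 : 0 <= C.
Hypothesis c150 : (150 <= c)%N.
Hypothesis cQ : (Q <= c)%N.
Hypothesis cL : (c ^ 10 <= L)%N.
Hypothesis GL : (100 * L.+1 <= G)%N.
Hypothesis NQ : (Q %| N)%N.
Hypothesis Nk : forall k, (0 < k < size o)%N -> (20 * k %| N)%N /\ (k ^ 7 %| N)%N.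
Hypothesis decay : forall k s : nat, (0 < k)%N -> (k <= 1024 * s ^ 10)%N ->
  7 * k%:R ^+ 2 * (1 - Q%:R^-1) ^+ s <= C / k%:R ^+ 2.

(** Union bound over the stages beyond [L], each bounded by [C / k^2]. The divisibility hypotheses
    make the levels [N / (20 k)], [N / s^7] and [N / Q] integers, so thresholds need no rounding. *)
Lemma bad_later_prob :
  Pr (fun f => light F g f && bad_later f) <= Pr (light F g) * (C / L%:R).
Proof.
have [uo So FK cF hF] := st.
have L0R := Pr_ge0 R N0 (light F g).
pose E (k : 'I_(size o)) f := light F g f &&
   [exists x in drop k (take k.+1 o), bad_stage [set y in take k o] x Q f].
apply: (@le_trans _ _ (\sum_(k < size o | (L < k)%N) Pr (E k))).
  by apply: Pr_union => // f /andP[lf /existsP[k /andP[Lk hk]]]; exists k => //; rewrite /E lf.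
apply: (@le_trans _ _ (\sum_(k < size o | (L < k)%N) Pr (light F g) * (C / k%:R ^+ 2))); last first.
  by rewrite -mulr_sumr; apply: ler_wpM2l => //; exact: sum_inv_sq.
apply: ler_sum => k Lk.
have ko := ltn_ord k.
have k0 : (0 < k)%N := leq_ltn_trans (leq0n _) Lk.
have [x0 _] : exists x, x \in o.
  by have := leq_ltn_trans (leq0n k) ko; rewrite -has_predT => /hasP[x xo _]; exists x.
have Eo : o = take k o ++ nth x0 o k :: drop k.+1 o by rewrite -drop_nth // cat_take_drop.
have szk : size (take k o) = k by rewrite size_takel // ltnW.
have [s [cs sk s_le ks]] := root10 (leq_trans cL (ltnW Lk)) (leq_trans (isT : (0 < 150)%N) c150).
have up : uniq (take k o) by exact: take_uniq.
have cS : #|[set y in take k o]| = k by rewrite card_seq.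
set S := [set y in take k o] in cS *; set v := nth x0 o k in Eo *.
pose S0 := [set y in take L.+1 o].
have S0S : S0 \subset S.
  apply/subsetP=> y; rewrite !inE => yt.
  by move: yt; rewrite -{1}(@take_takel _ L.+1 k) // => /mem_take.
have vS : v \notin S.
  by move: uo; rewrite {1}Eo cat_uniq /= inE => /and3P[_ /norP[]].
have cS0 : #|S0| = L.+1 by rewrite card_seq ?take_uniq // size_takel.
have conS0 x y : x \in S0 -> y \in S0 -> conn F x y.
  move=> xS yS; have Eo' : o = take L.+1 o ++ drop L.+1 o by rewrite cat_take_drop.
  have := group_conn Eo' _ xS yS; rewrite size_takel // => /(_ (leqnn _)).
  by apply: conn_mono; exact: subsetIl.
have [/dvdnP[a Na] _] := Nk (introT andP (conj k0 ko)).
have so : (0 < s < size o)%N.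
  by rewrite (leq_trans _ cs) ?(leq_trans _ c150) //= (leq_ltn_trans s_le ko).
have [_ /dvdnP[m Nm]] := Nk so.
have /dvdnP[b Nb] := NQ.
have Na' : N = (20 * #|S| * a)%N by rewrite cS mulnC.
have Nm' : N = (s ^ 7 * m)%N by rewrite mulnC.
have Nb' : N = (Q * b)%N by rewrite mulnC.
have sk' : (s ^ 10 <= #|S|)%N by rewrite cS.
have ks' : (#|S| <= 1024 * s ^ 10)%N by rewrite cS.
have := stage_fail R N0 S0S FK vS conS0 (leq_trans c150 cs) sk' ks' cF cS0 Na' Nm' Nb' Ng Q20
  (leq_trans cQ cs) GL.
rewrite cS => le; apply: (@le_trans _ _ (Pr (light F g) * (7 * k%:R ^+ 2 * (1 - Q%:R^-1) ^+ s))).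
  apply: le_trans le; apply: Pr_le => // f /andP[-> /exists_inP[x]].
  by have := drop_take1 Eo; rewrite szk => ->; rewrite mem_seq1 => /eqP->.
by apply: ler_wpM2l => //; exact: decay.
Qed.

Lemma light_prob : Pr (light F g) = (G%:R^-1) ^+ L.
Proof.
have [uo So FK cF hF] := st.
have gN : (g <= N)%N.
  rewrite Ng leq_pmull //; apply: leq_trans GL; by rewrite muln_gt0.
rewrite (Pr_rect R N0 F (fun _ => [pred v : 'I_N | (v < g)%N])).
rewrite card_ord_lt // prodr_const cF; congr (_ ^+ _).
have N1 : N%:R != 0 :> R by rewrite pnatr_eq0 -lt0n.
move: N1; rewrite Ng natrM mulf_eq0 negb_or => /andP[G1 g1].
by field; rewrite G1 g1.
Qed.

End Fixed.

Lemma all_locations (M L Q G g c : nat) (C : R) (o : 'I_M -> seq V) (F : 'I_M -> {set {set V}}) :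
  (0 < M)%N -> (forall i, group_start L (F i) (o i)) -> (forall i, size (o i) = #|V|) ->
  (forall i j, i != j -> [disjoint F i & F j]) ->
  (20 <= Q)%N -> N = (G * g)%N -> (Q * L ^ 2 <= G)%N -> 0 <= C -> (150 <= c)%N -> (Q <= c)%N ->
  (c ^ 10 <= L)%N -> (100 * L.+1 <= G)%N -> (Q %| N)%N ->
  (forall k, (0 < k < #|V|)%N -> (20 * k %| N)%N /\ (k ^ 7 %| N)%N) ->
  (forall k s : nat, (0 < k)%N -> (k <= 1024 * s ^ 10)%N ->
    7 * k%:R ^+ 2 * (1 - Q%:R^-1) ^+ s <= C / k%:R ^+ 2) ->
  Pr (fun f => [forall i, light (F i) g f ==> bad_later L (o i) Q f])
   <= 4 / (M%:R * G%:R^-1 ^+ L) + 2 * (C / L%:R).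
Proof.
move=> M0 st so dis Q20 Ng GQ C0 c150 cQ cL GL NQ Nk decay.
have L0 : (0 < L)%N by apply: leq_trans cL; rewrite expn_gt0 (leq_trans _ c150).
have G0 : (0 < G)%N by apply: leq_trans GL.
have lp i := light_prob (st i) Ng GL.
have := @second_moment R {set V} N N0 'I_M (fun i => light (F i) g) (fun i => bad_later L (o i) Q)
  (G%:R^-1 ^+ L) (C / L%:R); rewrite card_ord; apply => //.
- by rewrite exprn_gt0 // invr_gt0 ltr0n.
- by rewrite divr_ge0.
- move=> i j ij; rewrite (@Pr_indep _ _ _ N0 (F i) (F j)) ?dis // ?lp ?expr2 //; exact: light_dep.
- move=> i; rewrite -(lp i); apply: (bad_later_prob (st i) L0 Q20 Ng C0 c150 cQ cL GL NQ _ decay).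
  by rewrite so.
Qed.

End Group.

(** * Disjoint starting groups in a connected graph *)

Section Locations.
Import mathcomp.boot.fintype mathcomp.boot.finset Pilot.Defs.
Local Open Scope set_scope.
Variables (V : finType) (H : {set {set V}}).
Implicit Types (x y z : V) (p q o s : seq V).
Hypothesis HK : H \subset cgraph V.
Hypothesis HC : forall x y, conn H x y.

Definition partial_order o :=
  uniq o /\ forall p x q, o = p ++ x :: q -> p != [::] -> exists2 y, y \in p & adj H x y.

Lemma extend_order p : p != [::] -> partial_order p ->
  exists r, search_order H (p ++ r).
Proof.
move: {2}(#|V| - size p) (leqnn (#|V| - size p)) => n.
elim: n p => [|n IH] p le p0 [up ap].
  exists [::]; rewrite cats0; split=> // x.
  have : #|p| = #|V|.
    by apply/eqP; rewrite eqn_leq max_card (card_uniqP up) -subn_eq0 -leqn0 le.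
  by move=> E; have /(subset_cardP E)/(_ x) := subset_predT (mem p); rewrite inE => ->.
case: (boolP [forall x, x \in p]) => [/forallP h|/forallPn[z zp]].
  by exists [::]; rewrite cats0; split.
have [y0 y0p] : exists y, y \in p by case: (p) p0 => // y p' _; exists y; rewrite mem_head.
have y0P : y0 \in [set x in p] by rewrite inE.
have zP : z \notin [set x in p] by rewrite inE.
have [u [v [uP vP a]]] := cut_edge (HC y0 z) y0P zP; rewrite !inE in uP vP.
have [|//||r hr] := IH (rcons p v).
- by rewrite size_rcons leq_subLR addSnnS -leq_subLR.
- by case: (p).
- split; first by rewrite rcons_uniq vP.
  move=> p1 x q E p10; case: (lastP q) E => [|q' w].
    rewrite cats1 => /rcons_inj[<- <-]; exists u => //; by rewrite adjC.
  by rewrite -rcons_cons -rcons_cat => /rcons_inj[E _]; apply: ap E p10.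
by exists (v :: r); rewrite -cat_rcons.
Qed.

Section Blocks.
Variables (E : nat -> {set V}) (B M K L : nat).
Hypothesis injE : forall a b, a < B -> b < B -> E a = E b -> a = b.
Hypothesis LK : L <= K.
Hypothesis MK : M * K <= B.

Definition block (i : nat) : {set {set V}} := [set E (i * K + j) | j : 'I_L].

Let lt_B i (j : 'I_L) : i < M -> i * K + j < B.
Proof.
move=> iM; apply: leq_trans MK; apply: (@leq_trans (i * K + K)).
  by rewrite ltn_add2l; apply: leq_trans LK.
by rewrite addnC -mulSn leq_mul2r iM orbT.
Qed.

Lemma card_block i : i < M -> #|block i| = L.
Proof.
move=> iM; rewrite card_imset ?card_ord // => j j' /injE h.
by apply/val_inj/eqP; rewrite -(eqn_add2l (i * K)); apply/eqP; apply: h; exact: lt_B.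
Qed.

Lemma block_disj i i' : i < M -> i' < M -> i != i' -> [disjoint block i & block i'].
Proof.
move=> iM iM' ne; apply/pred0P=> e /=; apply/negbTE/negP.
move=> /andP[/imsetP[j _ ->] /imsetP[j' _ h]]; have := injE (lt_B j iM) (lt_B j' iM') h.
have jK : j < K by apply: leq_trans LK.
have jK' : j' < K by apply: leq_trans LK.
have K0 : 0 < K by exact: leq_ltn_trans jK.
move=> h'; case/eqP: ne; have := congr1 (divn^~ K) h'.
by rewrite !divnMDl // !divn_small // !addn0.
Qed.

End Blocks.

(** If all degrees are below [D], a ball of radius [r] has at most [D ^ r] vertices; if moreover all
    simple paths were shorter than [r], this ball would contain every vertex. *)
Lemma star_or_path D r : D ^ r < #|V| ->
  (exists x, D <= #|[set y | adj H x y]|) \/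
  (exists x s, [/\ path (adj H) x s, uniq (x :: s) & r <= size s]).
Proof.
move=> big; case: (pselect (exists x, D <= #|[set y | adj H x y]|)) => [|nd]; first by left.
right; apply: contrapT => np.
have [x0 _] : exists x : V, x \in V by apply/card_gt0P; exact: leq_ltn_trans big.
pose ball k := iter k (fun S : {set V} => \bigcup_(y in S) (y |: [set z | adj H y z])) [set x0].
have deg y : #|y |: [set z | adj H y z]| <= D.
  apply: (@leq_trans #|[set z | adj H y z]|.+1).
    by rewrite cardsU1; case: (_ \notin _).
  by rewrite ltnNge; apply/negP=> h; apply: nd; exists y.
have cb k : #|ball k| <= D ^ k.
  elim: k => [|k IH]; first by rewrite cards1.
  rewrite /= -/(ball k) expnS mulnC; apply: leq_trans (_ : #|ball k| * D <= _); last by rewrite leq_mul2r IH orbT.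
  rewrite -sum_nat_const.
  apply: (@leq_trans (\sum_(y in ball k) #|y |: [set z | adj H y z]|)); last by apply: leq_sum => y _; exact: deg.
  elim/big_rec2: _ => [|y n X yB IH']; first by rewrite cards0.
  by apply: leq_trans (leq_of_leqif (leq_card_setU _ _)) _; rewrite leq_add2l.
have sb k : ball k \subset ball k.+1.
  by apply/subsetP=> y yB; apply/bigcupP; exists y => //; exact: setU11.
have inb s : path (adj H) x0 s -> last x0 s \in ball (size s).
  elim/last_ind: s => [|s y IH]; first by rewrite inE.
  rewrite rcons_path last_rcons size_rcons => /andP[/IH h a].
  by apply/bigcupP; exists (last x0 s) => //; rewrite !inE a orbT.
have mono k j : ball k \subset ball (k + j).
  elim: j => [|j IH]; first by rewrite addn0.
  by rewrite addnS; apply: subset_trans IH (sb _).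
have all y : y \in ball r.
  have /connectP[s ps ->] := HC x0 y; case/shortenP: ps => s' ps' us' _.
  have sr : size s' < r.
    by rewrite ltnNge; apply/negP=> h; apply: np; exists x0, s'; split.
  by have := subsetP (mono (size s') (r - size s')) _ (inb _ ps'); rewrite subnKC // ltnW.
move: big; rewrite ltnNge => /negP; apply; apply: leq_trans (cb r).
by rewrite -cardsT; apply: subset_leq_card; apply/subsetP=> y _.
Qed.

Lemma group_startP L (F : {set {set V}}) g r : uniq (g ++ r) -> size g = L.+1 -> F \subset EK [set x in g] -> #|F| = L ->
  (forall p x q, g = p ++ x :: q -> p != [::] -> exists2 y, y \in p & [set x; y] \in F) ->
  group_start L F (g ++ r).
Proof.
move=> u sg FK cF hF; split=> //.
- by rewrite size_cat sg leq_addr.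
- by rewrite take_size_cat.
- move=> p x q E p0 sp.
  have sl : size p < size g by rewrite sg.
  apply: (hF p x (drop (size p).+1 g)) => //.
  have <- : take (size p) (g ++ r) = p by rewrite E take_size_cat.
  rewrite takel_cat ?(ltnW sl) //.
  have -> : x = nth x g (size p).
    by have := congr1 (fun t => nth x t (size p)) E; rewrite /= nth_cat sl nth_cat ltnn subnn /= => ->.
  by rewrite size_takel ?(ltnW sl) // -drop_nth // cat_take_drop.
Qed.

(** At a vertex of large degree the groups are stars sharing this centre; on a long path they are
    successive segments. Only their edge sets have to be disjoint. *)
Lemma locations M L : (M * L.+1) ^ (M * L.+1) < #|V| ->
  exists (o : 'I_M -> seq V) (F : 'I_M -> {set {set V}}),
    [/\ forall i, search_order H (o i), forall i, group_start L (F i) (o i),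
        forall i, size (o i) = #|V| & forall i j, i != j -> [disjoint F i & F j]].
Proof.
move=> big; set K := L.+1 in big.
suff [E [g [injE gP]]] : exists (E : nat -> {set V}) (g : 'I_M -> seq V),
   (forall a b, a < M * K -> b < M * K -> E a = E b -> a = b) /\
   forall i : 'I_M, [/\ partial_order (g i), size (g i) = L.+1, block E K L i \subset EK [set x in g i] &
     forall p x q, g i = p ++ x :: q -> p != [::] -> exists2 y, y \in p & [set x; y] \in block E K L i].
  have ext (i : 'I_M) : exists r, search_order H (g i ++ r).
    have [po sz _ _] := gP i; apply: extend_order => //; by case: (g i) sz.
  have [r hr] := choice ext.
  exists (fun i => g i ++ r i), (fun i : 'I_M => block E K L i); split=> //.
  - move=> i; have [po sz bE hb] := gP i; apply: group_startP => //.
      by have [] := hr i.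
    by apply: (card_block injE) => //; exact: ltn_ord.
  - move=> i; have [u al _] := hr i; rewrite -(card_uniqP u) -cardsT.
    by apply: eq_card => x; rewrite inE al.
  - by move=> i j ij; apply: (block_disj injE) => //; exact: ltn_ord.
have [[c hc]|[x [s [ps us ss]]]] := star_or_path big.
  pose nb := enum [set y | adj H c y].
  have unb : uniq nb by exact: enum_uniq.
  have snb : M * K <= size nb by rewrite -cardE.
  have nbP a : a < M * K -> adj H c (nth c nb a).
    move=> aM; have : nth c nb a \in nb by rewrite mem_nth // (leq_trans aM).
    by rewrite mem_enum inE.
  pose E a := [set c; nth c nb a].
  exists E, (fun i : 'I_M => c :: mkseq (fun j => nth c nb (i * K + j)) L); split.
    move=> a b aM bM E1; have := nbP a aM; have := nbP b bM => hb /(adj_neq HK) na.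
    have : nth c nb a \in E b by rewrite -E1 !inE eqxx orbT.
    rewrite !inE eq_sym (negbTE na) /= nth_uniq ?(leq_trans aM) ?(leq_trans bM) // => /eqP //.
  move=> i; have lt j : j < L -> i * K + j < M * K.
    move=> jL; apply: (@leq_trans (i * K + K)); first by rewrite ltn_add2l ltnW // ltnS ltnW.
    by rewrite addnC -mulSn leq_mul2r ltn_ord orbT.
  have hE p y q : c :: mkseq (fun j => nth c nb (i * K + j)) L = p ++ y :: q -> p != [::] ->
     exists j, [/\ j < L, y = nth c nb (i * K + j) & c \in p].
    case: p => // c' p /= [<- E1] _; exists (size p).
    have sp : size p < L by have := congr1 size E1; rewrite size_mkseq size_cat /=; lia.
    split=> //; last by rewrite mem_head.
    by have := congr1 (fun t => nth c t (size p)) E1; rewrite nth_mkseq // nth_cat ltnn subnn /= => <-.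
  split.
  - split.
      rewrite /=; apply/andP; split; last first.
        apply/mkseq_uniqP => j j'; rewrite !inE => jL jL' /eqP; rewrite nth_uniq ?(leq_trans (lt _ _)) //.
        by rewrite eqn_add2l => /eqP.
      apply/negP=> /mapP[j]; rewrite mem_iota /= => jL E1.
      by have := adj_neq HK (nbP _ (lt j jL)); rewrite -E1 eqxx.
    move=> p y q E1 p0; have [j [jL -> cp]] := hE p y q E1 p0; exists c => //.
    by rewrite adjC; apply: nbP; exact: lt.
  - by rewrite /= size_mkseq.
  - apply/subsetP=> e /imsetP[j _ ->]; rewrite inE edge2 (adj_neq HK (nbP _ (lt j (ltn_ord j)))).
    rewrite sub2 !inE eqxx /=; apply/orP; right; apply/mapP; exists (val j) => //.
    by rewrite mem_iota /=.
  - move=> p y q E1 p0; have [j [jL -> cp]] := hE p y q E1 p0; exists c => //.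
    by apply/imsetP; exists (Ordinal jL) => //; rewrite setUC.
pose P := x :: s; pose E a := [set nth x P a; nth x P a.+1].
have sP a : a < M * K -> a.+1 < size P by rewrite /= ltnS => h; exact: leq_trans ss.
have aP a : a < M * K -> adj H (nth x P a) (nth x P a.+1).
  by move=> h; apply: (pathP x ps); exact: leq_trans ss.
exists E, (fun i : 'I_M => mkseq (fun j => nth x P (i * K + j)) L.+1); split.
  move=> a b aM bM E1.
  have sa := sP a aM; have sb := sP b bM.
  have : nth x P a \in E b by rewrite -E1 !inE eqxx.
  have : nth x P b \in E a by rewrite E1 !inE eqxx.
  rewrite !inE !nth_uniq ?(ltnW sa) ?(ltnW sb) //.
  by move=> /orP[/eqP//|/eqP h1] /orP[/eqP//|/eqP h2]; move: h1 h2; lia.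
move=> i; have lt j : j <= L -> i * K + j < M * K.
  move=> jL; apply: (@leq_trans (i * K + K)); first by rewrite ltn_add2l ltnS.
  by rewrite addnC -mulSn leq_mul2r ltn_ord orbT.
have hE p y q : mkseq (fun j => nth x P (i * K + j)) L.+1 = p ++ y :: q -> p != [::] ->
     exists j, [/\ j < L, y = nth x P (i * K + j).+1 & nth x P (i * K + j) \in p].
  move=> E1 p0; have sp : size p <= L.
    by have := congr1 size E1; rewrite size_mkseq size_cat /=; lia.
  have p1 : 0 < size p by case: (p) p0.
  exists (size p).-1; split; first by rewrite prednK.
    have := congr1 (fun t => nth x t (size p)) E1.
    by rewrite nth_mkseq // nth_cat ltnn subnn /= => <-; rewrite -[in LHS](prednK p1) addnS.
  have lp : (size p).-1 < size p by rewrite prednK.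
  have := congr1 (fun t => nth x t (size p).-1) E1.
  by rewrite nth_mkseq ?nth_cat ?lp => [->|]; rewrite ?mem_nth // ltnS (leq_trans (leq_pred _)).
split.
- split.
    apply/mkseq_uniqP => j j'; rewrite !inE !ltnS => jL jL' /eqP.
    by rewrite nth_uniq ?(ltnW (sP _ (lt _ _))) // eqn_add2l => /eqP.
  move=> p y q E1 p0; have [j [jL -> jp]] := hE p y q E1 p0; exists (nth x P (i * K + j)) => //.
  by rewrite adjC; apply: aP; apply: lt; exact: ltnW.
- by rewrite size_mkseq.
- apply/subsetP=> e /imsetP[j _ ->]; have jL := ltn_ord j.
  rewrite inE edge2 (adj_neq HK (aP _ (lt j (ltnW jL)))) sub2 !in_set.
  rewrite /mkseq andTb; apply/andP; split; apply/mapP; [exists (val j)|exists (val j).+1]; rewrite ?mem_iota ?addnS //.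
  by rewrite andTb add0n ltnS ltnW.
- move=> p y q E1 p0; have [j [jL -> jp]] := hE p y q E1 p0; exists (nth x P (i * K + j)) => //.
  by apply/imsetP; exists (Ordinal jL) => //; rewrite setUC.
Qed.

End Locations.

(** * Rounding the weights *)

Section Measure.
Local Open Scope classical_set_scope.
Local Open Scope ring_scope.

Lemma uniform_itv (R : realType) (a b : R) : 0 <= a -> a <= b -> b <= 1 ->
  uniform_prob (@ltr01 R) `[a, b[ = (b - a)%:E.
Proof.
move=> a0 ab b1; rewrite /uniform_prob integral_uniform_pdf setIidl; last first.
  move=> x /=; rewrite !in_itv /= => /andP[ax xb].
  by rewrite (le_trans a0 ax) (le_trans (ltW xb) b1).
rewrite (eq_integral (fun=> 1%:E)); last first.
  move=> x; rewrite inE /= in_itv /= => /andP[ax xb].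
  by rewrite /uniform_pdf (le_trans a0 ax) (le_trans (ltW xb) b1) /= subr0 invr1.
rewrite integral_cst //= lebesgue_measure_itv /= lte_fin mul1e.
by case: ltP => // ba; rewrite (_ : a = b) ?subrr //; apply/eqP; rewrite eq_le ab ba.
Qed.

Lemma finite_boole (R : realType) (d : measure_display) (T : measurableType d) (P : probability T R)
  (I : finType) (Q : pred I) (F : I -> set T) : (forall i, measurable (F i)) ->
  (P (\big[setU/set0]_(i | Q i) F i) <= \sum_(i | Q i) P (F i))%E.
Proof.
move=> mF; suff [] : measurable (\big[setU/set0]_(i | Q i) F i) /\
  (P (\big[setU/set0]_(i | Q i) F i) <= \sum_(i | Q i) P (F i))%E by [].
elim/big_rec2: _ => [|i y X Qi [mX le]]; first by split => //; rewrite measure0.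
split; first exact: measurableU.
by apply: le_trans (measureU2 _ _ _) _ => //; rewrite leeD2l.
Qed.

End Measure.

(** * Comparison with the finite probability space *)

Section Transfer.
Import mathcomp.boot.fintype mathcomp.boot.finset Pilot.Defs.
Local Open Scope set_scope.
Local Open Scope classical_set_scope.
Local Open Scope ring_scope.
Variables (R : realType) (d : measure_display) (T : measurableType d) (P : probability T R).
Variables (V : finType) (X : {set V} -> {RV P >-> R}) (N : nat).
Hypothesis N0 : (0 < N)%N.
Hypothesis indep : mutually_independent (cgraph V) X.
Hypothesis unif : forall e, e \in cgraph V -> uniform01 (X e).
Local Notation Om := {ffun {set V} -> 'I_N}.
Local Notation K := (cgraph V).
Local Notation Pr := (@Pr R {set V} N).

Definition cell (v : nat) : set R := `[v%:R / N%:R, v.+1%:R / N%:R[.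

Lemma cell_prob e (v : 'I_N) : e \in K -> P (X e @^-1` cell v) = (N%:R^-1)%:E.
Proof.
move=> eK; have NR : 0 < N%:R :> R by rewrite ltr0n.
have := unif eK (measurable_itv `[v%:R / N%:R, v.+1%:R / N%:R[ : measurable (cell v)).
rewrite uniform_itv; first last.
- by rewrite ler_pdivrMr // mul1r ler_nat.
- by rewrite ler_pM2r ?invr_gt0 // ler_nat.
- by rewrite divr_ge0.
by rewrite -mulrBl -natr1 addrAC subrr add0r mul1r.
Qed.

Definition cells (b : Om) : set T := \bigcap_(e in [set` K]) (X e @^-1` cell (b e)).
Definition in_unit : set T := \bigcap_(e in [set` K]) (X e @^-1` `[0, 1[).

Lemma cells_measurable b : measurable (cells b).
Proof.
apply: fin_bigcap_measurable; first exact: finite_finset.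
by move=> e _; apply: measurable_funPTI; exact: measurable_itv.
Qed.

Lemma in_unit_measurable : measurable in_unit.
Proof.
apply: fin_bigcap_measurable; first exact: finite_finset.
by move=> e _; apply: measurable_funPTI; exact: measurable_itv.
Qed.

Lemma cells_prob b : P (cells b) = ((N%:R^-1) ^+ #|K|)%:E.
Proof.
rewrite /cells indep // => [|e]; last exact: measurable_itv.
rewrite (eq_bigr (fun=> (N%:R^-1)%:E)) => [|e eK]; last exact: cell_prob.
by rewrite -(big_morph EFin EFinM erefl) prodr_const.
Qed.

Lemma in_unit_prob : P in_unit = 1%E.
Proof.
rewrite /in_unit indep //.
rewrite big1 // => e eK; have := unif eK (measurable_itv `[0, 1[ : measurable (`[0, 1[ : set R)).
by rewrite uniform_itv ?subr0.
Qed.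

Lemma in_unit_cells t : in_unit t -> exists b : Om, cells b t /\ forall e, e \notin K -> b e = Ordinal N0.
Proof.
move=> ht; have NR : 0 < N%:R :> R by rewrite ltr0n.
have ex e : exists v : 'I_N, (e \in K -> cell v (X e t)) /\ (e \notin K -> v = Ordinal N0).
  case: (boolP (e \in K)) => eK; last by exists (Ordinal N0).
  have := ht e eK; rewrite /= in_itv /= => /andP[x0 x1].
  have tr := truncn_itv (mulr_ge0 (ltW NR) x0).
  have lt : (Num.truncn (N%:R * X e t) < N)%N.
    rewrite -(ltr_nat R); case/andP: tr => tr _; apply: (le_lt_trans tr).
    by rewrite -[ltRHS]mulr1 ltr_pM2l.
  exists (Ordinal lt); split=> // _; rewrite /cell /= in_itv /=; case/andP: tr => t1 t2.
  by rewrite ler_pdivrMr // ltr_pdivlMr // !(mulrC (X e t)) t1 t2.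
have [b hb] := choice ex; exists [ffun e => b e]; split.
  by move=> e eK /=; rewrite ffunE; exact: (hb e).1.
by move=> e eK; rewrite ffunE; exact: (hb e).2.
Qed.

(** Up to a null set every outcome lies in a cell, and [Good] contains the cells where [A] fails;
    the probabilities of the remaining cells are added up. [z] keeps one function per cell, with
    value 0 off the edges, so that no cell is counted several times. *)
Lemma transfer (A : pred Om) (Good : set T) : measurable Good -> dep K A ->
  (forall t (b : Om), (forall e, e \in K -> (b e)%:R / N%:R <= X e t < (b e).+1%:R / N%:R) ->
     ~~ A b -> Good t) ->
  (P (~` Good) <= (Pr A)%:E)%E.
Proof.
move=> mG dA h.
pose z (b : Om) := [forall e, (e \notin K) ==> (b e == Ordinal N0)].
pose U := \big[classical_sets.setU/classical_sets.set0]_(b : Om | A b && z b) cells b.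
have mU : measurable U by apply: bigsetU_measurable => b _; exact: cells_measurable.
have sub : ~` Good `<=` ~` in_unit `|` U.
  move=> t ngt; case: (pselect (in_unit t)) => ut; last by left.
  right; have [b [cb zb]] := in_unit_cells ut.
  have zb' : z b by apply/forallP=> e; apply/implyP=> /zb ->.
  have Ab : A b.
    apply: contrapT => /negP nA; apply: ngt; apply: (h t b) => //.
  rewrite /U (bigD1 b) /=; first by left.
  by rewrite Ab.
have P1 : (P (~` Good) <= P (~` in_unit) + P U)%E.
  apply: le_trans (measureU2 _ _ _); rewrite ?le_measure // ?inE //.
  - by apply/mem_set; exact: measurableC.
  - by apply/mem_set; apply: measurableU => //; apply: measurableC; exact: in_unit_measurable.
  - by apply: measurableC; exact: in_unit_measurable.
apply: (le_trans P1); rewrite probability_setC ?in_unit_prob ?subee // ?add0e; last exact: in_unit_measurable.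
apply: le_trans (finite_boole _ _ cells_measurable) _.
rewrite (eq_bigr (fun=> ((N%:R^-1) ^+ #|K|)%:E)) => [|b _]; last exact: cells_prob.
rewrite -(big_morph EFin EFinD erefl) lee_fin.
have NR : N%:R != 0 :> R by rewrite pnatr_eq0 -lt0n.
pose proj (f : Om) : Om := [ffun e => if e \in K then f e else Ordinal N0].
rewrite (Pr_partition R proj) [leRHS](bigID (fun b => A b && z b)) /= -[leLHS]addr0.
apply: lerD; last by apply: sumr_ge0 => b _; exact: Pr_ge0.
apply: ler_sum => b /andP[Ab /forallP zb].
have -> : N%:R^-1 ^+ #|K| = Pr (fun f => [forall e in K, f e == b e]).
  rewrite (Pr_rect R N0 K (fun e => [pred v | v == b e])) -prodr_const.
  by apply: eq_bigr => e _; rewrite card1 div1r.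
apply: Pr_le => // f /forall_inP hf; apply/andP; split.
  by rewrite (dA f b) // => e eK; apply/eqP; exact: hf.
apply/eqP/ffunP=> e; rewrite ffunE; case: ifP => eK; first by apply/eqP; exact: hf.
by have := zb e; rewrite eK /= => /eqP.
Qed.

End Transfer.

(** * The upper bound *)

Section Sequences.
Import mathcomp.boot.fintype mathcomp.boot.finset Pilot.Defs.
Local Open Scope set_scope.
Local Open Scope ring_scope.
Variables (R : realType) (V : finType) (w : {set V} -> R).
Hypothesis inj : {in cgraph V &, injective w}.

Lemma seq_of_reach c A H H' : 0 <= c -> reach w c A H H' ->
  exists Ss, final_subgraph (cgraph V) w H Ss = H' /\ seq_weight (cgraph V) w H Ss <= c.
Proof.
move=> c0; elim=> [G|G P G' PA cn wt _ [Ss [fin wS]]].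
  by exists [::]; split=> //; rewrite /seq_weight big_ord0.
have st : phi (cgraph V) w G P = step w G P by rewrite /phi cn mst_kr.
exists (P :: Ss); split.
  by rewrite -fin /final_subgraph /subgraph_seq /= !take_size st.
rewrite /seq_weight big_ord_recl /= ge_max; apply/andP; split.
  by rewrite /subgraph_seq take0.
by move: wS; rewrite /seq_weight /subgraph_seq /= st.
Qed.

End Sequences.

(** * Ties, and events determined by the levels of edges *)

Section Deps.
Import mathcomp.boot.fintype mathcomp.boot.finset Pilot.Defs.
Local Open Scope set_scope.
Variables (V : finType) (N : nat).
Local Notation Om := {ffun {set V} -> 'I_N}.
Local Notation K := (cgraph V).
Implicit Types (f g : Om) (S : {set V}) (v : V) (o : seq V).

Definition tie f := [exists e in K, exists e' in K, (e != e') && (f e == f e')].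

Lemma tie_inj f : ~~ tie f -> {in K &, injective (wt f)}.
Proof.
move=> nt e e' eK eK' /val_inj E; apply: contrapT => /eqP ne; case/negP: nt.
by apply/exists_inP; exists e => //; apply/exists_inP; exists e' => //; rewrite ne E eqxx.
Qed.

Lemma tie_dep : dep K tie.
Proof.
move=> f g h; apply: eq_existsb => e; apply: andb_id2l => eK.
by apply: eq_existsb => e'; apply: andb_id2l => eK'; rewrite !h.
Qed.

(** [v \notin S] ensures that every pair [[set v; y]] with [y] in [S] is an edge. *)
Lemma stage_ok_ext f g Q S v : v \notin S -> (forall e, e \in K -> f e = g e) ->
  stage_ok f Q S v -> stage_ok g Q S v.
Proof.
move=> vS h [D1 D2 D3].
have kE : kr (wt g) S = kr (wt f) S by apply: kr_ext => e e' eK eK'; rewrite /wt !h.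
have hE (J : {set {set V}}) : J \subset K -> height g J = height f J.
  by move=> JK; apply: eq_bigr => e eJ; rewrite h // (subsetP JK).
have krK (J : {set {set V}}) : J \subset kr (wt f) S -> J \subset K.
  by move=> s; exact: subset_trans s (kr_cgraph _ _).
split; rewrite kE.
- by move=> x y xS yS; have [J [JM cJ hJ]] := D1 x y xS yS; exists J; split=> //; rewrite hE ?krK.
- by move=> e eM; rewrite -h ?D2 // (subsetP (kr_cgraph _ _) _ eM).
- move=> z zS; have [y [J [yS wy JM cJ hJ]]] := D3 z zS; exists y, J; split=> //.
    by rewrite -h // edge2; apply: contraNneq vS => ->.
  by rewrite hE ?krK.
Qed.

Lemma bad_stage_dep S v Q : v \notin S -> dep K (bad_stage (N := N) S v Q).
Proof.
move=> vS f g h.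
have one f1 g1 : (forall e, e \in K -> f1 e = g1 e) -> bad_stage S v Q f1 -> bad_stage S v Q g1.
  move=> h1 /asboolP[inj nok]; apply/asboolP; split.
    by move=> e e' eK eK'; rewrite /wt -!h1 //; exact: inj.
  by move=> ok; apply: nok; apply: stage_ok_ext ok => // e /h1.
by apply/idP/idP; apply: one => // e /h.
Qed.

Lemma bad_later_dep L o Q : uniq o -> dep K (bad_later (N := N) L o Q).
Proof.
move=> uo f g h; apply: eq_existsb => k; apply: andb_id2l => _.
apply: eq_existsb => x; apply: andb_id2l => xk.
apply: bad_stage_dep h; rewrite inE; apply/negP=> xk'.
have := take_uniq k.+1 uo; rewrite -(cat_take_drop k (take k.+1 o)) cat_uniq => /and3P[_ /hasPn/(_ x xk)].
by rewrite take_takel // /= xk'.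
Qed.

Local Open Scope ring_scope.

Lemma tie_prob (R : realType) : (0 < N)%N -> Pr R tie <= (#|K| ^ 2)%N%:R / N%:R.
Proof.
move=> N0; have NR : N%:R != 0 :> R by rewrite pnatr_eq0 -lt0n.
have one (e e' : {set V}) : e != e' -> Pr R (fun f : Om => f e == f e') <= N%:R^-1.
  move=> ne; rewrite (Pr_partition R (fun f : Om => f e)).
  apply: (@le_trans _ _ (\sum_(v : 'I_N) N%:R^-1 ^+ 2)); last first.
    by rewrite sumr_const card_ord -[_ *+ _]mulr_natl expr2 mulrA mulfV // mul1r.
  apply: ler_sum => v _.
  have -> : N%:R^-1 ^+ 2 = Pr R (fun f : Om => [forall h in [set e; e'], f h == v]).
    rewrite (Pr_rect R N0 [set e; e'] (fun _ => [pred u | u == v])).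
    by rewrite prodr_const cards2 ne card1 div1r.
  apply: Pr_le => // f /andP[/eqP E /eqP Ev]; apply/forall_inP=> h.
  by rewrite !inE => /orP[]/eqP->; rewrite -?E Ev.
pose E (p : {set V} * {set V}) (f : Om) := (p.1 != p.2) && (f p.1 == f p.2).
apply: (@le_trans _ _ (\sum_(p in setX K K) Pr R (E p))).
  apply: Pr_union => // f /exists_inP[e eK /exists_inP[e' eK' h]]; exists (e, e') => //.
  by rewrite inE /= eK.
apply: (@le_trans _ _ (\sum_(p in setX K K) N%:R^-1)); last first.
  by rewrite sumr_const cardsX mulnn -[_ *+ _]mulr_natl.
apply: ler_sum => -[e e'] _; rewrite /E /=; case: eqVneq => [_|ne].
  by rewrite Pr_false // invr_ge0.
by apply: le_trans (one e e' ne); apply: Pr_le => // f.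
Qed.

End Deps.

Section CellIso.
Import mathcomp.boot.fintype mathcomp.boot.finset Pilot.Defs.
Local Open Scope set_scope.
Local Open Scope ring_scope.
Variables (R : realType) (V : finType) (N : nat) (w : {set V} -> R) (f : {ffun {set V} -> 'I_N}).
Hypothesis N0 : (0 < N)%N.
Hypothesis hw : forall e, e \in cgraph V -> (f e)%:R / N%:R <= w e < (f e).+1%:R / N%:R.
Hypothesis inj : {in cgraph V &, injective (wt f)}.

(** Without ties, different edges have their weights in different cells, and cells are ordered by
    their levels. *)
Lemma cell_iso e e' : e \in cgraph V -> e' \in cgraph V -> (wt f e < wt f e')%O = (w e < w e').
Proof.
move=> eK eK'; have [a1 a2] := andP (hw eK); have [b1 b2] := andP (hw eK').
have NR : 0 < N%:R^-1 :> R by rewrite invr_gt0 ltr0n.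
have lt (u v : {set V}) : u \in cgraph V -> v \in cgraph V -> (f u < f v)%N -> w u < w v.
  move=> uK vK h; have [_ h1] := andP (hw uK); have [h2 _] := andP (hw vK).
  by apply: lt_le_trans h1 (le_trans _ h2); rewrite ler_pM2r // ler_nat.
apply/idP/idP => [h|h]; first exact: lt.
rewrite ltNge; apply/negP; rewrite le_eqVlt => /orP[/eqP E|h'].
  by move: h; rewrite (inj eK' eK E) ltxx.
by have := lt _ _ eK' eK h'; rewrite ltNge (ltW h).
Qed.

Lemma cell_inj : {in cgraph V &, injective w}.
Proof.
move=> e e' eK eK' E; apply: contrapT => /eqP ne.
have : wt f e != wt f e' by apply: contra ne => /eqP/(inj eK eK') ->.
by rewrite neq_lt !cell_iso // E ltxx.
Qed.

Lemma cell_bounds e : e \in cgraph V -> [/\ 0 <= w e, w e <= 1 & w e <= (f e).+1%:R / N%:R].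
Proof.
move=> eK; have [a1 a2] := andP (hw eK); have NR : 0 < N%:R :> R by rewrite ltr0n.
split; first by apply: le_trans a1; rewrite divr_ge0.
  by apply: le_trans (ltW a2) _; rewrite ler_pdivrMr // mul1r ler_nat.
exact: ltW.
Qed.

End CellIso.

Section PartA.
Import mathcomp.boot.fintype mathcomp.boot.finset Pilot.Defs.
Local Open Scope set_scope.
Local Open Scope ring_scope.

Lemma natr_bound (R : realType) (x : R) : exists n : nat, x <= n%:R.
Proof. by exists (Num.truncn x).+1; apply/ltW/truncnS_gt. Qed.

Lemma good_location (R : realType) n (H : {set {set 'I_n}}) (w : {set 'I_n} -> R) N
  (f : {ffun {set 'I_n} -> 'I_N}) L F o Q G g :
  (0 < N)%N -> H \subset cgraph 'I_n -> search_order H o -> group_start L F o -> (0 < L)%N ->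
  (20 <= Q)%N -> N = (G * g)%N -> (Q * L ^ 2 <= G)%N ->
  (forall e, e \in cgraph 'I_n -> (f e)%:R / N%:R <= w e < (f e).+1%:R / N%:R) ->
  ~~ tie f -> light F g f -> ~~ bad_later L o Q f ->
  exists Ss, mst_sequence (cgraph 'I_n) w H Ss /\
    seq_weight (cgraph 'I_n) w H Ss <= 1 + Q%:R^-1 + Q%:R^-1.
Proof.
move=> N0 HK so st L0 Q20 Ng GQ hw nt lf nb.
have inj := tie_inj nt.
have winj := cell_inj N0 hw inj.
have q0 : 0 <= Q%:R^-1 :> R by rewrite invr_ge0.
have re : reach w (1 + Q%:R^-1 + Q%:R^-1) [set: 'I_n] H (kr w [set: 'I_n]).
  apply: (reach_order winj _ _ q0 HK so).
  - by move=> e eK; have [] := cell_bounds N0 hw eK.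
  - by move=> e eK; have [] := cell_bounds N0 hw eK.
  move=> p x r E p0; apply: (real_stageP N0 (f := f)) => //.
  - by move=> e e' eK eK'; apply: (cell_iso N0 hw inj).
  - by move=> e eK; have [] := cell_bounds N0 hw eK.
  - exact: leq_trans Q20.
  - have [uo _ _] := so; move: uo; rewrite E inE cat_uniq /= => /and3P[_ /norP[]] //.
  exact: (good_stages st Q20 Ng GQ inj lf nb E p0).
have [Ss [fin wS]] := seq_of_reach winj (addr_ge0 (addr_ge0 ler01 q0) q0) re.
by exists Ss; split=> //; rewrite /mst_sequence fin mst_kr.
Qed.

(** [n0] depends on [eps] and [eta] only, since the probability space and [H] change with [n].
    Passing to a measurable set [Good] that contains the event leaves measurability to a separate
    argument. *)
Theorem light_mst_sequence_prob (R : realType) (eps eta : R) : 0 < eps -> 0 < eta ->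
  exists n0 : nat, forall n, (n0 <= n)%N ->
  forall (d : measure_display) (T : measurableType d) (P : probability T R)
    (X : {set 'I_n} -> {RV P >-> R}) (H : {set {set 'I_n}}),
  mutually_independent (cgraph 'I_n) X ->
  (forall e, e \in cgraph 'I_n -> uniform01 (X e)) ->
  H \subset cgraph 'I_n -> (forall x y, conn H x y) ->
  forall Good : set T, measurable Good ->
  (forall t, (exists Ss, mst_sequence (cgraph 'I_n) (fun e => X e t) H Ss /\
     seq_weight (cgraph 'I_n) (fun e => X e t) H Ss <= 1 + eps) -> Good t) ->
  (P (~` Good)%classic <= eta%:E)%E.
Proof.
move=> eps0 eta0.
have e3 : eta / 3 + (eta / 3 + eta / 3) <= eta by lra.
(* The sets weigh at most [1 + 2/Q]. *)
have [Q [Q20 Qe]] : exists Q, (20 <= Q)%N /\ Q%:R^-1 + Q%:R^-1 <= eps.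
  have [k hk] := natr_bound (2 / eps); exists (maxn 20 k); split; first exact: leq_maxl.
  have kk : k%:R <= (maxn 20 k)%:R :> R by rewrite ler_nat leq_maxr.
  have m0 : 0 < (maxn 20 k)%:R :> R by rewrite ltr0n (leq_trans _ (leq_maxl _ _)).
  move: (le_trans hk kk); rewrite ler_pdivrMr // => h.
  rewrite -mulr2n -[_ *+ 2]mulr_natl ler_pdivrMr //; lra.
have Q0 : (0 < Q)%N by exact: leq_trans Q20.
have u01 : 0 < (Q%:R^-1 : R) <= 1 by rewrite invr_gt0 ltr0n Q0 invf_le1 ?ltr0n // ler1n.
have [C [C0 decay]] := poly_exp_decay 1024 u01.
have [c [c150 cQ]] : exists c, (150 <= c)%N /\ (Q <= c)%N.
  by exists (maxn 150 Q); rewrite leq_maxl leq_maxr.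
have [L [cL L0 hL]] : exists L, [/\ (c ^ 10 <= L)%N, (0 < L)%N & 2 * (C / L%:R) <= eta / 3].
  have [k hk] := natr_bound (6 * C / eta); exists (maxn (c ^ 10) k.+1).
  have m0 : (0 < maxn (c ^ 10) k.+1)%N by rewrite (leq_trans _ (leq_maxr _ _)).
  split=> //; first exact: leq_maxl.
  have kk : k%:R <= (maxn (c ^ 10) k.+1)%:R :> R by rewrite ler_nat (leq_trans _ (leq_maxr _ _)).
  move: (maxn _ _) m0 kk => m m0 kk; have mR : 0 < m%:R :> R by rewrite ltr0n.
  move: (le_trans hk kk); rewrite ler_pdivrMr // => h.
  rewrite mulrA ler_pdivrMr //; lra.
pose G := (Q * L ^ 2 + 100 * L.+1)%N.
have GQ : (Q * L ^ 2 <= G)%N by exact: leq_addr.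
have GL : (100 * L.+1 <= G)%N by exact: leq_addl.
have G0 : (0 < G)%N by apply: leq_trans GL; rewrite muln_gt0.
have mu0 : 0 < G%:R^-1 ^+ L :> R by rewrite exprn_gt0 // invr_gt0 ltr0n.
(* Enough groups to outweigh the small probability [G^-L] that a given one is light. *)
have [M [M0 hM]] : exists M, (0 < M)%N /\ 4 / (M%:R * G%:R^-1 ^+ L) <= eta / 3.
  have [k hk] := natr_bound (12 / (eta * G%:R^-1 ^+ L)); exists k.+1; split=> //.
  have kk : k%:R <= k.+1%:R :> R by rewrite ler_nat.
  have kR : 0 < k.+1%:R :> R by rewrite ltr0n.
  move: mu0 hk; move: (G%:R^-1 ^+ L) => mu mu0 hk; move: (le_trans hk kk).
  rewrite ler_pdivrMr ?mulr_gt0 // ler_pdivrMr ?mulr_gt0 // => h; lra.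
have [n1 hn1] := natr_bound (3 / eta).
exists (maxn n1.+1 ((M * L.+1) ^ (M * L.+1)).+1) => n; rewrite geq_max => /andP[n1n nbig].
move=> d T P X H indep unif HK HC Good mG hG.
have n0 : (0 < n)%N by exact: leq_trans n1n.
have [ff [ff0 ffk ff7]] : exists ff, [/\ (0 < ff)%N,
    (forall k, (0 < k < n)%N -> (k %| ff)%N /\ (k ^ 7 %| ff)%N) & (n ^ 7 <= ff)%N].
  exists (n`! ^ 7)%N; split; first by rewrite expn_gt0 fact_gt0.
    move=> k /andP[k0 kn]; have kf : (k %| n`!)%N by rewrite dvdn_fact // k0 ltnW.
    by split; [rewrite expnS dvdn_mulr|rewrite dvdn_exp2r].
  by rewrite leq_exp2r // fact_geq.
(* As [ff] is the seventh power of a factorial, [N] is divisible by all [20 * k] and [k ^ 7] with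
   [k < n]; being at least [n ^ 7], it also makes ties among at most [n ^ 4] pairs of edges
   unlikely. *)
pose N := (20 * (G * Q) * ff)%N.
have N0 : (0 < N)%N by rewrite !muln_gt0 G0 Q0 ff0.
have NQ : (Q %| N)%N by rewrite /N dvdn_mulr // dvdn_mull // dvdn_mull.
have [g Ng] : exists g, N = (G * g)%N by exists (20 * Q * ff)%N; rewrite /N; ring.
have Nk k : (0 < k < #|'I_n|)%N -> (20 * k %| N)%N /\ (k ^ 7 %| N)%N.
  rewrite card_ord => /ffk[k1 k7]; split; last by rewrite /N dvdn_mull.
  by rewrite /N -mulnA dvdn_mul // dvdn_mull.
have big : ((M * L.+1) ^ (M * L.+1) < #|'I_n|)%N by rewrite card_ord.
have [od [F [so st sz dis]]] := locations HK HC big.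
pose A (f : {ffun {set 'I_n} -> 'I_N}) := tie f || [forall i, light (F i) g f ==> bad_later L (od i) Q f].
have dA : dep (cgraph 'I_n) A.
  move=> f f' h; congr (_ || _); first exact: tie_dep.
  apply: eq_forallb => i; have [uo _ FK _ _] := st i; congr (_ ==> _).
    apply: light_dep => e eF; apply: h; by have /setIdP[] := subsetP FK _ eF.
  exact: bad_later_dep.
apply: le_trans (transfer N0 indep unif mG dA _) _.
  move=> t f hw; rewrite negb_or => /andP[nt /forallPn[i]]; rewrite negb_imply => /andP[lf nb].
  apply: hG; have [Ss [ms wS]] := good_location N0 HK (so i) (st i) L0 Q20 Ng GQ hw nt lf nb.
  by exists Ss; split=> //; apply: (le_trans wS); rewrite -addrA lerD2l.
rewrite lee_fin; apply: le_trans (Pr_or R N0 _ _) _.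
have loc := all_locations N0 M0 st sz dis Q20 Ng GQ C0 c150 cQ cL GL NQ Nk decay.
have tp := @tie_prob 'I_n N R N0.
have : (#|cgraph 'I_n| ^ 2)%N%:R / N%:R <= eta / 3 :> R.
  have nR : 0 < n%:R :> R by rewrite ltr0n.
  apply: (@le_trans _ _ (n%:R^-1)).
    rewrite ler_pdivrMr ?ltr0n // mulrC ler_pdivlMr // -natrM ler_nat.
    have cK : (#|cgraph 'I_n| <= n ^ 2)%N.
      rewrite /cgraph (eq_card (B := [set e : {set 'I_n} | e \subset [set: 'I_n] & #|e| == 2])); last first.
        by move=> e; rewrite !inE subsetT.
      rewrite cards_draws cardsT card_ord bin2 -mulnn.
      by apply: (@leq_trans (n * n.-1)%N); [rewrite -[leqRHS]odd_double_half -addnn addnA leq_addl|rewrite leq_mul2l leq_pred orbT].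
    apply: (@leq_trans ((n ^ 2) ^ 2 * n)%N); first by rewrite leq_mul2r leq_exp2r // cK orbT.
    rewrite -expnM -expnSr /N; apply: (@leq_trans (n ^ 7)%N); first by rewrite leq_pexp2l.
    by apply: (leq_trans ff7); rewrite leq_pmull // !muln_gt0 G0 Q0.
  have : n1%:R <= n%:R :> R by rewrite ler_nat ltnW.
  move: hn1; rewrite ler_pdivrMr // => h1 h2.
  rewrite -[leLHS]mul1r ler_pdivrMr //.
  have := ler_wpM2r (ltW eta0) h2; lra.
by move=> tn; apply: le_trans e3; apply: lerD (le_trans tp tn) (le_trans loc (lerD hM hL)).
Qed.

End PartA.

(** * The lower bound *)

Section Survive.
Import mathcomp.boot.fintype mathcomp.boot.finset Pilot.Defs.
Local Open Scope set_scope.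
Local Open Scope ring_scope.
Variables (R : realType) (V : finType) (w : {set V} -> R).
Hypothesis inj : {in cgraph V &, injective w}.
Hypothesis w_ge0 : forall e, e \in cgraph V -> 0 <= w e.
Local Notation K := (cgraph V).
Implicit Types (H : {set {set V}}) (P : {set V}) (Ss : seq {set V}).

Lemma seq_weight_cons H P Ss : seq_weight K w H (P :: Ss) =
  Num.max (weight w (induced H P)) (seq_weight K w (phi K w H P) Ss).
Proof. by rewrite /seq_weight big_ord_recl /subgraph_seq /=. Qed.

Lemma final_cons H P Ss : final_subgraph K w H (P :: Ss) = final_subgraph K w (phi K w H P) Ss.
Proof. by rewrite /final_subgraph /subgraph_seq /= !take_size. Qed.

Lemma phi_sub H P : H \subset K -> phi K w H P \subset K.
Proof.
move=> HK; rewrite /phi; case: ifP => // _; rewrite mst_kr // subUset kr_cgraph andbT.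
by apply: subset_trans HK; exact: subsetDl.
Qed.

Lemma final_sub H Ss : H \subset K -> final_subgraph K w H Ss \subset K.
Proof.
elim: Ss H => [|P Ss IH] H HK; first by rewrite /final_subgraph /subgraph_seq.
by rewrite final_cons; apply: IH; exact: phi_sub.
Qed.

Lemma heavy_survive H Ss e : H \subset K -> e \in H -> seq_weight K w H Ss < w e ->
  e \in final_subgraph K w H Ss.
Proof.
elim: Ss H => [|P Ss IH] H HK eH; first by rewrite /final_subgraph /subgraph_seq.
rewrite seq_weight_cons gt_max final_cons => /andP[lt1 lt2].
apply: IH lt2; first exact: phi_sub.
rewrite /phi; case: ifP => // _; rewrite in_setU in_setD eH andbT; apply/orP; left.
apply: contraL lt1 => ein; rewrite -leNgt /weight (bigD1 e) //= lerDl.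
apply: sumr_ge0 => g /andP[gi _]; apply: w_ge0; apply: (subsetP HK).
exact: (subsetP (induced_sub _ _) _ gi).
Qed.

End Survive.

(** * Counting edges and separated vertices *)

Section Cover.
Import mathcomp.boot.fintype mathcomp.boot.finset Pilot.Defs.
Local Open Scope set_scope.
Variables (V : finType).
Implicit Types (H M E : {set {set V}}) (x y z : V) (A B S : {set V}).

Lemma connected_card H : H \subset cgraph V -> (forall x y, conn H x y) -> (1 < #|V|)%N ->
  (#|V| <= 2 * #|H|)%N.
Proof.
move=> HK HC V1.
have cov : [set: V] \subset cover H.
  apply/subsetP=> x _; have [y yx] : exists y, y != x.
    apply: contrapT => no; have : #|V| <= #|[set x]|.
      rewrite -cardsT; apply: subset_leq_card; apply/subsetP=> y _; rewrite inE.
      by apply: contrapT => /negP ny; apply: no; exists y.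
    by rewrite cards1 leqNgt V1.
  have xx : x \in [set x] by rewrite inE.
  have yx' : y \notin [set x] by rewrite inE.
  have [u [v [/set1P-> _ a]]] := cut_edge (HC x y) xx yx'.
  by apply/bigcupP; exists [set x; v] => //; rewrite !inE eqxx.
rewrite -cardsT; apply: leq_trans (subset_leq_card cov) _.
apply: leq_trans (leq_card_cover H) _; rewrite mulnC -sum_nat_const.
by apply: leq_sum => e /(subsetP HK); rewrite inE => /eqP->.
Qed.

Definition separated H (A : {set V}) := {in A &, forall x y, conn H x y -> x = y}.

(** Removing one more edge splits a component, which contains at most one chosen vertex; an end of
    the edge on a side without it is added. *)
Lemma forest_remove M E : forest M -> E \subset M -> (0 < #|V|)%N ->
  exists A : {set V}, separated (M :\: E) A /\ #|A| = #|E|.+1.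
Proof.
move=> fM; move: {-1}(#|E|) (erefl #|E|) => n; elim: n E => [|n IH] E cE EM V0.
  have /card_gt0P[x _] := V0; exists [set x]; rewrite cards1; split=> //.
  by move=> y z /set1P-> /set1P->.
have /card_gt0P[e eE] : 0 < #|E| by rewrite cE.
have cE' : #|E :\ e| = n by move: cE; rewrite (cardsD1 e) eE => -[].
have [A [sA cA]] := IH _ cE' (subset_trans (subsetDl _ _) EM) V0.
have eM := subsetP EM _ eE.
have /edgeP[a [b [nab Ee]]] := subsetP (proj1 fM) _ eM.
have nc : ~~ conn (M :\: E) a b.
  have ab : adj M a b by rewrite /adj -Ee.
  apply: contra (proj2 fM a b ab); apply: conn_mono; rewrite -Ee.
  by apply/subsetP=> g; rewrite !inE => /andP[gE ->]; rewrite andbT; apply: contraNneq gE => ->.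
have GE : M :\: (E :\ e) = [set a; b] |: (M :\: E).
  rewrite -Ee; apply/setP=> g; rewrite !inE; case: (eqVneq g e) => [->|_] //=; by rewrite eM.
have sub : M :\: E \subset M :\: (E :\ e) by rewrite GE; exact: subsetUr.
have cab : conn (M :\: (E :\ e)) a b by rewrite GE; apply: conn1; exact: setU11.
have sA' : separated (M :\: E) A by move=> x y xA yA /(conn_mono sub); exact: sA.
have add x : x \notin A -> (forall y, y \in A -> ~~ conn (M :\: E) x y) ->
    exists A : {set V}, separated (M :\: E) A /\ #|A| = n.+2.
  move=> xA hx; exists (x |: A); split; last by rewrite cardsU1 xA cA.
  move=> y z; rewrite !in_setU1 => /orP[/eqP->|yA] /orP[/eqP->|zA] //.
  - by move=> c; have := hx z zA; rewrite c.
  - by rewrite connC => c; have := hx y yA; rewrite c.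
  - exact: sA'.
case: (pselect (exists2 r, r \in A & conn (M :\: E) a r)) => [[r rA car]|na].
  apply: (add b).
    apply/negP=> bA; case/negP: nc.
    have -> : b = r; last by [].
    apply: sA => //; rewrite connC; apply: conn_trans cab; rewrite connC; exact: conn_mono car.
  move=> y yA; apply/negP=> cby; case/negP: nc.
  have -> : conn (M :\: E) a b; last by [].
  have E1 : y = r.
    apply: sA => //; apply: (@conn_trans _ _ b); first by rewrite connC; exact: conn_mono cby.
    by rewrite connC; apply: conn_trans cab; rewrite connC; exact: conn_mono car.
  by apply: conn_trans car _; rewrite -E1 connC.
apply: (add a).
  by apply/negP=> aA; apply: na; exists a => //; exact: conn0.
by move=> y yA; apply/negP=> cy; apply: na; exists y.
Qed.

End Cover.

(** * The tree's weight as a sum over levels *)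

Section Levels.
Import mathcomp.boot.fintype mathcomp.boot.finset Pilot.Defs.
Local Open Scope set_scope.
Variables (V : finType) (N : nat) (f : {ffun {set V} -> 'I_N}).
Hypothesis inj : {in cgraph V &, injective (wt f)}.
Hypothesis V0 : (0 < #|V|)%N.
Local Notation M := (kr (wt f) [set: V]).

Definition above c := #|[set e in M | (c <= f e)%N]|.

Definition small c j := [exists J : {set V}, (#|J| == j) && (2 * #|cl f c [set: V] J| <= #|V|)%N].

Lemma half_le (a b n : nat) : (a + b <= n)%N -> (n < 2 * a)%N -> (2 * b <= n)%N.
Proof. lia. Qed.

(** Removing the tree edges of level at least [c] leaves at least [2 * j] vertices in different
    clusters. Two disjoint families of [j] of them have disjoint clusters, so one family covers at
    most half of the vertices. *)
Lemma above_small c j : (2 * j <= (above c).+1)%N -> small c j.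
Proof.
move=> h; set E := [set e in M | (c <= f e)%N] in h.
have EM : E \subset M by apply/subsetP=> e /setIdP[].
have [A [sA cA]] := forest_remove (kr_forest _ inj) EM V0.
have sl : {in A &, forall x y, conn (lo f c [set: V]) x y -> x = y}.
  move=> x y xA yA cxy; apply: sA => //.
  have dc : forall a b : nat, (a < b)%O -> (b < c)%N -> (a < c)%N by move=> a b; exact: ltn_trans.
  apply: conn_mono (kr_minimax (w := wt f) dc cxy); apply/subsetP=> e /setIP[eM].
  by rewrite in_lo => /and3P[_ _ lt]; rewrite in_setD eM andbT inE eM leqNgt lt.
have [A1 A1A c1] : exists2 B : {set V}, B \subset A & #|B| = j.
  by apply: exists_subset_card; rewrite cA (leq_trans _ h) // mul2n -addnn leq_addr.
have [A2 A2A c2] : exists2 B : {set V}, B \subset A :\: A1 & #|B| = j.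
  apply: exists_subset_card; rewrite cardsD (setIidPr A1A) c1 cA leq_subRL.
    by rewrite addnn -mul2n.
  by rewrite (leq_trans _ h) // mul2n -addnn leq_addr.
have dis : [disjoint cl f c [set: V] A1 & cl f c [set: V] A2].
  apply/pred0P=> x /=; apply/negbTE/negP=> /andP[/setIdP[_ /exists_inP[r rA cr]] /setIdP[_ /exists_inP[r' rA' cr']]].
  have := subsetP A2A _ rA'; rewrite in_setD => /andP[n1 r'A]; case/negP: n1.
  have -> // : r' = r; apply: sl => //; first exact: (subsetP A1A).
  by apply: conn_trans cr' _; rewrite connC.
have sum : (#|cl f c [set: V] A1| + #|cl f c [set: V] A2| <= #|V|)%N.
  by have := leq_card_setU (cl f c [set: V] A1) (cl f c [set: V] A2); move/leqif_geq;
    rewrite -(eqP (introT eqP (cardsUI _ _))) disjoint_setI0 // cards0 addn0 => _; exact: max_card.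
case: (leqP (2 * #|cl f c [set: V] A1|) #|V|) => h1.
  by apply/existsP; exists A1; rewrite c1 eqxx.
by apply/existsP; exists A2; rewrite c2 eqxx /=; exact: half_le sum h1.
Qed.

Lemma level_sum a s x : (minn x.+1 (s * a) <= a * \sum_(i < s) (i * a <= x))%N.
Proof.
elim: s => [|s IH]; first by rewrite mul0n minn0.
rewrite big_ord_recr /= mulnDr.
case: (leqP (s * a) x) => h /=; last first.
  rewrite muln0 addn0; apply: leq_trans IH; rewrite leq_min geq_minl /=.
  by rewrite (leq_trans (geq_minl _ _)).
rewrite muln1; apply: (@leq_trans (s * a + a)); first by rewrite mulSn addnC geq_minr.
rewrite leq_add2r; apply: leq_trans IH; rewrite leq_min leqnn andbT; exact: leqW.
Qed.

(** Summation by layers of thickness [a]: an edge is counted once for each multiple of [a] up to its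
    level. *)
Lemma height_levels a s : above (s * a) = 0 -> (height f M <= a * \sum_(i < s) above (i * a))%N.
Proof.
move=> h0; have lt e : e \in M -> (f e < s * a)%N.
  move=> eM; rewrite ltnNge; apply/negP=> h.
  have : e \in [set e in M | (s * a <= f e)%N] by apply/setIdP.
  by have /eqP := h0; rewrite /above cards_eq0 => /eqP->; rewrite inE.
apply: (@leq_trans (\sum_(e in M) a * \sum_(i < s) (i * a <= f e))).
  apply: leq_sum => e eM; apply: leq_trans (level_sum a s (f e)).
  by rewrite leq_min leqnn /= lt.
rewrite -big_distrr /= leq_mul2l exchange_big /=; apply/orP; right.
apply: leq_sum => i _; rewrite /above -sum1_card [leqRHS](eq_bigl (fun e => (e \in M) && (i * a <= f e)%N)).
  by rewrite [leqRHS]big_mkcondr /=; apply: leq_sum => e _; case: (i * a <= f e)%N.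
by move=> e; rewrite inE.
Qed.

End Levels.

Section BinBound.
Variable R : realType.
Local Open Scope ring_scope.

Lemma expR1_ge2 : 2 <= expR 1 :> R.
Proof. by apply: le_trans (expR_ge1Dx 1); lra. Qed.

Lemma fact_bound j : j%:R ^+ j <= 3 ^+ j * (j`!)%:R :> R.
Proof.
elim: j => [|j IH]; first by rewrite !expr0 fact0 mul1r.
have [->|j0] := posnP j; first by rewrite !expr1 factS fact0; lra.
have jR : 0 < j%:R :> R by rewrite ltr0n.
have h : (j.+1%:R : R) ^+ j <= 3 * j%:R ^+ j.
  have -> : j.+1%:R = (1 + j%:R^-1) * j%:R :> R by rewrite mulrDl mul1r mulVf ?gt_eqF // natr1.
  rewrite exprMn; apply: ler_wpM2r; first by rewrite exprn_ge0 // ltW.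
  apply: (le_trans _ (expR1_le3 R)).
  have -> : expR 1 = expR (j%:R^-1) ^+ j :> R by rewrite -expRM_natl mulfV // gt_eqF.
  by apply: lerXn2r; rewrite ?nnegrE ?expR_ge0 ?expR_ge1Dx // addr_ge0 // invr_ge0 ltW.
rewrite exprS factS natrM [3 ^+ _]exprS; apply: (@le_trans _ _ (j.+1%:R * (3 * (3 ^+ j * (j`!)%:R)))).
  by apply: ler_wpM2l => //; apply: (le_trans h); apply: ler_wpM2l.
by rewrite le_eqVlt; apply/orP; left; apply/eqP; ring.
Qed.

Lemma ffact_le n j : (n ^_ j <= n ^ j)%N.
Proof.
elim: j n => [|j IH] [|n] //; rewrite ffactSS expnS leq_mul2l /=.
by apply: (leq_trans (IH n)); case: j {IH} => // j; rewrite leq_exp2r.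
Qed.

(** The left side is at most [(n z)^j / j!], hence at most [(3 n z / j)^j] by [fact_bound]. *)
Lemma bin_bound n j (z : R) : 0 <= z -> (0 < j)%N -> 6 * n%:R * z <= j%:R ->
  'C(n, j)%:R * z ^+ j <= (1 / 2) ^+ j.
Proof.
move=> z0 j0 h; have jR : 0 < j%:R :> R by rewrite ltr0n.
have f0 : 0 < (j`!)%:R :> R by rewrite ltr0n fact_gt0.
have t0 : 0 < 3 ^+ j :> R by apply: exprn_gt0; lra.
rewrite -(ler_pM2r f0) mulrAC -natrM bin_ffact.
apply: (@le_trans _ _ (n%:R ^+ j * z ^+ j)).
  by apply: ler_wpM2r; [exact: exprn_ge0|rewrite -natrX ler_nat ffact_le].
rewrite -exprMn -(ler_pM2l t0); apply: (@le_trans _ _ ((1 / 2) ^+ j * j%:R ^+ j)).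
  rewrite -!exprMn; apply: lerXn2r; rewrite ?nnegrE ?mulr_ge0 //; lra.
rewrite mulrCA; apply: ler_wpM2l; [by apply: exprn_ge0; lra|exact: fact_bound].
Qed.

Lemma half_decay n i : (0 < n)%N -> (2 * i <= n)%N ->
  (1 - 2 * i%:R / n%:R) ^+ (n - n %/ 2) <= (1 / 2) ^+ i :> R.
Proof.
move=> n0 hi; have nR : 0 < n%:R :> R by rewrite ltr0n.
have h1 : 0 <= 1 - 2 * i%:R / n%:R :> R.
  by rewrite subr_ge0 ler_pdivrMr // mul1r -natrM ler_nat.
apply: (@le_trans _ _ (expR (- (2 * i%:R / n%:R)) ^+ (n - n %/ 2))).
  by apply: lerXn2r; rewrite ?nnegrE ?expR_ge0 //; exact: expR_ge1Dx.
rewrite -expRM_natl; apply: (@le_trans _ _ (expR (i%:R * -1))).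
  rewrite ler_expR mulrN mulrN1 lerN2 !mulrA ler_pdivlMr //.
  have : n%:R <= 2 * (n - n %/ 2)%N%:R :> R by rewrite -natrM ler_nat; lia.
  have : 0 <= i%:R :> R by [].
  nra.
rewrite expRM_natl; apply: lerXn2r; rewrite ?nnegrE ?expR_ge0 //.
rewrite expRN; have h2 := expR1_ge2.
by rewrite div1r lef_pV2 ?posrE //; lra.
Qed.

Lemma halving_sum m s : (\sum_(i < s) m %/ 2 ^ i.+1 <= m)%N.
Proof.
suff h : (\sum_(i < s) m %/ 2 ^ i.+1 + m %/ 2 ^ s <= m)%N by exact: leq_trans (leq_addr _ _) h.
elim: s => [|s IH]; first by rewrite big_ord0 expn0 divn1.
rewrite big_ord_recr /= -addnA; apply: leq_trans IH; rewrite leq_add2l expnSr divnMA; lia.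
Qed.

Lemma sqrt_exists n : exists s, (s * s <= n)%N /\ (n < s.+1 * s.+1)%N.
Proof.
have ex : exists s, (s * s <= n)%N by exists 0%N.
have bd s : (s * s <= n)%N -> (s <= n)%N by case: s => // s; apply: leq_trans; rewrite leq_pmulr.
have [s sn mx] := ex_maxnP ex bd; exists s; split=> //.
by rewrite ltnNge; apply/negP=> /mx; rewrite ltnn.
Qed.

End BinBound.

(** * The minimum spanning tree has bounded weight *)

Section MstProb.
Import mathcomp.boot.fintype mathcomp.boot.finset Pilot.Defs.
Local Open Scope set_scope.
Local Open Scope ring_scope.
Variables (R : realType) (V : finType) (N : nat).
Hypothesis N0 : (0 < N)%N.
Local Notation Om := {ffun {set V} -> 'I_N}.
Local Notation Pr := (@Pr R {set V} N).
Local Notation n := #|V|.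
Hypothesis n0 : (0 < n)%N.

Lemma small_dep c j : dep (cgraph V) (fun f : Om => small f c j).
Proof.
move=> f g h; apply: eq_existsb => J; congr (_ && (_ * #|_| <= _)%N).
have E := @cl_dep V N c [set: V] J f g; rewrite E // => e /setIdP[eK _]; exact: h.
Qed.

Lemma small_prob c j (z : R) : (c <= N)%N -> 0 <= z <= 1 ->
  (1 - c%:R / N%:R * (1 - z)) ^+ (n - n %/ 2) <= z ->
  Pr (fun f => small f c j) <= 'C(n, j)%:R * z ^+ j.
Proof.
move=> cN z01 hz.
apply: (@le_trans _ _ (\sum_(J : {set V} | #|J| == j) Pr (fun f => (#|cl f c [set: V] J| <= n %/ 2)%N))).
  apply: Pr_union => // f /existsP[J /andP[cJ hJ]]; exists J => //.
  by rewrite leq_divRL // mulnC.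
apply: (@le_trans _ _ (\sum_(J : {set V} | #|J| == j) z ^+ j)).
  apply: ler_sum => J /eqP <-; apply: (closure_tail N0 cN z01 hz) => //.
  by rewrite cardsT subnKC // leq_div.
rewrite sumr_const -[_ *+ _]mulr_natl.
rewrite (eq_card (B := [set J : {set V} | J \subset [set: V] & #|J| == j])); last first.
  by move=> J; rewrite !inE subsetT.
by rewrite cards_draws cardsT.
Qed.

Variables (a s : nat).
Hypothesis Na : N = (n * a)%N.
Hypothesis s4 : (4 <= s)%N.
Hypothesis sn : (s * s <= n)%N.
Local Notation jj i := (s.+1 + 6 * n %/ 2 ^ i)%N.
Local Notation lev i := (i * (4 * a))%N.

(** At level [lev i], that is weight [4 i / n], a given set of [j] vertices has small clusters with
    probability at most [2^(- i j)]. The term [6 n / 2^i] in [jj i] beats the number of sets, by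
    [bin_bound]; the term [s.+1] makes the bound at most [2^-s]. The last condition puts every
    vertex in a cluster of more than half of the vertices at level [lev s], so no tree edge is
    heavier. *)
Definition many_small_clusters (f : Om) := [exists i : 'I_s, (0 < i)%N && small f (lev i) (jj i)] || small f (lev s) 1.

Lemma many_small_clusters_dep : dep (cgraph V) many_small_clusters.
Proof.
move=> f g h; have E c j : small f c j = small g c j by exact: small_dep.
by rewrite /many_small_clusters E; apply: orb_id2r => _; apply: eq_existsb => i; rewrite E.
Qed.

Let a0 : (0 < a)%N. Proof. by move: N0; rewrite Na; case: (a) => //; rewrite muln0. Qed.

Lemma level_prob i j : (0 < i)%N -> (i <= s)%N -> Pr (fun f => small f (lev i) j) <= 'C(n, j)%:R * ((1 / 2) ^+ i) ^+ j.
Proof.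
move=> i0 is_; have in4 : (4 * i <= n)%N.
  by apply: leq_trans sn; apply: leq_mul.
have nR : 0 < n%:R :> R by rewrite ltr0n.
have aR : 0 < a%:R :> R by rewrite ltr0n.
have z0 : 0 <= (1 / 2 : R) ^+ i by apply: exprn_ge0; lra.
have z1 : (1 / 2 : R) ^+ i <= 1 / 2.
  rewrite -[X in _ <= X]expr1; apply: ler_wiXn2l => //; lra.
apply: small_prob.
- by rewrite Na mulnA leq_mul2r mulnC in4 orbT.
- by rewrite z0 (le_trans z1) //; lra.
have pE : (lev i)%:R / N%:R = 4 * i%:R / n%:R :> R.
  by rewrite Na !natrM; field; rewrite !gt_eqF.
rewrite pE; apply: (@le_trans _ _ ((1 - 2 * i%:R / n%:R) ^+ (n - n %/ 2))); last first.
  apply: half_decay => //; apply: leq_trans in4; by rewrite leq_mul2r orbT.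
have x0 : 0 <= i%:R / n%:R :> R by rewrite divr_ge0.
have x1 : 4 * (i%:R / n%:R) <= 1 :> R.
  by rewrite mulrA ler_pdivrMr // mul1r -natrM ler_nat.
move: x0 x1 z0 z1; rewrite -!(mulrA _ i%:R); move: (i%:R / n%:R) ((1 / 2) ^+ i) => x z x0 x1 z0 z1.
by apply: lerXn2r; rewrite ?nnegrE; [nra|nra|nra].
Qed.

Lemma many_small_clusters_prob : Pr many_small_clusters <= (s%:R + n%:R) * (1 / 2) ^+ s.
Proof.
have h0 : 0 <= (1 / 2 : R) by lra.
have h1 : (1 / 2 : R) <= 1 by lra.
rewrite mulrDl; apply: le_trans (Pr_or R N0 _ _) _; apply: lerD; last first.
  have := @level_prob s 1 (leq_trans (isT : (0 < 4)%N) s4) (leqnn _).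
  by rewrite bin1 expr1.
apply: (@le_trans _ _ (\sum_(i < s | (0 < i)%N) Pr (fun f => small f (lev i) (jj i)))).
  by apply: Pr_union => // f /existsP[i /andP[i0 hi]]; exists i.
apply: (@le_trans _ _ (\sum_(i < s) (1 / 2) ^+ s)); last first.
  by rewrite sumr_const card_ord -[_ *+ _]mulr_natl.
rewrite big_mkcond; apply: ler_sum => i _; case: ifP => i0; last exact: exprn_ge0.
apply: (le_trans (level_prob (jj i) i0 (ltnW (ltn_ord i)))).
apply: (@le_trans _ _ ((1 / 2) ^+ (jj i))).
  apply: bin_bound; [exact: exprn_ge0|by rewrite addSn|].
  have t0 : 0 < 2 ^+ i :> R by apply: exprn_gt0; lra.
  have -> : (1 / 2 : R) ^+ i = (2 ^+ i)^-1 by rewrite div1r exprVn.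
  rewrite ler_pdivrMr // -natrX -!natrM ler_nat.
  apply: ltnW; apply: (leq_trans (ltn_ceil (6 * n) (expn_gt0 2 i : (0 < 2 ^ i)%N))).
  by rewrite leq_mul2r addSn ltnS leq_addl orbT.
by apply: ler_wiXn2l => //; rewrite addSn ltnW // ltnS leq_addr.
Qed.

(** The counts add up to [15 n]: [n] at level 0, [12 n] from the halving terms and [2 n] from the
    terms [s.+1], as [s * s <= n]. Layers have thickness [4 * a], and [4 * a * (15 * n)] is
    [60 * N]. *)
Lemma mst_height f : ~~ tie f -> ~~ many_small_clusters f -> (height f (kr (wt f) [set: V]) <= 60 * N)%N.
Proof.
move=> nt; rewrite negb_or => /andP[/existsPn nb nbs].
have inj := tie_inj nt.
have s0 : (0 < s)%N := leq_trans (isT : (0 < 4)%N) s4.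
have top : above f (lev s) = 0%N.
  apply/eqP; rewrite -leqn0 leqNgt; apply: contra nbs => h.
  by apply: (above_small inj n0).
apply: (leq_trans (height_levels top)).
have sum : (\sum_(i < s) above f (i * (4 * a)) <= 15 * n)%N.
  case: s s0 sn nb => // s' _ sn' nb'.
  rewrite big_ord_recl /=; apply: (@leq_trans (n + \sum_(i < s') 2 * (s'.+2 + 6 * n %/ 2 ^ i.+1))).
    apply: leq_add.
      have [A [_ cA]] := forest_remove (kr_forest _ inj) (subxx (kr (wt f) [set: V])) n0.
      apply: (@leq_trans #|kr (wt f) [set: V]|).
        by apply: subset_leq_card; apply/subsetP=> e /setIdP[].
      by apply: ltnW; rewrite -cA max_card.
    apply: leq_sum => i _; rewrite leqNgt; have := nb' (lift ord0 i); rewrite /= /bump /=.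
    apply: contra => h; apply: (above_small inj n0); rewrite add1n in h *; exact: leqW (ltnW h).
  rewrite -big_distrr /= big_split /= sum_nat_const card_ord.
  have := halving_sum (6 * n) s'; move: (\sum_(i < s') _)%N => X hX.
  by move: sn' hX; move: n => m; nia.
apply: (@leq_trans (4 * a * (15 * n))); first by rewrite leq_mul2l sum orbT.
have -> : (60 * N = 60 * (n * a))%N by rewrite -Na.
by rewrite mulnACA (mulnC a).
Qed.

End MstProb.

(** * Heavy edges of the given graph *)

Section Heavy.
Import mathcomp.boot.fintype mathcomp.boot.finset Pilot.Defs.
Local Open Scope set_scope.
Local Open Scope ring_scope.
Variables (R : realType) (V : finType) (N : nat).
Hypothesis N0 : (0 < N)%N.
Local Notation Om := {ffun {set V} -> 'I_N}.
Local Notation Pr := (@Pr R {set V} N).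
Variables (H : {set {set V}}) (Q b : nat).
Hypothesis HK : H \subset cgraph V.
Hypothesis Q2 : (2 <= Q)%N.
Hypothesis Nb : N = (Q * b)%N.
Local Notation j := (#|H| %/ (4 * Q))%N.

(** Level [N - b] is the weight [1 - 1/Q], reached by an edge with probability [1/Q]; a quarter of
    the expected number of such edges is required. *)
Definition few_heavy_edges (f : Om) := (#|H| - j <= cnt H (N - b) f)%N.

Lemma few_heavy_edges_dep : dep (cgraph V) few_heavy_edges.
Proof.
move=> f g h; congr (_ <= _)%N; apply: eq_card => e.
by apply/setIdP/setIdP => -[eH lt]; split=> //; move: lt; rewrite h // (subsetP HK).
Qed.

Lemma heavy_p : (N - b)%N%:R / N%:R = 1 - Q%:R^-1 :> R.
Proof.
have NR : N%:R != 0 :> R by rewrite pnatr_eq0 -lt0n.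
have bN : (b <= N)%N by rewrite Nb leq_pmull // (leq_trans _ Q2).
rewrite natrB // mulrBl divff //; congr (_ - _).
move: NR; rewrite Nb natrM mulf_eq0 negb_or => /andP[Q0 b0].
by field; rewrite Q0 b0.
Qed.

(** The exponential bound at 2 is [(1 - 1/(2Q))^#|H|] times [2^j]; each of [j] groups of [4 Q]
    factors is at most 1/3. *)
Lemma few_heavy_edges_prob : Pr few_heavy_edges <= (2 / 3) ^+ j.
Proof.
have QR : 2 <= Q%:R :> R by rewrite (ler_nat R 2).
have q0 : 0 < Q%:R :> R by lra.
have z1 : 1 <= 2 :> R by lra.
apply: (le_trans (cnt_tail N0 H (#|H| - j) (leq_subr b N) z1)).
rewrite heavy_p.
have jH : (j <= #|H|)%N by exact: leq_div.
have u01 : 0 <= ((2 * Q%:R)^-1 : R) <= 1.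
  by rewrite invr_ge0 mulr_ge0 //= ?(ltW q0) // invf_le1 ?mulr_gt0 //; lra.
have E : 1 + (1 - Q%:R^-1) * (2 - 1) = 2 * (1 - (2 * Q%:R)^-1) :> R.
  by field; rewrite gt_eqF.
have t0 : 0 < 2 ^+ (#|H| - j) :> R by apply: exprn_gt0; lra.
have v0 : 0 <= 1 - (2 * Q%:R)^-1 :> R by case/andP: u01 => _ h; rewrite subr_ge0.
have v1 : 1 - (2 * Q%:R)^-1 <= 1 :> R by case/andP: u01 => h _; rewrite lerBlDr lerDl.
rewrite E exprMn ler_pdivrMr // mulrC.
have -> : 2 ^+ #|H| = 2 ^+ j * 2 ^+ (#|H| - j) :> R by rewrite -exprD subnKC.
rewrite mulrA; apply: ler_wpM2r; first exact: ltW.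
apply: (@le_trans _ _ (((1 - (2 * Q%:R)^-1) ^+ (4 * Q)) ^+ j * 2 ^+ j)).
  apply: ler_wpM2r; first exact: exprn_ge0.
  by rewrite -exprM; apply: ler_wiXn2l => //; rewrite mulnC leq_trunc_div.
clear t0; rewrite -exprMn; apply: lerXn2r; rewrite ?nnegrE ?mulr_ge0 ?exprn_ge0 //.
have d : (1 - (2 * Q%:R)^-1) ^+ (4 * Q) <= 1 / 3 :> R.
  apply: (pow_decay_le u01); first lra.
  have -> : (4 * Q)%N%:R * (2 * Q%:R)^-1 = 2 :> R by rewrite natrM; field; rewrite gt_eqF.
  lra.
by move: d; move: ((1 - _) ^+ (4 * Q)) => x; lra.
Qed.

Lemma heavy_count f : ~~ few_heavy_edges f -> (#|V| <= 2 * #|H|)%N ->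
  (#|V| <= 8 * Q * #|[set e in H | (N - b <= f e)%N]|)%N.
Proof.
rewrite /few_heavy_edges -ltnNge => lt VH.
have Q0 : (0 < 4 * Q)%N by rewrite muln_gt0 (leq_trans _ Q2).
have sum : (#|[set e in H | (N - b <= f e)%N]| + cnt H (N - b) f = #|H|)%N.
  rewrite /cnt -(cardsID [set e : {set V} | (N - b <= f e)%N] H); congr addn; apply: eq_card => e.
    by rewrite !inE.
  by rewrite !inE ltnNge andbC.
have lj := ltn_ceil #|H| Q0; move: lj lt sum VH.
move: (#|[set e in H | _]|) (cnt _ _ _) => x c; move: (j) => q; nia.
Qed.

End Heavy.

Section PartB.
Import mathcomp.boot.fintype mathcomp.boot.finset Pilot.Defs.
Local Open Scope set_scope.
Local Open Scope ring_scope.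

Lemma good_weights (R : realType) n (H : {set {set 'I_n}}) (w : {set 'I_n} -> R) N
  (f : {ffun {set 'I_n} -> 'I_N}) (eps : R) Q b a s :
  (0 < N)%N -> H \subset cgraph 'I_n -> (#|'I_n| <= 2 * #|H|)%N -> (0 < #|'I_n|)%N ->
  (2 <= Q)%N -> Q%:R^-1 < eps -> N = (Q * b)%N -> N = (#|'I_n| * a)%N -> (4 <= s)%N ->
  (s * s <= #|'I_n|)%N ->
  (forall e, e \in cgraph 'I_n -> (f e)%:R / N%:R <= w e < (f e).+1%:R / N%:R) ->
  ~~ tie f -> ~~ many_small_clusters a s f -> ~~ few_heavy_edges H Q b f ->
  weight w (mst (cgraph 'I_n) w [set: 'I_n]) <= 60 /\
  forall Ss, seq_weight (cgraph 'I_n) w H Ss <= 1 - eps ->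
    n%:R / (16 * Q%:R) <= weight w (final_subgraph (cgraph 'I_n) w H Ss).
Proof.
move=> N0 HK VH n0 Q2 Qe Nb Na s4 sn hw nt nm nh.
have inj := tie_inj nt.
have winj := cell_inj N0 hw inj.
have NR : 0 < N%:R :> R by rewrite ltr0n.
have wb e : e \in cgraph 'I_n -> w e <= (f e).+1%:R / N%:R.
  by move=> eK; have [] := cell_bounds N0 hw eK.
have w0 e : e \in cgraph 'I_n -> 0 <= w e.
  by move=> eK; have [] := cell_bounds N0 hw eK.
split.
  rewrite mst_kr //; apply: le_trans (weight_height wb (kr_cgraph _ _)) _.
  have <- : kr (wt f) [set: 'I_n] = kr w [set: 'I_n].
    by apply: kr_ext => e e' eK eK'; apply: (cell_iso N0 hw inj).
  rewrite ler_pdivrMr // -natrM ler_nat; exact: (mst_height N0 n0 Na s4 sn nt nm).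
move=> Ss wS; set E := [set e in H | (N - b <= f e)%N].
have QR : 2 <= Q%:R :> R by rewrite (ler_nat R 2).
have q0 : 0 < Q%:R :> R by lra.
have q2 : Q%:R^-1 <= 1 / 2 :> R by rewrite div1r lef_pV2 ?posrE //; lra.
have hE e : e \in E -> 1 - Q%:R^-1 <= w e.
  move=> /setIdP[eH le]; have [h _] := andP (hw e (subsetP HK _ eH)); apply: le_trans h.
  by rewrite -(heavy_p R N0 Q2 Nb) ler_pM2r ?invr_gt0 // ler_nat.
have EF : E \subset final_subgraph (cgraph 'I_n) w H Ss.
  apply/subsetP=> e eE; have /setIdP[eH _] := eE.
  apply: (heavy_survive winj w0 HK eH); apply: le_lt_trans wS _.
  by apply: lt_le_trans (hE e eE); rewrite ltrD2l ltrN2.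
apply: le_trans (weight_sub w0 EF (final_sub winj _ HK)).
have cE := heavy_count N0 HK Q2 Nb nh VH; rewrite card_ord -/E in cE.
(* [E] has at least [n / (8 Q)] edges, each of weight at least [1 - 1/Q >= 1/2]. *)
apply: (@le_trans _ _ (\sum_(e in E) (1 / 2))).
  rewrite sumr_const -[1 / 2 *+ _]mulr_natl ler_pdivrMr ?mulr_gt0 //.
  have : n%:R <= 8 * Q%:R * #|E|%:R :> R by rewrite -!natrM ler_nat.
  move: (#|E|%:R : R) => x.
  by have -> : x * (1 / 2) * (16 * Q%:R) = 8 * Q%:R * x by field.
by apply: ler_sum => e /hE; lra.
Qed.

(** [Q] is chosen before [eta], since [delta] has to be the same for all probability bounds. *)
Theorem heavy_final_subgraph_prob (R : realType) (eps : R) : 0 < eps ->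
  exists Q : nat, (2 <= Q)%N /\ forall eta : R, 0 < eta ->
  exists n0 : nat, forall n, (n0 <= n)%N ->
  forall (d : measure_display) (T : measurableType d) (P : probability T R)
    (X : {set 'I_n} -> {RV P >-> R}) (H : {set {set 'I_n}}),
  mutually_independent (cgraph 'I_n) X ->
  (forall e, e \in cgraph 'I_n -> uniform01 (X e)) ->
  H \subset cgraph 'I_n -> (forall x y, conn H x y) ->
  forall Good : set T, measurable Good ->
  (forall t, weight (fun e => X e t) (mst (cgraph 'I_n) (fun e => X e t) [set: 'I_n]) <= 60 ->
     (forall Ss, seq_weight (cgraph 'I_n) (fun e => X e t) H Ss <= 1 - eps ->
       n%:R / (16 * Q%:R) <= weight (fun e => X e t) (final_subgraph (cgraph 'I_n) (fun e => X e t) H Ss)) ->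
     Good t) ->
  (P (~` Good)%classic <= eta%:E)%E.
Proof.
move=> eps0.
have [Q [Q2 Qe]] : exists Q, (2 <= Q)%N /\ Q%:R^-1 < eps.
  have [k hk] := natr_bound (1 / eps); exists k.+2; split=> //.
  have k1 : k%:R < k.+2%:R :> R by rewrite ltr_nat ltnW.
  have k0 : 0 < k.+2%:R :> R by rewrite ltr0n.
  move: hk; rewrite ler_pdivrMr // => h.
  rewrite -[_^-1]mul1r ltr_pdivrMr //; nra.
exists Q; split=> // eta eta0.
have e3 : eta / 3 + (eta / 3 + eta / 3) <= eta by lra.
have Q0 : (0 < Q)%N by exact: leq_trans Q2.
have u01 : 0 < (1 / 2 : R) <= 1 by lra.
have [C [C0 decay]] := poly_exp_decay 1 u01.
have [n1 hn1] := natr_bound (3 / eta).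
have [k3 hk3] := natr_bound (3 * C / eta).
have [m hm] := natr_bound (9 / eta).
exists (maxn (maxn n1.+1 2) (maxn ((maxn k3 4).+1 * (maxn k3 4).+1) (8 * Q * m))) => n.
rewrite !geq_max => /andP[/andP[n1n n2] /andP[nk nm]].
move=> d T P X H indep unif HK HC Good mG hG.
have n0 : (0 < n)%N by exact: leq_trans n2.
have nR : 0 < n%:R :> R by rewrite ltr0n.
have [s [sn ns]] := sqrt_exists n.
have [sk s4] : (k3 <= s)%N /\ (4 <= s)%N.
  have : ((maxn k3 4) < s.+1)%N.
    rewrite ltnNge; apply/negP=> h.
    by have := leq_trans (leq_mul h h) (leq_trans (leq_mul (leqnSn _) (leqnSn _)) nk); rewrite leqNgt ns.
  by rewrite ltnS geq_max => /andP[].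
pose N := (n * (Q * n ^ 6))%N.
have n6 : (0 < n ^ 6)%N by rewrite expn_gt0 n0.
have N0 : (0 < N)%N by rewrite /N; move: (n ^ 6)%N n6 => x x0; rewrite !muln_gt0 n0 Q0 x0.
have Na : N = (#|'I_n| * (Q * n ^ 6))%N by rewrite card_ord.
have Nb : N = (Q * (n * n ^ 6))%N by rewrite /N mulnCA.
have V1 : (1 < #|'I_n|)%N by rewrite card_ord.
have VH := connected_card HK HC V1.
have sn' : (s * s <= #|'I_n|)%N by rewrite card_ord.
have n0' : (0 < #|'I_n|)%N by rewrite card_ord.
pose A (f : {ffun {set 'I_n} -> 'I_N}) :=
  tie f || (many_small_clusters (Q * n ^ 6) s f || few_heavy_edges H Q (n * n ^ 6) f).
have dA : dep (cgraph 'I_n) A.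
  move=> f f' h; congr (_ || (_ || _)); first exact: tie_dep.
    exact: many_small_clusters_dep.
  exact: few_heavy_edges_dep.
apply: le_trans (transfer N0 indep unif mG dA _) _.
  move=> t f hw; rewrite negb_or => /andP[nt]; rewrite negb_or => /andP[nmb nh].
  have [h1 h2] := good_weights N0 HK VH n0' Q2 Qe Nb Na s4 sn' hw nt nmb nh.
  exact: hG.
rewrite lee_fin; apply: le_trans e3; apply: le_trans (Pr_or R N0 _ _) _; apply: lerD.
  apply: (le_trans (@tie_prob 'I_n N R N0)).
  apply: (@le_trans _ _ (n%:R^-1)).
    rewrite ler_pdivrMr ?ltr0n // mulrC ler_pdivlMr // -natrM ler_nat.
    have cK : (#|cgraph 'I_n| <= n ^ 2)%N.
      rewrite /cgraph (eq_card (B := [set e : {set 'I_n} | e \subset [set: 'I_n] & #|e| == 2])); last first.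
        by move=> e; rewrite !inE subsetT.
      rewrite cards_draws cardsT card_ord bin2 -mulnn.
      by apply: (@leq_trans (n * n.-1)%N); [rewrite -[leqRHS]odd_double_half -addnn addnA leq_addl|rewrite leq_mul2l leq_pred orbT].
    apply: (@leq_trans ((n ^ 2) ^ 2 * n)%N); first by rewrite leq_mul2r leq_exp2r // cK orbT.
    rewrite -expnM -expnSr /N mulnCA -expnS; apply: (@leq_trans (n ^ 7)%N); first by rewrite leq_pexp2l.
    by rewrite leq_pmull.
  have : n1%:R <= n%:R :> R by rewrite ler_nat ltnW.
  move: hn1; rewrite ler_pdivrMr // => h1 h2.
  rewrite -[leLHS]mul1r ler_pdivrMr //.
  have := ler_wpM2r (ltW eta0) h2; lra.
apply: le_trans (Pr_or R N0 _ _) _; apply: lerD.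
  apply: (le_trans (many_small_clusters_prob R N0 n0' Na s4 sn')); rewrite card_ord.
  have s0 : (0 < s)%N := leq_trans (isT : (0 < 4)%N) s4.
  have sR : 0 < s%:R :> R by rewrite ltr0n.
  have sx : (s <= 1 * s ^ 10)%N by rewrite mul1n -[X in (X <= _)%N]expn1 leq_pexp2l.
  have := decay s s s0 sx; rewrite (_ : 1 - 1 / 2 = 1 / 2 :> R); last by lra.
  have p0 : 0 <= (1 / 2 : R) ^+ s by apply: exprn_ge0; lra.
  have : s%:R + n%:R <= 7 * s%:R ^+ 2 :> R.
    rewrite -natrX -natrM -natrD ler_nat; apply: (@leq_trans (s + s.+1 * s.+1)%N).
      by rewrite leq_add2l ltnW.
    by rewrite -mulnn; move: s0; clear; nia.
  move=> h1 h2; apply: (le_trans (ler_wpM2r p0 h1)); apply: (le_trans h2).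
  have sk' : k3%:R <= s%:R :> R by rewrite ler_nat.
  move: (le_trans hk3 sk'); rewrite ler_pdivrMr // => h3.
  rewrite ler_pdivrMr ?exprn_gt0 //.
  have s1 : 1 <= s%:R :> R by rewrite ler1n.
  have : s%:R * eta <= s%:R ^+ 2 * eta by rewrite expr2 -mulrA ler_peMl // mulr_ge0 // ltW.
  lra.
apply: (le_trans (few_heavy_edges_prob R N0 H Q2 Nb)).
have mj : (m <= #|H| %/ (4 * Q))%N.
  rewrite leq_divRL ?muln_gt0 ?Q0 //; move: VH nm; rewrite card_ord.
  by move: (#|H|) => h; clear; nia.
have -> : 2 / 3 = 1 - 1 / 3 :> R by lra.
apply: pow_decay_le; [lra|lra|].
have : m%:R <= (#|H| %/ (4 * Q))%N%:R :> R by rewrite ler_nat.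
move=> hmj; move: (le_trans hm hmj); rewrite ler_pdivrMr //.
move: ((#|H| %/ (4 * Q))%N%:R : R) => x hx.
have -> : eta / 3 * (1 + x * (1 / 3)) = eta / 3 + (x * eta) / 9 by field.
lra.
Qed.

End PartB.

(** * Measurability and conclusion *)

Section SameOrder.
Import mathcomp.boot.fintype mathcomp.boot.finset Pilot.Defs.
Local Open Scope set_scope.
Local Open Scope ring_scope.
Variables (R : realType) (V : finType) (E H : {set {set V}}).
Implicit Types (w : {set V} -> R) (F : {set {set V}}) (S : {set V}) (Ss : seq {set V}).

(** Finitely many comparisons sort the outcomes into classes. On each class the trees and the
    subgraph sequences are constant, while [seq_weight] and [cost] are weights of fixed edge sets.
    Measurability follows, whatever the length of the sequences. *)
Definition same_order w w' :=
  forall F F', (weight w F <= weight w F') = (weight w' F <= weight w' F').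

(** The sets of minimizers coincide, hence so does the choice made by [xget], even with ties. *)
Lemma mst_same w w' S : same_order w w' -> mst E w S = mst E w' S.
Proof.
move=> h; rewrite /mst; congr xget; apply/funext => F; apply/propext.
by split=> -[sp mn]; split=> // F' /mn; rewrite h.
Qed.

Lemma subgraph_same w w' Ss i : same_order w w' ->
  subgraph_seq E w H Ss i = subgraph_seq E w' H Ss i.
Proof.
move=> h; rewrite /subgraph_seq; elim: (take i Ss) (H) => //= S s IH G.
by rewrite IH; congr foldl; rewrite /phi (mst_same S h).
Qed.

Lemma mst_sequence_same w w' Ss : same_order w w' ->
  mst_sequence E w H Ss -> mst_sequence E w' H Ss.
Proof.
by move=> h; rewrite /mst_sequence /final_subgraph (subgraph_same _ _ h) (mst_same _ h).
Qed.

Lemma bigmax_attained m (g : 'I_m -> R) :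
  \big[Num.max/0]_(i < m) g i = 0 \/ exists i, \big[Num.max/0]_(i < m) g i = g i.
Proof.
elim/big_rec: _ => [|i x _ [->|[k ->]]]; first by left.
  by rewrite /Num.max; case: ifP => _; [left|right; exists i].
by right; rewrite /Num.max; case: ifP => _; [exists k|exists i].
Qed.

Lemma weight0 w : weight w set0 = 0.
Proof. exact: big_set0. Qed.

Lemma seq_weight_le w Ss c : (seq_weight E w H Ss <= c) <->
  (weight w set0 <= c /\ forall i : 'I_(size Ss),
     weight w (induced (subgraph_seq E w H Ss i) (nth set0 Ss i)) <= c).
Proof.
rewrite weight0 /seq_weight; split=> [/bigmax_leP[c0 h]|[c0 h]].
  by split=> // i; exact: h.
by apply/bigmax_leP; split=> // i _; exact: h.
Qed.

Lemma same_sym w w' : same_order w w' -> same_order w' w. Proof. by move=> h F F'; rewrite h. Qed.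

Lemma seq_weight_val w Ss : exists F, forall w', same_order w w' ->
  seq_weight E w' H Ss = weight w' F.
Proof.
have [F [hF mem]] : exists F, seq_weight E w H Ss = weight w F /\
   (F = set0 \/ exists i : 'I_(size Ss), F = induced (subgraph_seq E w H Ss i) (nth set0 Ss i)).
  have [h|[i h]] := @bigmax_attained (size Ss)
    (fun i => weight w (induced (subgraph_seq E w H Ss i) (nth set0 Ss i))).
    by exists set0; rewrite weight0; split; [exact: h|left].
  by exists (induced (subgraph_seq E w H Ss i) (nth set0 Ss i)); split; [exact: h|right; exists i].
exists F => w' ww'; apply/eqP; rewrite eq_le; apply/andP; split.
  apply/seq_weight_le; have : seq_weight E w H Ss <= weight w F by rewrite hF.
  move=> /seq_weight_le[h0 h]; rewrite -ww'; split=> // i.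
  by rewrite -(subgraph_same _ _ ww') -ww'.
have /seq_weight_le[h0 h] := lexx (seq_weight E w' H Ss).
case: mem => [->|[i ->]] //.
by rewrite (subgraph_same _ _ ww').
Qed.

(** The minimum over infinitely many sequences is attained because [seq_weight] only takes values
    [weight w F], and there are finitely many [F]. *)
Lemma cost_min w : (exists Ss, mst_sequence E w H Ss) ->
  exists F, forall w', same_order w w' ->
    [/\ cost E w' H = weight w' F, exists2 Ss, mst_sequence E w' H Ss & seq_weight E w' H Ss = cost E w' H &
      forall Ss, mst_sequence E w' H Ss -> cost E w' H <= seq_weight E w' H Ss].
Proof.
move=> [Ss1 m1].
pose ok : pred {set {set V}} := fun F => `[< exists2 Ss, mst_sequence E w H Ss &
   forall w', same_order w w' -> seq_weight E w' H Ss = weight w' F >].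
have [F1 hF1] := seq_weight_val w Ss1.
have ok1 : ok F1 by apply/asboolP; exists Ss1.
case: (arg_minP (P := ok) (weight w) ok1) => F /asboolP[Ss0 m0 h0] mn.
exists F => w' ww'.
have low Ss : mst_sequence E w' H Ss -> weight w' F <= seq_weight E w' H Ss.
  move=> /(mst_sequence_same (same_sym ww')) mSs.
  have [F2 hF2] := seq_weight_val w Ss; rewrite hF2 // -ww'.
  by apply: mn; apply/asboolP; exists Ss.
have m0' := mst_sequence_same ww' m0.
have mi : is_minimum [set seq_weight E w' H Ss | Ss in [set Ss | mst_sequence E w' H Ss]]%classic (weight w' F).
  by split; [exists Ss0; rewrite ?h0|move=> _ [Ss mSs <-]; exact: low].
have cE : cost E w' H = weight w' F.
  have [[Ss mSs e1] l1] := xgetPex 0 (ex_intro _ _ mi).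
  apply/eqP; rewrite eq_le; apply/andP; split; first by apply: l1; exact: (proj1 mi).
  by rewrite /cost -e1; exact: low.
by split; rewrite ?cE //; exists Ss0; rewrite ?h0.
Qed.

Lemma cost_val w : exists F, forall w', same_order w w' -> cost E w' H = weight w' F.
Proof.
case: (pselect (exists Ss, mst_sequence E w H Ss)) => [ex|nex].
  by have [F hF] := cost_min ex; exists F => w' /hF[].
exists set0 => w' ww'; rewrite weight0 /cost xgetPN // => c [[Ss mSs _] _].
by apply: nex; exists Ss; exact: mst_sequence_same (same_sym ww') mSs.
Qed.

End SameOrder.

Section Pattern.
Local Open Scope classical_set_scope.
Local Open Scope ring_scope.
Variables (R : realType) (d : measure_display) (T : measurableType d).

(* [A] is a union of atoms of the algebra generated by the [B i]. *)
Lemma measurable_pattern (I : finType) (B : I -> set T) (A : set T) :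
  (forall i, measurable (B i)) ->
  (forall t t', (forall i, B i t <-> B i t') -> A t -> A t') -> measurable A.
Proof.
move=> mB inv.
pose atom (s : {ffun I -> bool}) := \bigcap_(i in [set: I]) (if s i then B i else ~` B i).
pose D := [set s : {ffun I -> bool} | exists2 t, A t & atom s t].
have AE : A = \bigcup_(s in D) atom s.
  apply/seteqP; split=> t.
    move=> At; pose s := [ffun i => `[< B i t >]].
    have st : atom s t.
      by move=> i _; rewrite /s ffunE; case: asboolP.
    by exists s => //; exists t.
  move=> [s [t' At' st'] st]; apply: inv At' => i.
  have := st' i Logic.I; have := st i Logic.I; case: (s i) => //=; tauto.
rewrite AE; apply: fin_bigcup_measurable; first exact: finite_finset.
move=> s _; apply: fin_bigcap_measurable; first exact: finite_finset.
by move=> i _; case: (s i) => //; exact: measurableC.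
Qed.

End Pattern.

Section EventMeasurability.
Import mathcomp.boot.fintype mathcomp.boot.finset Pilot.Defs.
Local Open Scope classical_set_scope.
Local Open Scope ring_scope.
Variables (R : realType) (d : measure_display) (T : measurableType d) (P : probability T R).
Variables (V : finType) (X : {set V} -> {RV P >-> R}) (E H : {set {set V}}).
Let w (t : T) (e : {set V}) : R := X e t.

Lemma measurable_weight F : measurable_fun [set: T] (fun t => weight (w t) F).
Proof.
rewrite /weight; under eq_fun do rewrite -big_filter.
by apply: measurable_sum => e; exact: measurable_funP.
Qed.

Lemma measurable_le_set (f g : T -> R) : measurable_fun [set: T] f -> measurable_fun [set: T] g ->
  measurable [set t | f t <= g t].
Proof.
move=> mf mg; have := measurable_realfun.measurable_fun_ler mf mg measurableT (Y := [set true]).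
by rewrite classical_sets.setTI; apply.
Qed.

Lemma measurable_of_order (J : finType) (B : J -> set T) (A : set T) :
  (forall j, measurable (B j)) ->
  (forall t t', same_order (w t) (w t') -> (forall j, B j t <-> B j t') -> A t -> A t') ->
  measurable A.
Proof.
move=> mB inv.
pose C (i : ({set {set V}} * {set {set V}}) + J) : set T := match i with
  | inl p => [set t | weight (w t) p.1 <= weight (w t) p.2] | inr j => B j end.
apply: (@measurable_pattern _ _ _ C); first case=> [p|j] //=.
  by apply: measurable_le_set; exact: measurable_weight.
move=> t t' h; apply: inv => [F F'|j]; last exact: (h (inr j)).
by apply/idP/idP => /(h (inl (F, F'))).
Qed.

Lemma measurable_mst_event (c : R) : measurable [set t | exists Ss : seq {set V},
  mst_sequence E (w t) H Ss /\ seq_weight E (w t) H Ss <= c].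
Proof.
apply: (@measurable_of_order _ (fun F => [set t | weight (w t) F <= c])) => [F|t t' so le].
  by apply: measurable_le_set; [exact: measurable_weight|exact: measurable_cst].
move=> [Ss [mSs /seq_weight_le[h0 h]]]; exists Ss; split; first exact: mst_sequence_same mSs.
apply/seq_weight_le; split=> [|i]; first exact: (proj1 (le _) h0).
by rewrite -(subgraph_same _ _ _ _ so); exact: (proj1 (le _) (h i)).
Qed.

Lemma measurable_final_event (b c : R) : measurable [set t | forall Ss : seq {set V},
  seq_weight E (w t) H Ss <= c ->
  b * weight (w t) (mst E (w t) [set: V]%SET) <= weight (w t) (final_subgraph E (w t) H Ss)].
Proof.
pose B (j : {set {set V}} + ({set {set V}} * {set {set V}})) := match j with
  | inl F => [set t | weight (w t) F <= c]
  | inr p => [set t | b * weight (w t) p.1 <= weight (w t) p.2] end.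
apply: (@measurable_of_order _ B) => [[F|p]|t t' so le].
- by apply: measurable_le_set; [exact: measurable_weight|exact: measurable_cst].
- apply: measurable_le_set; last exact: measurable_weight.
  by apply: measurable_realfun.measurable_funM; [exact: measurable_cst|exact: measurable_weight].
move=> h Ss /seq_weight_le[h0 h1].
rewrite /final_subgraph -(subgraph_same _ _ _ _ so) -(mst_same _ _ so).
apply: (proj1 (le (inr (_, _)))); apply: h; apply/seq_weight_le; split=> [|i].
  exact: (proj2 (le (inl _)) h0).
by rewrite (subgraph_same _ _ _ _ so); exact: (proj2 (le (inl _)) (h1 i)).
Qed.

Lemma measurable_cost : measurable_fun [set: T] (fun t => cost E (w t) H).
Proof.
move=> _ B mB; rewrite classical_sets.setTI.
apply: (@measurable_of_order _ (fun F => [set t | B (weight (w t) F)])) => [F|t t' so le].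
  by have := @measurable_weight F measurableT B mB; rewrite classical_sets.setTI.
have [F hF] := cost_val E H (w t).
by rewrite /= (hF (w t)) // (hF (w t')) // => /le.
Qed.

End EventMeasurability.

Local Open Scope classical_set_scope.
Local Open Scope ring_scope.

(** Hence [cost] is a minimum over a nonempty set and not the default value 0. *)
Lemma mst_sequence_setT (R : realType) (V : finType) (E : {set {set V}}) (w : {set V} -> R)
    (H : {set {set V}}) : connected_on [set: V]%SET H -> mst_sequence E w H [:: [set: V]%SET].
Proof.
move=> cH; have HV : Defs.induced H [set: V]%SET = H.
  by apply/finset.setP => e; rewrite finset.inE finset.subsetT andbT.
by rewrite /mst_sequence /final_subgraph /subgraph_seq /= /phi HV cH finset.setDv finset.set0U.
Qed.

Lemma whp_of_eps (R : realType) (d : nat -> measure_display)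
    (T : forall n : nat, measurableType (d n)) (P : forall n : nat, probability (T n) R)
    (A : forall n, set (T n)) : (forall n, measurable (A n)) ->
  (forall eta : R, 0 < eta -> exists n0 : nat, forall n, (n0 <= n)%N -> (P n (~` A n)%classic <= eta%:E)%E) ->
  whp P A.
Proof.
move=> mA h; split=> //.
have fP n : P n (A n) = (fine (P n (A n)))%:E by rewrite fineK // fin_num_measure.
apply/fine_cvgP; split; first by apply: nearW => n; rewrite fin_num_measure.
apply/cvgrPdist_le => e e0; have [n0 hn0] := h e e0.
exists n0 => // n /= n0n; have := hn0 n n0n.
have : (P n (A n) <= 1)%E by exact: probability_le1.
rewrite probability_setC // (fP n) -EFinB !lee_fin => le1 le2.
by rewrite ger0_norm ?subr_ge0.
Qed.

Lemma cvg0_of_eps (R : realType) (u : nat -> \bar R) : (forall n, (0 <= u n)%E) ->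
  (forall eta : R, 0 < eta -> exists n0 : nat, forall n, (n0 <= n)%N -> (u n <= eta%:E)%E) ->
  u n @[n --> \oo] --> 0%E.
Proof.
move=> u0 h; have [n1 hn1] := h 1 ltr01.
have fu n : (n1 <= n)%N -> u n \is a fin_num.
  by move=> /hn1 le; rewrite ge0_fin_numE // (le_lt_trans le) // ltry.
apply/fine_cvgP; split; first by exists n1 => // n /= /fu.
apply/cvgrPdist_le => e e0; have [n0 hn0] := h e e0.
exists (maxn n0 n1) => // n /=; rewrite geq_max => /andP[n0n n1n].
by rewrite sub0r normrN ger0_norm ?fine_ge0 // -lee_fin fineK ?fu // hn0.
Qed.
Theorem theorem1p1 (R : realType) (d : nat -> measure_display)
    (T : forall n : nat, measurableType (d n))
    (P : forall n : nat, probability (T n) R)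
    (X : forall n : nat, {set 'I_n} -> {RV (P n) >-> R})
    (H : forall n : nat, {set {set 'I_n}})
    (X_indep : forall n : nat, mutually_independent (complete_graph n) (X n))
    (X_unif : forall (n : nat) (e : {set 'I_n}),
        e \in complete_graph n -> uniform01 (X n e))
    (H_sub : forall n : nat, (0 < n)%N -> H n \subset complete_graph n)
    (H_conn : forall n : nat, (0 < n)%N -> connected_on [set: 'I_n]%SET (H n)) :
  let K n := complete_graph n in
  let w (n : nat) (t : T n) (e : {set 'I_n}) : R := X n e t in
  (forall eps : R, 0 < eps ->
     whp P (fun n => [set t | exists Ss : seq {set 'I_n},
              mst_sequence (K n) (w n t) (H n) Ss /\
              seq_weight (K n) (w n t) (H n) Ss <= 1 + eps])
     /\
     exists delta : R, 0 < delta /\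
       whp P (fun n => [set t | forall Ss : seq {set 'I_n},
                seq_weight (K n) (w n t) (H n) Ss <= 1 - eps ->
                delta * n%:R * weight (w n t) (mst (K n) (w n t) [set: 'I_n]%SET)
                <= weight (w n t) (final_subgraph (K n) (w n t) (H n) Ss)]))
  /\
  cvg_in_probability P (fun n t => cost (K n) (w n t) (H n)) 1.
Proof.
move=> K w.
have conn_H n : (0 < n)%N -> forall x y, conn (H n) x y.
  by move=> n0 x y; move/connP_on: (H_conn n n0); apply; rewrite finset.in_setT.
have pa (eps eta : R) : 0 < eps -> 0 < eta -> exists n0 : nat, forall n, (n0 <= n)%N ->
    forall Good : set (T n), measurable Good ->
    (forall t, (exists Ss, mst_sequence (K n) (w n t) (H n) Ss /\
       seq_weight (K n) (w n t) (H n) Ss <= 1 + eps) -> Good t) ->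
    (P n (~` Good) <= eta%:E)%E.
  (* The hypotheses on [H n] are only available for [n > 0]. *)
  move=> eps0 eta0; have [n0 h] := light_mst_sequence_prob eps0 eta0; exists (maxn n0 1) => n.
  rewrite geq_max => /andP[n0n n1].
  exact: (h n n0n _ _ (P n) (X n) (H n) (X_indep n) (X_unif n) (H_sub n n1) (conn_H n n1)).
have pb (eps : R) : 0 < eps -> exists Q : nat, (2 <= Q)%N /\ forall eta : R, 0 < eta ->
    exists n0 : nat, forall n, (n0 <= n)%N -> forall Good : set (T n), measurable Good ->
    (forall t, weight (w n t) (mst (K n) (w n t) [set: 'I_n]%SET) <= 60 ->
       (forall Ss, seq_weight (K n) (w n t) (H n) Ss <= 1 - eps ->
         n%:R / (16 * Q%:R) <= weight (w n t) (final_subgraph (K n) (w n t) (H n) Ss)) ->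
       Good t) ->
    (P n (~` Good) <= eta%:E)%E.
  move=> eps0; have [Q [Q2 hQ]] := heavy_final_subgraph_prob eps0; exists Q; split=> // eta eta0.
  have [n0 h] := hQ _ eta0; exists (maxn n0 1) => n.
  rewrite geq_max => /andP[n0n n1].
  exact: (h n n0n _ _ (P n) (X n) (H n) (X_indep n) (X_unif n) (H_sub n n1) (conn_H n n1)).
split; last split.
- move=> eps eps0; split.
    apply: whp_of_eps => [n|eta eta0]; first exact: measurable_mst_event.
    have [n0 h] := pa _ _ eps0 eta0; exists n0 => n n0n.
    by apply: h => //; exact: measurable_mst_event.
  have [Q [Q2 hQ]] := pb _ eps0.
  have Q0 : 0 < Q%:R :> R by rewrite ltr0n ltnW.
  (* The final weight is at least [n / (16 Q)], and the tree weighs at most 60. *)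
  exists (16 * Q%:R * 60)^-1; split; first by rewrite invr_gt0; nra.
  apply: whp_of_eps => [n|eta eta0]; first exact: measurable_final_event.
  have [n0 h] := hQ _ eta0; exists n0 => n n0n.
  apply: h => //; first exact: measurable_final_event.
  move=> t w60 fin Ss /fin; apply: le_trans.
  rewrite -[leLHS]mulrA mulrCA ler_wpM2l // ler_pdivrMl; last by nra.
  by rewrite mulrAC divff ?mul1r //; apply: lt0r_neq0; nra.
- by move=> n; exact: measurable_cost.
move=> eta eta0; apply: cvg0_of_eps => [n|e e0]; first exact: measure_ge0.
have e2 : 0 < e / 2 by rewrite divr_gt0.
have [na ha] := pa _ _ eta0 e2.
have [Q [Q2 hQ]] := pb _ eta0.
have [nb hb] := hQ _ e2.
have Q0 : 0 < Q%:R :> R by rewrite ltr0n ltnW.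
(* 960 is 60 times 16: an MST sequence of weight at most [1 - eta] ends in the tree itself, which
   would then weigh at least [n / (16 Q) > 60]. *)
exists (maxn (maxn na nb) (960 * Q).+1) => n.
rewrite !geq_max => /andP[/andP[nan nbn] nQ].
have n0 : (0 < n)%N by exact: leq_trans nQ.
pose up : set (T n) := [set t | cost (K n) (w n t) (H n) <= 1 + eta].
pose lo : set (T n) := [set t | 1 - eta <= cost (K n) (w n t) (H n)].
have mcost : measurable_fun [set: T n] (fun t => cost (K n) (w n t) (H n)) by exact: measurable_cost.
have mup : measurable up by apply: measurable_le_set => //; exact: measurable_cst.
have mlo : measurable lo by apply: measurable_le_set => //; exact: measurable_cst.
have exSs t : exists Ss, mst_sequence (K n) (w n t) (H n) Ss.
  by exists [:: [set: 'I_n]%SET]; exact: mst_sequence_setT (H_conn n n0).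
have Pup : (P n (~` up) <= (e / 2)%:E)%E.
  apply: ha => // t [Ss [mSs le]]; rewrite /up /=; apply: le_trans le.
  by have [F /(_ (w n t))[//|_ _]] := cost_min (exSs t); apply.
have Plo : (P n (~` lo) <= (e / 2)%:E)%E.
  apply: hb => // t w60 low; rewrite /lo /= leNgt; apply/negP => /ltW clt.
  have [F /(_ (w n t))[//|_ [Ss mSs wSs] _]] := cost_min (exSs t).
  move: (low Ss); rewrite wSs => /(_ clt); rewrite mSs => /le_trans /(_ w60).
  rewrite ler_pdivrMr; last by nra.
  rewrite leNgt => /negP; apply.
  have -> : 60 * (16 * Q%:R) = (960 * Q)%:R :> R by rewrite natrM; ring.
  by rewrite ltr_nat.
have -> : [set t | eta < `|cost (K n) (w n t) (H n) - 1|] = ~` up `|` ~` lo.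
  rewrite -[LHS]classical_sets.setCK -classical_sets.setCI; congr (~` _).
  apply/seteqP; split=> t /=; rewrite /up /lo /= ltNge ler_norml.
    by move=> /negP; rewrite negbK => /andP[l u]; split; lra.
  by move=> [u l]; apply/negP; rewrite negbK; apply/andP; split; lra.
apply: le_trans (measureU2 _ _ _) _; [exact: measurableC|exact: measurableC|].
by apply: le_trans (leeD Pup Plo) _; rewrite -EFinD lee_fin; lra.
Qed.
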